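(* Let $n\ge 3$ be an integer and let $\mathcal{A}_n(a,c)$ be a compact hyperbolic antiprism in $\mathbb{H}^3$ with $2n$ vertices given by its edge lengths $a,c$. Then its hyperbolic volume $V=\mathrm{vol}(\mathcal{A}_n(a,c))$ is given by $$V=n \int_{c_0}^{c} \frac{a\,G+t\,H}{\left(2\cosh^2 t-1-\cosh a\right)\sqrt{R}}\,dt,$$ where $G,H,R$ are the following functions of $t$ (with $a$ and $n$ fixed): $$G=2\left(\cosh t-\cos\frac{\pi}{n}\right)\sinh a\,\sinh t,$$ $$H=-(\cosh a-1)\left(1+\cosh a+2\cosh^2 t-4\cosh t\cos\frac{\pi}{n}\right),$$ $$R=1-\cosh a\,(2+\cosh a)+2\cosh^2 t+4\,(\cosh a-1)\cosh t\cos\frac{\pi}{n}-2\sinh^2 t\,\cos\frac{2\pi}{n},$$ and $c_0$ is the positive root (in the unknown $x$) of the equation $2\cosh x\left(1+\cos\frac{\pi}{n}\right)=1+\cosh a+2\cos\frac{\pi}{n}$.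
   Context: $\mathbb{H}^3$ is hyperbolic $3$-space of constant curvature $-1$. An antiprism $\mathcal{A}_n$ is a (non-degenerate, i.e. $3$-dimensional) convex polyhedron with $2n$ vertices having two equal regular $n$-gons as its top and bottom faces and $2n$ equal triangles as its lateral faces. It has the symmetry group $S_{2n}$, the cyclic group generated by a mirror-rotational symmetry of order $2n$: the composition of the rotation by the angle $\pi/n$ about the axis passing through the centres of the top and bottom faces with the reflection in a plane perpendicular to this axis (which passes through the midpoints of the lateral edges). This group acts transitively on the vertices: the vertices are $V_1,\dots,V_{2n}$ (indices modulo $2n$), where the generator maps $V_i\mapsto V_{i+1}$; the odd-indexed vertices form the top $n$-gon, the even-indexed vertices form the bottom $n$-gon, and the lateral faces are the triangles $V_iV_{i+1}V_{i+2}$. ''Compact'' means that all vertices are (finite) points of $\mathbb{H}^3$. There are two types of edges: $a$ denotes the hyperbolic length of the edges of the top and bottom $n$-gonal faces (the edges $V_iV_{i+2}$), and $c$ denotes the hyperbolic length of the lateral edges (the edges $V_iV_{i+1}$). $\mathcal{A}_n(a,c)$ denotes the antiprism $\mathcal{A}_n$ given by its edge lengths $a,c$. *)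

(* Defs.v *)
From HB Require Import structures.
From mathcomp Require Import all_boot all_order all_algebra.
From mathcomp Require Import all_classical all_reals all_analysis.

Set Implicit Arguments.
Unset Strict Implicit.
Unset Printing Implicit Defensive.
Import Order.TTheory GRing.Theory Num.Theory.
Import numFieldNormedType.Exports.
Local Open Scope classical_set_scope.
Local Open Scope ring_scope.

Definition cosh (R : realType) (x : R) : R := (expR x + expR (- x)) / 2.
Definition sinh (R : realType) (x : R) : R := (expR x - expR (- x)) / 2.

(* Inverse of [cosh] on the nonnegative reals; meaningful for [1 <= x]. *)
Definition arcosh (R : realType) (x : R) : R := ln (x + Num.sqrt (x ^+ 2 - 1)).

(* Hyperbolic 3-space of curvature -1 is represented by its projective
   (Beltrami-Klein) model: the open unit ball [H3] of R^3, in which geodesics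
   are Euclidean segments and planes are traces of Euclidean planes. Hence
   hyperbolic convexity is Euclidean convexity. *)
Definition pt3 (R : realType) : Type := (R * R * R)%type.

Definition dot (R : realType) (p q : pt3 R) : R :=
  p.1.1 * q.1.1 + p.1.2 * q.1.2 + p.2 * q.2.

Definition H3 (R : realType) : set (pt3 R) := [set p | dot p p < 1].

Definition hdist (R : realType) (p q : pt3 R) : R :=
  arcosh ((1 - dot p q) / Num.sqrt ((1 - dot p p) * (1 - dot q q))).

(* In the Klein model of H^d the Riemannian volume element is
   (1 - |p|^2)^(-(d+1)/2) dp. *)
Definition hvolume (R : realType) (A : set (pt3 R)) : \bar R :=
  (\int[((@lebesgue_measure R \x @lebesgue_measure R)
          \x @lebesgue_measure R)]_(p in A)
     (((1 - dot p p) ^+ 2)^-1)%:E)%E.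

Definition hisometry (R : realType) (f : pt3 R -> pt3 R) : Prop :=
  set_bij (@H3 R) (@H3 R) f /\
  forall p q, H3 p -> H3 q -> hdist (f p) (f q) = hdist p q.

(* Rotation by [theta] about the third coordinate axis, composed with the
   reflection in the plane z = 0 orthogonal to it. *)
Definition std_mirror_rotation (R : realType) (theta : R) (p : pt3 R) :
    pt3 R :=
  (cos theta * p.1.1 - sin theta * p.1.2,
   sin theta * p.1.1 + cos theta * p.1.2, - p.2).

(* An arbitrary axis and an arbitrary plane perpendicular to it are carried to
   the standard ones by an isometry. *)
Definition mirror_rotation (R : realType) (theta : R)
    (g : pt3 R -> pt3 R) : Prop :=
  exists2 phi : pt3 R -> pt3 R, hisometry phi &
    forall p, H3 p -> g (phi p) = phi (std_mirror_rotation theta p).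

Definition hull (R : realType) (m : nat) (V : 'I_m -> pt3 R) :
    set (pt3 R) :=
  [set p | exists w : 'I_m -> R,
    [/\ forall i, 0 <= w i, \sum_i w i = 1 &
        p = (\sum_i w i * (V i).1.1, \sum_i w i * (V i).1.2,
             \sum_i w i * (V i).2)]].

Definition coplanar (R : realType) (m : nat) (V : 'I_m -> pt3 R) : Prop :=
  exists u : pt3 R, exists b : R, u <> (0, 0, 0) /\ forall i, dot u (V i) = b.

(* Some supporting plane of [hull V] contains exactly the vertices with index
   in [F]. *)
Definition face (R : realType) (m : nat) (V : 'I_m -> pt3 R)
    (F : pred 'I_m) : Prop :=
  exists u : pt3 R, exists b : R,
    forall i, if F i then dot u (V i) = b else dot u (V i) < b.

(* [hull V] is a compact antiprism with vertices [V]; indices run from 0 to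
   2n - 1 and [ordS] is the successor modulo 2n. That the top and bottom faces
   are regular and congruent, and that the lateral faces are congruent, is
   implied by [ap_symmetry]. *)
Record antiprism (R : realType) (n : nat) (V : 'I_(2 * n) -> pt3 R) : Prop :=
  Antiprism {
    ap_compact : forall i, H3 (V i);
    ap_nondegenerate : ~ coplanar V;
    ap_symmetry : exists2 g, mirror_rotation (pi / n%:R) g &
      forall i, g (V i) = V (ordS i);
    ap_top : face V (fun i => odd i);
    ap_bottom : face V (fun i => ~~ odd i);
    ap_lateral : forall i,
      face V (fun j => j \in [:: i; ordS i; ordS (ordS i)])
  }.

Definition antiprism_G (R : realType) (n : nat) (a t : R) : R :=
  2 * (cosh t - cos (pi / n%:R)) * sinh a * sinh t.

Definition antiprism_H (R : realType) (n : nat) (a t : R) : R :=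
  - (cosh a - 1) *
    (1 + cosh a + 2 * cosh t ^+ 2 - 4 * cosh t * cos (pi / n%:R)).

Definition antiprism_R (R : realType) (n : nat) (a t : R) : R :=
  1 - cosh a * (2 + cosh a) + 2 * cosh t ^+ 2
  + 4 * (cosh a - 1) * cosh t * cos (pi / n%:R)
  - 2 * sinh t ^+ 2 * cos (2 * pi / n%:R).

(* Main.v *)
From HB Require Import structures.
Require Import Defs.
From mathcomp Require Import all_boot all_order all_algebra.
From mathcomp Require Import all_classical all_reals all_analysis.
From mathcomp Require Import measurable_realfun ring lra zify.
Import Order.TTheory GRing.Theory Num.Theory.
Import numFieldNormedType.Exports.
Set Implicit Arguments.
Unset Strict Implicit.
Unset Printing Implicit Defensive.
Local Open Scope classical_set_scope.
Local Open Scope ring_scope.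

(** Why the formula holds.

    In the Klein model hulls are Euclidean hulls and the volume element is
    (1 - |p|^2)^-2 dp. The symmetry of an antiprism is known only up to an
    isometry of the ball, so the polyhedron is first brought to a standard
    position. Every isometry is undone on the ball by a composition of
    rotations of coordinate planes, reflections in coordinate planes and one
    boost along the z axis ([hisometry_motion]); each of these maps preserves
    distances, volumes, hulls and coplanarity ([motion]). The vertices become
    (r cos (i pi / n), r sin (i pi / n), - (-1)^i h) with r, h > 0
    ([antiprism_normal_form]).

    The axis cuts the standard antiprism into 2n sectors of angle pi / n, which
    the mirror rotation permutes. A horizontal slice is a 2n-gon with one corner
    in each sector; the rays from the axis to these corners cut every sector
    into two halves, and a half-turn exchanges the halves. The volume is
    therefore 4n times that of a half sector ([std_antiprism_volume]), whose
    slices are right triangles. Two of the three integrations over a half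
    sector are elementary ([integral_triangle]), and what remains is the
    integral over u = z / h in [-1, 1] of [slice_density], which up to a
    rational factor and square roots is the hyperbolic length of half a side of
    the slice ([half_sector_volume]).

    That integral is not computed directly; its derivative in the height of the
    vertices is elementary. Let q and s be the cosine and the sine of pi / n,
    and let b and eta be the radial and the axial coordinate of a vertex in the
    hyperboloid model; then cosh a = 1 + 2 b^2 s^2 and cosh c = 1 + 2 (eta^2 +
    b^2 (1 - q) / 2). For fixed a the antiprism is parametrized by eta, and it
    collapses to a plane polygon at eta = 0, where c = c0. The derivative of
    [slice_density] in eta is the derivative in u of an explicit function
    ([variation_primitive_deru]), so the derivative of the volume in eta is a
    difference of boundary values, a combination of the edge lengths a and c,
    as Schlaefli's formula predicts ([slice_volume_der]). Integrating from eta
    = 0, where the volume vanishes, and taking the lateral edge length t as the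
    variable instead of eta gives the integrand (a G + t H) / ... of the
    theorem ([edge_length_integral]). *)

(** * Change of variables for the Lebesgue integral *)
Section density_transport.
Local Open Scope ereal_scope.
Context (R : realType).
Notation lam := (@lebesgue_measure R).
Variables (D E : set R) (phi w : R -> R).
Hypothesis mD : measurable D.
Hypothesis mE : measurable E.
Hypothesis mphi : measurable_fun D phi.
Hypothesis mw : measurable_fun D w.
Hypothesis w0 : forall x, D x -> (0 <= w x)%R.
Hypothesis wE : forall u v : R, (u < v)%R ->
  \int[lam]_(x in D `&` phi @^-1` `]u, v]) (w x)%:E = lam (`]u, v] `&` E).

Let mpre A : measurable A -> measurable (D `&` phi @^-1` A).
Proof. by move=> mA; exact: mphi. Qed.

Let nu (A : set R) := \int[lam]_(x in D `&` phi @^-1` A) (w x)%:E.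

Let nu0 : nu set0 = 0.
Proof. by rewrite /nu preimage_set0 setI0 integral_set0. Qed.

Let nu_ge0 A : 0 <= nu A.
Proof. by apply: integral_ge0 => x [Dx _]; rewrite lee_fin w0. Qed.

Let nu_sadd : semi_sigma_additive nu.
Proof.
move=> F mF tF mUF; rewrite /nu preimage_bigcup setI_bigcupr.
rewrite ge0_integral_bigcup; last first.
- apply/trivIsetP => i j _ _ ij; move/trivIsetP : tF => /(_ i j I I ij) Fij.
  by rewrite setIACA setIid -preimage_setI Fij preimage_set0 setI0.
- by move=> x [i _ [Dx _]]; rewrite lee_fin w0.
- by apply/measurable_EFinP; apply: measurable_funS mw => //; move=> x [i _ []].
- by move=> k; exact: mpre.
apply: is_cvg_ereal_nneg_natsum_cond => n _ _.
by apply: integral_ge0 => x [Dx _]; rewrite lee_fin w0.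
Qed.

(** Both sides are measures in [A], finite on the intervals ]-k, k], so it is
    enough that they agree on half-open intervals, which is [wE]. *)
Let nuE A : measurable A -> nu A = lam (A `&` E).
Proof.
move=> mA.
have mJ k : measurable (`] (- k%:R)%R, (k%:R)%R] : set (measurableTypeR R)) by [].
pose nuM : {measure set (measurableTypeR R) -> \bar R} :=
  HB.pack nu (isMeasure.Build _ (measurableTypeR R) R nu nu0 nu_ge0 nu_sadd).
pose lamE : {measure set (measurableTypeR R) -> \bar R} := mrestr lam mE.
suff : nuM A = lamE A by [].
apply: (@measure_unique _ _ (measurableTypeR R) (@ocitv R)
    (fun k => `] (- k%:R)%R, (k%:R)%R]%classic)) => //.
- exact: ocitvI.
- by move=> k; exact: is_ocitv.
- by rewrite bigcup_itvT.
- move=> _ /ocitvP[->|[[u v] /= uv ->]]; first by rewrite !measure0.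
  exact: wE.
- move=> k /=; rewrite -[ltLHS]/(nu _).
  case: k => [|k]; first by rewrite oppr0 set_itvoc0 nu0.
  rewrite [ltLHS]wE; last by rewrite gtrN// ltr0n.
  apply: le_lt_trans (_ : lam `](- k.+1%:R)%R, (k.+1%:R)%R] < +oo).
    by apply: le_measure; rewrite ?inE//; exact: measurableI.
  by rewrite lebesgue_measure_itv/=; case: ifP => _; rewrite ?ltry.
Qed.

Import HBNNSimple.

(** The hypothesis [wE] says that [phi] pushes the measure of density [w] on [D]
    forward to the Lebesgue measure on [E], tested on intervals only. Simple
    functions and monotone convergence do the rest. *)
Lemma ge0_integral_transport (f : R -> \bar R) :
  measurable_fun setT f -> (forall x, 0 <= f x) ->
  \int[lam]_(x in D) (f (phi x) * (w x)%:E) = \int[lam]_(y in E) f y.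
Proof.
move=> mf f0; pose f_ := nnsfun_approx measurableT mf.
have f_cvg y : (f_ n y)%:E @[n --> \oo] --> f y.
  by apply: cvg_nnsfun_approx => // *; exact: f0.
have mf_ n : measurable_fun setT (f_ n) by exact: measurable_funP.
have nd_ (y : R) m n : (m <= n)%N -> (f_ m y <= f_ n y)%R.
  by move=> mn; exact/lefP/nd_nnsfun_approx.
have mwE : measurable_fun D (EFin \o w) by exact/measurable_EFinP.
transitivity (limn (fun n => \int[lam]_(x in D) ((f_ n (phi x))%:E * (w x)%:E))).
  rewrite -monotone_convergence//.
  - apply: eq_integral => x /[!inE] Dx; apply/esym/cvg_lim => //.
    by apply: cvgeZr => //; exact: f_cvg.
  - move=> n; apply: emeasurable_funM => //; apply/measurable_EFinP.
    exact: measurableT_comp.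
  - by move=> n x Dx; rewrite mule_ge0// lee_fin ?w0.
  - move=> x Dx m n mn; rewrite lee_wpmul2r ?lee_fin ?w0//.
    exact: nd_.
transitivity (limn (fun n => \int[lam]_(y in E) (f_ n y)%:E)); last first.
  rewrite -monotone_convergence//.
  - by apply: eq_integral => x _; apply/cvg_lim.
  - by move=> n; apply/measurable_EFinP; exact: measurable_funTS (mf_ n).
  - by move=> n x _; rewrite lee_fin.
  - by move=> x _ m n mn; rewrite lee_fin; exact: nd_.
congr (limn _); apply/funext => n.
have mS r : measurable (f_ n @^-1` [set r] : set R) by exact: measurable_funPTI.
have mi r : measurable_fun setT (\1_(f_ n @^-1` [set r]) : R -> R).
  exact: measurable_indic.
transitivity (\sum_(k \in range (f_ n)) \int[lam]_(x in D)
   (k%:E * (\1_(f_ n @^-1` [set k]) (phi x) * w x)%:E)).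
  rewrite -ge0_integral_fsum//.
  - apply: eq_integral => x /[!inE] Dx.
    rewrite fimfunE -fsumEFin// ge0_mule_fsuml; last first.
      by move=> r; rewrite EFinM nnfun_muleindic_ge0.
    by apply: eq_fsbigr => r _; rewrite !EFinM muleA.
  - move=> r; apply: emeasurable_funM => //; apply/measurable_EFinP.
    apply: measurable_funM => //.
    by apply: measurableT_comp.
  - move=> r x Dx; rewrite EFinM muleA mule_ge0 ?lee_fin ?w0//.
    by have := nnfun_muleindic_ge0 (f_ n) r (phi x); rewrite -EFinM lee_fin.
transitivity (\sum_(k \in range (f_ n)) \int[lam]_(y in E)
   (k * \1_(f_ n @^-1` [set k]) y)%:E); last first.
  rewrite -ge0_integral_fsum//.
  - by apply: eq_integral => x _; rewrite fimfunE -fsumEFin.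
  - by move=> r; apply/measurable_EFinP; apply: measurable_funM => //; exact: measurable_funTS (mi r).
  - by move=> r x _; rewrite EFinM nnfun_muleindic_ge0.
apply: eq_fsbigr => r /[!inE] -[z _ zr].
have r0 : (0 <= r)%R by rewrite -zr.
rewrite ge0_integralZl_EFin//; last 2 first.
- by move=> x Dx; rewrite lee_fin mulr_ge0 ?w0// indicE.
- apply/measurable_EFinP; apply: measurable_funM => //.
  by apply: measurableT_comp.
under [RHS]eq_integral do rewrite EFinM.
rewrite ge0_integralZl_EFin//; last by apply/measurable_EFinP; exact: measurable_funTS (mi r).
congr (_ * _); transitivity (nu (f_ n @^-1` [set r])); last first.
  rewrite nuE//.
  by apply/esym; exact: (integral_indic lam mE (mS r)).
rewrite /nu integral_mkcondr; apply: eq_integral => x _.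
rewrite /patch indicE; case: (boolP (x \in phi @^-1` _)) => /=.
  by rewrite inE => xS; rewrite mem_set ?mul1r.
by move=> xS; rewrite memNset ?mul0r//; move/negP: xS; rewrite inE.
Qed.

End density_transport.

Section change_of_variables.
Context (R : realType).
Notation lam := (@lebesgue_measure R).

(** Two-sided differentiability at the end points is assumed because every
    primitive below is differentiable on a neighbourhood of the segment. *)
Lemma FTC_segment (F f : R -> R) (a b : R) : a <= b ->
  (forall x, x \in `[a, b] -> is_derive x 1 F (f x)) ->
  (forall x, x \in `[a, b] -> {for x, continuous f}) ->
  (\int[lam]_(x in `[a, b]) (f x)%:E = (F b - F a)%:E)%E.
Proof.
rewrite le_eqVlt => /predU1P[<- _ _|ab dF cf].
  by rewrite set_itv1 integral_set1 subrr.
have cF x : x \in `[a, b] -> {for x, continuous F}.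
  by move=> xab; apply/differentiable_continuous/derivable1_diffP; case: (dF x xab).
rewrite (@continuous_FTC2 _ f F)//.
- by apply: continuous_in_subspaceT => x /[!inE]; exact: cf.
- split.
  + by move=> x /subset_itv_oo_cc xab; case: (dF x xab).
  + by apply: cvg_at_right_filter; apply: cF; rewrite in_itv/= lexx ltW.
  + by apply: cvg_at_left_filter; apply: cF; rewrite in_itv/= lexx ltW.
- move=> x /subset_itv_oo_cc xab; rewrite derive1E.
  by case: (dF x xab).
Qed.

Lemma ge0_integral_affine (al be : R) (f : R -> \bar R) : al != 0 ->
  measurable_fun setT f -> (forall x, 0 <= f x)%E ->
  (\int[lam]_x (f (al * x + be)%R * `|al|%:E) = \int[lam]_y f y)%E.
Proof.
move=> al0 mf f0.
have mphi : measurable_fun setT (fun x : R => al * x + be).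
  by apply: measurable_funD => //; exact: measurable_funM.
apply: (@ge0_integral_transport R setT setT (fun x => al * x + be) (cst `|al|)) => //.
move=> u v uv; rewrite setTI setIT.
have mpre : measurable ((fun x : R => al * x + be) @^-1` `]u, v]).
  by rewrite -[X in measurable X]setTI; exact: mphi.
transitivity (`|al|%:E * lam ((fun x : R => (al * x + be)%R) @^-1` `]u, v]))%E.
  exact: (integral_cst lam mpre (`|al|%:E)).
have al0' : `|al| != 0 by rewrite normr_eq0.
case: (ltgtP al 0) => [an|ap|/eqP]; last by rewrite (negPf al0).
- have -> : (fun x : R => al * x + be) @^-1` `]u, v] = `[(v - be) / al, (u - be) / al[%classic.
    apply/seteqP; split => x /=; rewrite !in_itv/= ler_ndivrMr// ltr_ndivlMr// => /andP[]; lra.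
  rewrite !lebesgue_measure_itv/= !lte_fin uv ltr_ndivlMr// divfK ?lt_eqF// ltrD2r uv.
  by rewrite ltr0_norm// -!EFinD -EFinM; congr EFin; field; rewrite lt_eqF.
- have -> : (fun x : R => al * x + be) @^-1` `]u, v] = `](u - be) / al, (v - be) / al]%classic.
    apply/seteqP; split => x /=; rewrite !in_itv/= ler_pdivlMr// ltr_pdivrMr// => /andP[]; lra.
  rewrite !lebesgue_measure_itv/= !lte_fin uv ltr_pdivrMr// divfK ?gt_eqF// ltrD2r uv.
  by rewrite gtr0_norm// -!EFinD -EFinM; congr EFin; field; rewrite gt_eqF.
Qed.

Section increasing.
Variables (phi dphi : R -> R) (a b : R).
Hypothesis ab : a < b.
Hypothesis phi_der : forall x, x \in `[a, b] -> is_derive x 1 phi (dphi x).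
Hypothesis dphi_cont : forall x, x \in `[a, b] -> {for x, continuous dphi}.
Hypothesis dphi_gt0 : forall x, x \in `]a, b[ -> 0 < dphi x.

Let cphi x : x \in `[a, b] -> {for x, continuous phi}.
Proof.
by move=> xab; apply/differentiable_continuous/derivable1_diffP; case: (phi_der xab).
Qed.

Let phi_mono : {in `[a, b] &, {mono phi : x y / x < y}}.
Proof.
have homo : {in `[a, b] &, {homo phi : x y / x < y}}.
  apply: gtr0_derive1_lt_cc.
  - by move=> x /subset_itv_oo_cc xab; case: (phi_der xab).
  - move=> x xab; rewrite derive1E; have [_ ->] := phi_der (subset_itv_oo_cc xab).
    exact: dphi_gt0.
  - by apply: continuous_in_subspaceT => x /[!inE]; exact: cphi.
move=> x y xab yab; case: (ltgtP x y) => [xy|yx|->].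
- exact: homo.
- by apply/negbTE; rewrite -leNgt ltW// homo.
- by rewrite ltxx.
Qed.

Let phi_le : {in `[a, b] &, {mono phi : x y / x <= y}}.
Proof. by move=> x y xab yab; rewrite !leNgt phi_mono. Qed.

Let aab : a \in `[a, b]. Proof. by rewrite in_itv/= lexx ltW. Qed.
Let bab : b \in `[a, b]. Proof. by rewrite in_itv/= lexx ltW. Qed.

Let onto y : phi a <= y <= phi b -> exists2 x, x \in `[a, b] & phi x = y.
Proof.
move=> yab; apply: IVT; first exact: ltW.
  by apply: continuous_in_subspaceT => x /[!inE]; exact: cphi.
have pab : phi a <= phi b by rewrite phi_le// ltW.
by rewrite min_l// max_r.
Qed.

(** The preimage of an interval under an increasing function is an interval, up
    to one end point, over which [dphi] is integrated by the fundamental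
    theorem. *)
Let transport_itv (u v : R) : u < v ->
  (\int[lam]_(x in `]a, b[ `&` phi @^-1` `]u, v]) (dphi x)%:E =
   lam (`]u, v] `&` `]phi a, phi b[))%E.
Proof.
move=> uv.
have pab : phi a < phi b by rewrite phi_mono.
(* The intersection of the two intervals has end points u' and v'. *)
pose u' := Num.max u (phi a); pose v' := Num.min v (phi b).
have [v'u'|u'v'] := leP v' u'.
  have e1 : `]u, v] `&` `]phi a, phi b[ = set0 :> set R.
    rewrite -subset0 => y /=; rewrite !in_itv/= => -[/andP[uy yv] /andP[ay yb]].
    move: v'u'; rewrite leNgt => /negP; apply.
    apply: (@lt_le_trans _ _ y); first by rewrite /u' gt_max uy ay.
    by rewrite /v' le_min yv ltW.
  have e2 : `]a, b[ `&` phi @^-1` `]u, v] = set0 :> set R.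
    rewrite -subset0 => x /=; rewrite in_itv/= => -[/andP[ax xb] phx].
    have xab : x \in `[a, b] by rewrite in_itv/= !ltW.
    suff : (`]u, v] `&` `]phi a, phi b[) (phi x) by rewrite e1.
    by split => //=; rewrite in_itv/= !phi_mono// ax xb.
  by rewrite e1 e2 measure0 integral_set0.
have [ua av] : phi a <= u' /\ v' <= phi b by rewrite /u' /v' le_max ge_min !lexx !orbT.
have [uu vv] : u <= u' /\ v' <= v by rewrite /u' /v' le_max ge_min !lexx.
have [p pab_ pu] : exists2 x, x \in `[a, b] & phi x = u'.
  by apply: onto; rewrite ua (le_trans (ltW u'v')).
have [q qab_ qv] : exists2 x, x \in `[a, b] & phi x = v'.
  by apply: onto; rewrite av andbT (le_trans ua)// ltW.
have pq : p < q by rewrite -phi_mono// pu qv.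
have ap : a <= p by move: pab_; rewrite in_itv/= => /andP[].
have qb : q <= b by move: qab_; rewrite in_itv/= => /andP[].
have sub x : x \in `[p, q] -> x \in `[a, b].
  by rewrite !in_itv/= => /andP[px xq]; rewrite (le_trans ap)//= (le_trans xq).
have mlt y : (u' < y) = (u < y) && (phi a < y) by rewrite /u' gt_max.
have mgt y : (y < v') = (y < v) && (y < phi b) by rewrite /v' lt_min.
(* [q] may lie in the preimage, as ]u, v] contains its right end point. *)
have e1 : (`]a, b[ `&` phi @^-1` `]u, v]) `\ q = `]p, q[%classic.
  apply/seteqP; split => x /=; rewrite !in_itv/=.
    move=> [[/andP[ax xb] /andP[ux xv]] xq].
    have xab : x \in `[a, b] by rewrite in_itv/= !ltW.
    rewrite -phi_mono// pu mlt ux phi_mono// ax/=.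
    rewrite -phi_mono// qv lt_neqAle le_min xv/= phi_le// (ltW xb) andbT.
    rewrite -qv; apply/eqP => /eqP; rewrite eq_le !phi_le// -eq_le => /eqP; exact: xq.
  move=> /andP[px xq].
  have xab : x \in `[a, b] by apply: sub; rewrite in_itv/= !ltW.
  have := phi_mono pab_ xab; rewrite px pu mlt phi_mono// => /andP[-> ->].
  have := phi_mono xab qab_; rewrite xq qv mgt phi_mono// => /andP[/ltW -> ->].
  by split => // xqE; move: xq; rewrite xqE ltxx.
have e2 : (`]u, v] `&` `]phi a, phi b[) `\ v' = `]u', v'[%classic.
  apply/seteqP; split => y /=; rewrite !in_itv/=.
    move=> [[/andP[uy yv] /andP[ay yb]] yv'].
    by rewrite mlt uy ay/= lt_neqAle le_min yv (ltW yb) !andbT; apply/eqP.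
  rewrite mlt mgt => /andP[/andP[-> ->] /andP[yv yb]]; rewrite (ltW yv) yb.
  by split => // yE; move: yv yb; rewrite yE /v' minEle; case: ifPn; rewrite ?ltxx.
have mdphi : measurable_fun `]p, q[ (EFin \o dphi).
  apply/measurable_EFinP; apply: subspace_continuous_measurable_fun => //.
  apply: continuous_in_subspaceT => x /[!inE] /= xpq.
  by apply: dphi_cont; apply: sub; exact: subset_itv_oo_cc.
rewrite -(@integral_setD1 _ _ q) e1//.
rewrite -(@integral_itv_bndoo _ p q _ true false)//.
have -> := @FTC_segment phi dphi p q (ltW pq)
  (fun x xpq => phi_der (sub x xpq)) (fun x xpq => dphi_cont (sub x xpq)).
rewrite pu qv.
have mS : measurable (`]u, v] `&` `]phi a, phi b[ : set R) by exact: measurableI.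
rewrite -[RHS]mul1e -(integral_cst lam mS) -(@integral_setD1 _ _ v') e2//.
by rewrite integral_cst//= mul1e lebesgue_measure_itv/= lte_fin u'v' EFinB.
Qed.

Let mphi : measurable_fun `]a, b[ phi.
Proof.
apply: subspace_continuous_measurable_fun => //.
by apply: continuous_in_subspaceT => x /[!inE] /= /subset_itv_oo_cc; exact: cphi.
Qed.

Let mdphi : measurable_fun `]a, b[ dphi.
Proof.
apply: subspace_continuous_measurable_fun => //.
by apply: continuous_in_subspaceT => x /[!inE] /= /subset_itv_oo_cc; exact: dphi_cont.
Qed.

Lemma ge0_integral_increasing (f : R -> \bar R) :
  measurable_fun setT f -> (forall x, 0 <= f x)%E ->
  (\int[lam]_(y in `]phi a, phi b[) f y =
   \int[lam]_(x in `]a, b[) (f (phi x) * (dphi x)%:E))%E.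
Proof.
move=> mf f0; rewrite (@ge0_integral_transport R `]a, b[ `]phi a, phi b[)//.
by move=> x /= xab; exact/ltW/dphi_gt0.
Qed.

Lemma integral_increasing (f : R -> \bar R) :
  measurable_fun setT f ->
  (\int[lam]_(y in `]phi a, phi b[) f y =
   \int[lam]_(x in `]a, b[) (f (phi x) * (dphi x)%:E))%E.
Proof.
move=> mf; rewrite [LHS]integralE [RHS]integralE; congr (_ - _)%E.
- rewrite ge0_integral_increasing//; last exact: measurable_funepos.
  apply: eq_integral => x /[!inE] /= xab; rewrite !funeposE.
  by rewrite maxe_pMl ?mul0e// ?lee_fin ltW// dphi_gt0.
- rewrite ge0_integral_increasing//; last exact: measurable_funeneg.
  apply: eq_integral => x /[!inE] /= xab; rewrite !funenegE.
  by rewrite -mulNe maxe_pMl ?mul0e// ?lee_fin ltW// dphi_gt0.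
Qed.

End increasing.
End change_of_variables.

(** * Derivatives, continuity and measurability of explicit formulas *)

(** The rules below are stated for eta-expanded functions, so that the tactics
    [der], [cts] and [meas] can follow the syntax of an expression. *)
Section pointwise_derivatives.
Context (R : realType).
Implicit Types (f g : R -> R) (x : R).

Lemma der_cst (c x : R) : is_derive x 1 (fun=> c) 0.
Proof. exact: is_derive_cst. Qed.

Lemma der_id x : is_derive x 1 (fun y : R => y) 1.
Proof. exact: is_derive_id. Qed.

Lemma der_add f g x df dg : is_derive x 1 f df -> is_derive x 1 g dg ->
  is_derive x 1 (fun y => f y + g y) (df + dg).
Proof. by move=> hf hg; exact: is_deriveD. Qed.

Lemma der_opp f x df : is_derive x 1 f df -> is_derive x 1 (fun y => - f y) (- df).
Proof. by move=> hf; exact: is_deriveN. Qed.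

Lemma der_mul f g x df dg : is_derive x 1 f df -> is_derive x 1 g dg ->
  is_derive x 1 (fun y => f y * g y) (df * g x + f x * dg).
Proof.
move=> hf hg; apply: is_derive_eq (is_deriveM hf hg) _.
by rewrite /GRing.scale/= addrC [g x * _]mulrC.
Qed.

Lemma der_exp f n x df : is_derive x 1 f df ->
  is_derive x 1 (fun y => f y ^+ n.+1) (n.+1%:R * f x ^+ n * df).
Proof.
move=> hf; elim: n => [|n ih].
  by apply: is_derive_eq hf _; rewrite expr0 !mul1r.
apply: is_derive_eq (der_mul hf ih) _.
by rewrite -[in RHS]natr1 exprS; ring.
Qed.

Lemma der_inv f x df : f x != 0 -> is_derive x 1 f df ->
  is_derive x 1 (fun y => (f y)^-1) (- df / f x ^+ 2).
Proof.
move=> fx0 hf; apply: is_derive_eq (is_deriveV fx0 hf) _.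
by rewrite /GRing.scale/= mulNr mulNr mulrC.
Qed.

Lemma der_comp f g x df dg : is_derive (g x) 1 f df -> is_derive x 1 g dg ->
  is_derive x 1 (fun y => f (g y)) (df * dg).
Proof. by move=> hf hg; exact: is_derive1_comp. Qed.

Lemma der_sqrt f x df : 0 < f x -> is_derive x 1 f df ->
  is_derive x 1 (fun y => Num.sqrt (f y)) (df / (2 * Num.sqrt (f x))).
Proof.
move=> fx hf; apply: is_derive_eq (der_comp (is_derive1_sqrt fx) hf) _.
by rewrite mulrC.
Qed.

Lemma der_ln f x df : 0 < f x -> is_derive x 1 f df ->
  is_derive x 1 (fun y => ln (f y)) (df / f x).
Proof.
move=> fx hf; apply: is_derive_eq (der_comp (is_derive1_ln fx) hf) _.
by rewrite mulrC.
Qed.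

Lemma der_expR f x df : is_derive x 1 f df ->
  is_derive x 1 (fun y => expR (f y)) (expR (f x) * df).
Proof. by move=> hf; exact: (der_comp (is_derive_expR _) hf). Qed.

Definition artanh (x : R) : R := (ln (1 + x) - ln (1 - x)) / 2.

Lemma der_artanh f x df : `|f x| < 1 -> is_derive x 1 f df ->
  is_derive x 1 (fun y => artanh (f y)) (df / (1 - f x ^+ 2)).
Proof.
rewrite ltr_norml => /andP[f1 f2] hf.
have p1 : 0 < 1 + f x by lra.
have p2 : 0 < 1 - f x by lra.
rewrite /artanh.
have h1 := @der_ln (fun y => 1 + f y) x _ p1 (der_add (der_cst 1 x) hf).
have h2 := @der_ln (fun y => 1 - f y) x _ p2 (der_add (der_cst 1 x) (der_opp hf)).
have h := der_mul (der_add h1 (der_opp h2)) (der_cst (2^-1) x).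
apply: is_derive_eq h _.
have -> : 1 - f x ^+ 2 = (1 + f x) * (1 - f x) by ring.
by field; rewrite !gt_eqF.
Qed.

End pointwise_derivatives.

Ltac der1 := lazymatch goal with
 | |- is_derive _ _ (fun _ => ?c) _ => exact: der_cst
 | |- is_derive _ _ (fun y => y) _ => exact: der_id
 | |- is_derive _ _ (fun y => @?f y + @?g y) _ => notypeclasses refine (@der_add _ f g _ _ _ _ _)
 | |- is_derive _ _ (fun y => - (@?f y)) _ => notypeclasses refine (@der_opp _ f _ _ _)
 | |- is_derive _ _ (fun y => @?f y * @?g y) _ => notypeclasses refine (@der_mul _ f g _ _ _ _ _)
 | |- is_derive _ _ (fun y => @?f y ^+ ?n.+1) _ => notypeclasses refine (@der_exp _ f n _ _ _)
 | |- is_derive _ _ (fun y => (@?f y)^-1) _ => notypeclasses refine (@der_inv _ f _ _ _ _)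
 | |- is_derive _ _ (fun y => Num.sqrt (@?f y)) _ => notypeclasses refine (@der_sqrt _ f _ _ _ _)
 | |- is_derive _ _ (fun y => ln (@?f y)) _ => notypeclasses refine (@der_ln _ f _ _ _ _)
 | |- is_derive _ _ (fun y => expR (@?f y)) _ => notypeclasses refine (@der_expR _ f _ _ _)
 | |- is_derive _ _ (fun y => artanh (@?f y)) _ => notypeclasses refine (@der_artanh _ f _ _ _ _)
 end.
Ltac der := repeat der1.

Section pointwise_continuity.
Context (R : realType) (T : topologicalType).
Implicit Types (f g : T -> R) (x : T).

Lemma cts_cst (c : R) x : {for x, continuous (fun=> c : R)}.
Proof. exact: cst_continuous. Qed.

Lemma cts_add f g x : {for x, continuous f} -> {for x, continuous g} ->
  {for x, continuous (fun y => f y + g y)}.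
Proof. by move=> hf hg; exact: continuousD. Qed.

Lemma cts_opp f x : {for x, continuous f} -> {for x, continuous (fun y => - f y)}.
Proof. by move=> hf; exact: continuousN. Qed.

Lemma cts_mul f g x : {for x, continuous f} -> {for x, continuous g} ->
  {for x, continuous (fun y => f y * g y)}.
Proof. by move=> hf hg; exact: continuousM. Qed.

Lemma cts_comp (h : R -> R) f x : {for f x, continuous h} -> {for x, continuous f} ->
  {for x, continuous (fun y => h (f y))}.
Proof. by move=> hf hg; apply: continuous_comp. Qed.

Lemma cts_exp f n x : {for x, continuous f} -> {for x, continuous (fun y => f y ^+ n)}.
Proof. by move=> hf; apply: (cts_comp (h := fun z => z ^+ n)) => //; exact: exprn_continuous. Qed.

Lemma cts_inv f x : f x != 0 -> {for x, continuous f} ->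
  {for x, continuous (fun y => (f y)^-1)}.
Proof. by move=> f0 hf; apply: continuousV. Qed.

Lemma cts_sqrt f x : {for x, continuous f} -> {for x, continuous (fun y => Num.sqrt (f y))}.
Proof. by move=> hf; apply: cts_comp => //; exact: sqrt_continuous. Qed.

Lemma cts_ln f x : 0 < f x -> {for x, continuous f} -> {for x, continuous (fun y => ln (f y))}.
Proof. by move=> f0 hf; apply: cts_comp => //; exact: continuous_ln. Qed.

Lemma cts_expR f x : {for x, continuous f} -> {for x, continuous (fun y => expR (f y))}.
Proof. by move=> hf; apply: cts_comp => //; exact: continuous_expR. Qed.

Lemma cts_artanh f x : `|f x| < 1 -> {for x, continuous f} ->
  {for x, continuous (fun y => artanh (f y))}.
Proof.
rewrite ltr_norml => /andP[f1 f2] hf; apply: cts_mul; last exact: cts_cst.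
apply: cts_add; last apply: cts_opp; apply: cts_ln; try lra.
  by apply: cts_add => //; exact: cts_cst.
by apply: cts_add; [exact: cts_cst|exact: cts_opp].
Qed.

End pointwise_continuity.

Ltac cts1 := lazymatch goal with
 | |- {for _, continuous (fun _ => ?c)} => exact: cts_cst
 | |- {for _, continuous (fun y => y)} => exact: cvg_id
 | |- {for _, continuous (fun y => y.1)} => exact: cvg_fst
 | |- {for _, continuous (fun y => y.2)} => exact: cvg_snd
 | |- {for _, continuous (fun y => @?f y + @?g y)} => refine (@cts_add _ _ f g _ _ _)
 | |- {for _, continuous (fun y => - (@?f y))} => refine (@cts_opp _ _ f _ _)
 | |- {for _, continuous (fun y => @?f y * @?g y)} => refine (@cts_mul _ _ f g _ _ _)
 | |- {for _, continuous (fun y => @?f y ^+ ?n)} => refine (@cts_exp _ _ f n _ _)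
 | |- {for _, continuous (fun y => (@?f y)^-1)} => refine (@cts_inv _ _ f _ _ _)
 | |- {for _, continuous (fun y => Num.sqrt (@?f y))} => refine (@cts_sqrt _ _ f _ _)
 | |- {for _, continuous (fun y => ln (@?f y))} => refine (@cts_ln _ _ f _ _ _)
 | |- {for _, continuous (fun y => expR (@?f y))} => refine (@cts_expR _ _ f _ _)
 | |- {for _, continuous (fun y => artanh (@?f y))} => refine (@cts_artanh _ _ f _ _ _)
 end.
Ltac cts := repeat cts1.

Lemma measurable_funV d (T : measurableType d) (R : realType) (D : set T) (f : T -> R) :
  measurable_fun D f -> measurable_fun D (fun x => (f x)^-1).
Proof.
move=> mf; apply: (measurableT_comp (f := @GRing.inv R)) => //.
have -> : [set: R] = [set~ 0] `|` [set 0] by rewrite setUC setUv.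
have m0 : measurable ([set~ 0] : set R) by exact: measurableC.
apply/measurable_funU => //; split; last exact: measurable_fun_set1.
apply: subspace_continuous_measurable_fun => //.
apply: continuous_in_subspaceT => x /[!inE] /= x0.
by apply: inv_continuous; apply/eqP.
Qed.

Lemma measurable_fun_sqrt d (T : measurableType d) (R : realType) (D : set T) (f : T -> R) :
  measurable_fun D f -> measurable_fun D (fun x => Num.sqrt (f x)).
Proof.
move=> mf; apply: (measurableT_comp (f := @Num.sqrt R)) => //.
by apply: continuous_measurable_fun; exact: sqrt_continuous.
Qed.

Ltac meas1 := lazymatch goal with
 | |- measurable_fun _ (fun _ => ?c) => exact: measurable_cst
 | |- measurable_fun _ (fun y => y) => exact: measurable_id
 | |- measurable_fun _ (fun y => @?f y + @?g y) => notypeclasses refine (measurable_funD (f := f) (g := g) _ _)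
 | |- measurable_fun _ (fun y => - (@?f y)) => notypeclasses refine (measurable_funN (f := f) _)
 | |- measurable_fun _ (fun y => @?f y * @?g y) => notypeclasses refine (measurable_funM (f := f) (g := g) _ _)
 | |- measurable_fun _ (fun y => @?f y ^+ ?n) => notypeclasses refine (measurable_funX (f := f) n _)
 | |- measurable_fun _ (fun y => (@?f y)^-1) => notypeclasses refine (measurable_funV (f := f) _)
 | |- measurable_fun _ (fun y => Num.sqrt (@?f y)) => notypeclasses refine (measurable_fun_sqrt (f := f) _)
 end.
Ltac meas := repeat meas1.

(** * The integral over the slices as a function of the height *)

(** Rational identities behind the primitive of the height derivative. The
    unknowns [l0] and [l1] of an ansatz are determined by matching coefficients;
    [W0] is their common denominator. [k2] stands for [apothem_form]. *)
Section algebra.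
Variable (R : realFieldType).
Variables (k2 h u b d0 d1 : R).
Let de := d0 - u * d1.
Let X := k2 + h ^+ 2 * u ^+ 2 + b ^+ 2 * de ^+ 2.
Let c := X - h ^+ 2.
Let N := k2 + b ^+ 2 * de ^+ 2.
Let W0 := h ^+ 2 * X + b ^+ 2 * d1 ^+ 2 * X - b ^+ 2 * d0 ^+ 2 * h ^+ 2.
Let l1 := d0 * (- h ^+ 4 + b ^+ 2 * d1 ^+ 2 * c) / W0.
Let l0 := d1 * (X ^+ 2 - b ^+ 2 * d0 ^+ 2 * c) / W0.
Let M := c * u * de / N + (l0 + l1 * u).
Let dM := c * (de - u * d1) / N + 2 * c * u ^+ 2 * de * h ^+ 2 / N ^+ 2 + l1.
Let kk' := - h ^+ 2 * u + b ^+ 2 * de * d1.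

Lemma weight_primitive_identity : N != 0 -> W0 != 0 ->
  dM * k2 - M * kk' = de * ((X + h ^+ 2) * k2 / N
    - 2 * h ^+ 2 * X * (1 - u ^+ 2) * k2 / N ^+ 2
    - h ^+ 2 * X * (1 - u ^+ 2) / N).
Proof.
rewrite /dM /M /l0 /l1 /kk' /c /W0 /N /X /de => N0 W00; field.
by rewrite !exprMn N0 W00.
Qed.

Lemma boundary_remainder_identity : k2 != 0 -> N != 0 -> W0 != 0 -> d0 + d1 = 1 ->
  - M * (1 / 2 - (1 + u) / 2 * kk' / k2)
  - X * de * h ^+ 2 * ((1 + u) / 2) * (1 - u ^+ 2) / (N * k2)
  = ((l1 - l0) - c * u / N) / 2.
Proof.
move=> k20 + + /(canRL (addrK _)) dE.
rewrite /dM /M /l0 /l1 /kk' /c /W0 /N /X /de dE => N0 W00; field.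
by rewrite k20 !exprMn N0 W00.
Qed.
End algebra.

(** The quotient [f / g] cancels in this form: no square root survives when [g]
    is one. *)
Lemma der_artanh_div (R : realType) (f g : R -> R) (x df dg : R) :
  `|f x| < g x -> is_derive x 1 f df -> is_derive x 1 g dg ->
  is_derive x 1 (fun y => artanh (f y / g y))
    ((df * g x - f x * dg) / (g x ^+ 2 - f x ^+ 2)).
Proof.
move=> fg hf hg.
have g0 : 0 < g x by apply: le_lt_trans fg.
have gn : g x != 0 by rewrite gt_eqF.
have lt1 : `|f x / g x| < 1 by rewrite normf_div (gtr0_norm g0) ltr_pdivrMr// mul1r.
have := @der_artanh _ (fun y => f y / g y) x _ lt1 (der_mul hf (@der_inv _ g x _ gn hg)).
move=> h; apply: is_derive_eq h _.
have : g x ^+ 2 - f x ^+ 2 != 0.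
  by move: fg; rewrite ltr_norml => /andP[f1 f2]; rewrite subr_sqr mulf_neq0// gt_eqF//; lra.
by move=> d0; field; rewrite d0 gn.
Qed.

(** Parameters: [q] and [s] are the cosine and sine of pi / n; [b] and [h] are
    the radial and axial coordinates of a vertex in the hyperboloid model, that
    is, the Klein coordinates multiplied by the time coordinate; u in [-1, 1]
    is the height of a horizontal slice relative to that of the top face. *)
Section wedge_integral.
Context (R : realType) (b q s : R).
Hypothesis q01 : 0 < q < 1.
Hypothesis s0 : 0 < s.
Hypothesis qs : q ^+ 2 + s ^+ 2 = 1.
Hypothesis b0 : 0 < b.
Implicit Types h u : R.

(** Relative to [b], the slice at height [u] has its side at distance [apothem u]
    from the axis, and [halfside u] is half the length of that side. *)
Definition apothem u := (1 + q) / 2 - u * ((1 - q) / 2).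
Definition halfside u := s * (1 + u) / 2.
(** The squared time coordinate of a vertex, then minus the Lorentz norms of the
    axis point, of the foot of the apothem and of the corner of a slice, all
    three scaled to that time coordinate. *)
Definition time_sqr h := 1 + b ^+ 2 + h ^+ 2.
Definition axis_form h u := time_sqr h - h ^+ 2 * u ^+ 2.
Definition apothem_form h u := axis_form h u - b ^+ 2 * apothem u ^+ 2.
Definition corner_form h u := apothem_form h u - b ^+ 2 * halfside u ^+ 2.
Definition apothem_root h u := Num.sqrt (apothem_form h u).
Definition time_coord h := Num.sqrt (time_sqr h).
(** The hyperbolic distance from the foot of the apothem to the corner. *)
Definition half_side_length h u := artanh (b * halfside u / apothem_root h u).
Definition slice_weight h u := b * apothem u * h * time_coord h / (axis_form h u * apothem_root h u).
Definition slice_density h u := slice_weight h u * half_side_length h u.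
(** One eighth of 2 (cosh c)^2 - 1 - cosh a. *)
Definition edge_denominator h := h ^+ 2 * time_sqr h + b ^+ 2 * ((1 - q) / 2) ^+ 2 * time_sqr h
  - b ^+ 2 * ((1 + q) / 2) ^+ 2 * h ^+ 2.
(** The two coefficients that make [weight_primitive] below a primitive in [u] of
    the derivative of [slice_weight] in [h]. *)
Definition linear_coef1 h := (1 + q) / 2 * (- h ^+ 4 + b ^+ 2 * ((1 - q) / 2) ^+ 2 * (1 + b ^+ 2)) / edge_denominator h.
Definition linear_coef0 h := (1 - q) / 2 * (time_sqr h ^+ 2 - b ^+ 2 * ((1 + q) / 2) ^+ 2 * (1 + b ^+ 2)) / edge_denominator h.
Definition weight_numerator h u := (1 + b ^+ 2) * u * apothem u / axis_form h u + (linear_coef0 h + linear_coef1 h * u).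
Definition weight_primitive h u := b * weight_numerator h u / (time_coord h * apothem_root h u).
(** The squared hyperbolic sine of half the lateral edge. *)
Definition sinh2_half_edge h := h ^+ 2 + b ^+ 2 * ((1 - q) / 2).
Definition slice_weight_dh h u := b * apothem u * ((time_coord h ^+ 2 + h ^+ 2) / (time_coord h * axis_form h u * apothem_root h u)
  - 2 * h ^+ 2 * time_coord h * (1 - u ^+ 2) / (axis_form h u ^+ 2 * apothem_root h u)
  - h ^+ 2 * time_coord h * (1 - u ^+ 2) / (axis_form h u * apothem_root h u ^+ 3)).
Definition half_side_length_dh h u := - (b * halfside u * h * (1 - u ^+ 2)) / (apothem_root h u * corner_form h u).
Definition slice_density_dh h u := slice_weight_dh h u * half_side_length h u + slice_weight h u * half_side_length_dh h u.

Let d01 : (1 + q) / 2 + (1 - q) / 2 = 1. Proof. by field. Qed.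

Lemma apothem_bounds u : u \in `[-1, 1] -> q <= apothem u <= 1.
Proof. by rewrite in_itv/= /apothem => /andP[u1 u2]; case/andP: q01 => q0 q1; nra. Qed.

Lemma time_sqr_gt0 h : 0 < time_sqr h.
Proof. by rewrite /time_sqr; nra. Qed.

Lemma apothem_form_ge1 h u : u \in `[-1, 1] -> 1 <= apothem_form h u.
Proof.
move=> u1; have /andP[a1 a2] := apothem_bounds u1.
have -> : apothem_form h u = 1 + b ^+ 2 * (1 - apothem u ^+ 2) + h ^+ 2 * (1 - u ^+ 2).
  by rewrite /apothem_form /axis_form /time_sqr; ring.
have e1 : 0 <= 1 - apothem u ^+ 2 by case/andP: q01 => q0 q1; nra.
have e2 : 0 <= 1 - u ^+ 2 by move: u1; rewrite in_itv/= => /andP[]; nra.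
by rewrite -addrA lerDl addr_ge0// mulr_ge0// sqr_ge0.
Qed.

(** The corner runs along a lateral edge, whence an expression in the length of
    that edge alone. *)
Lemma corner_formE h u : corner_form h u = 1 + sinh2_half_edge h * (1 - u ^+ 2).
Proof.
have s2 : s ^+ 2 = 1 - q ^+ 2 by rewrite -qs; ring.
have -> : corner_form h u = apothem_form h u - b ^+ 2 * (s ^+ 2 * ((1 + u) / 2) ^+ 2).
  by rewrite /corner_form /halfside; ring.
by rewrite s2 /apothem_form /axis_form /time_sqr /sinh2_half_edge /apothem; field.
Qed.

Lemma sinh2_half_edge_gt0 h : 0 < sinh2_half_edge h.
Proof. by case/andP: q01 => q0 q1; rewrite /sinh2_half_edge ltr_wpDl ?sqr_ge0// mulr_gt0 ?exprn_gt0//; lra. Qed.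

Lemma corner_form_ge1 h u : u \in `[-1, 1] -> 1 <= corner_form h u.
Proof.
move=> u1; rewrite corner_formE lerDl; apply: mulr_ge0; first exact/ltW/sinh2_half_edge_gt0.
by move: u1; rewrite in_itv/= => /andP[]; nra.
Qed.

Lemma axis_form_gt0 h u : u \in `[-1, 1] -> 0 < axis_form h u.
Proof.
move=> u1; have := apothem_form_ge1 h u1; rewrite /apothem_form lerBrDr => /(lt_le_trans _); apply.
by apply: ltr_pwDl => //; rewrite mulr_ge0// sqr_ge0.
Qed.

Lemma edge_denominator_gt0 h : 0 < edge_denominator h.
Proof.
case/andP: q01 => q0 q1.
have -> : edge_denominator h = h ^+ 2 * (1 + h ^+ 2) + h ^+ 2 * (b ^+ 2 * (1 - ((1 + q) / 2) ^+ 2))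
   + b ^+ 2 * ((1 - q) / 2) ^+ 2 * time_sqr h by rewrite /edge_denominator /time_sqr; ring.
have q2 : 0 <= 1 - ((1 + q) / 2) ^+ 2 by nra.
have h2 := sqr_ge0 h; have b2 := sqr_ge0 b; have X0 := time_sqr_gt0 h.
apply: ltr_wpDl.
  by apply: addr_ge0; apply: mulr_ge0 => //; [rewrite addr_ge0|exact: mulr_ge0].
by rewrite !mulr_gt0 ?exprn_gt0//; lra.
Qed.

Lemma apothem_root_gt0 h u : u \in `[-1, 1] -> 0 < apothem_root h u.
Proof. by move=> u1; rewrite sqrtr_gt0 (lt_le_trans _ (apothem_form_ge1 h u1)). Qed.

Lemma apothem_root_sqr h u : u \in `[-1, 1] -> apothem_root h u ^+ 2 = apothem_form h u.
Proof. by move=> u1; rewrite sqr_sqrtr// (le_trans _ (apothem_form_ge1 h u1)). Qed.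

Lemma time_coord_gt0 h : 0 < time_coord h. Proof. by rewrite sqrtr_gt0 time_sqr_gt0. Qed.

Lemma time_coord_sqr h : time_coord h ^+ 2 = time_sqr h.
Proof. by rewrite sqr_sqrtr// ltW// time_sqr_gt0. Qed.

Lemma halfside_lt h u : u \in `[-1, 1] -> `|b * halfside u| < apothem_root h u.
Proof.
move=> u1; rewrite -ltr_sqr ?nnegrE ?(ltW (apothem_root_gt0 h u1))// real_normK ?num_real//.
rewrite apothem_root_sqr// exprMn -subr_gt0; exact: lt_le_trans (corner_form_ge1 h u1).
Qed.

Lemma apothem_root_corner h u : u \in `[-1, 1] -> apothem_root h u ^+ 2 - (b * halfside u) ^+ 2 = corner_form h u.
Proof. by move=> u1; rewrite apothem_root_sqr// exprMn. Qed.

Lemma apothem_root_derh h u : u \in `[-1, 1] ->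
  is_derive h 1 (apothem_root^~ u) (h * (1 - u ^+ 2) / apothem_root h u).
Proof.
move=> u1; have K0 : 0 < apothem_form h u by rewrite (lt_le_trans _ (apothem_form_ge1 h u1)).
have k0 := apothem_root_gt0 h u1.
eapply is_derive_eq.
  rewrite /apothem_root /apothem_form /axis_form /time_sqr; der; exact: K0.
rewrite -/(axis_form h u) -/(apothem_form h u) -/(apothem_root h u) /=; field.
by rewrite gt_eqF.
Qed.

Lemma apothem_root_deru h u : u \in `[-1, 1] ->
  is_derive u 1 (apothem_root h) ((- h ^+ 2 * u + b ^+ 2 * apothem u * ((1 - q) / 2)) / apothem_root h u).
Proof.
move=> u1; have K0 : 0 < apothem_form h u by rewrite (lt_le_trans _ (apothem_form_ge1 h u1)).
have k0 := apothem_root_gt0 h u1.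
eapply is_derive_eq.
  rewrite /apothem_root /apothem_form /axis_form /time_sqr /apothem; der; exact: K0.
rewrite -/(apothem u) -/(axis_form h u) -/(apothem_form h u) -/(apothem_root h u) /apothem /=; field.
by rewrite gt_eqF.
Qed.

Lemma half_side_length_derh h u : u \in `[-1, 1] -> is_derive h 1 (half_side_length^~ u) (half_side_length_dh h u).
Proof.
move=> u1; have := @der_artanh_div _ (fun=> b * halfside u) (apothem_root^~ u) h _ _ (halfside_lt h u1) (der_cst (b * halfside u) h) (apothem_root_derh h u1).
move=> H; apply: is_derive_eq H _; rewrite apothem_root_corner// /half_side_length_dh; field.
by rewrite !gt_eqF ?apothem_root_gt0// (lt_le_trans _ (corner_form_ge1 h u1)).
Qed.

Lemma half_side_length_deru h u : u \in `[-1, 1] -> is_derive u 1 (half_side_length h)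
  (b * s * (1 / 2 - (1 + u) / 2 * (- h ^+ 2 * u + b ^+ 2 * apothem u * ((1 - q) / 2)) / apothem_form h u)
   * apothem_root h u / corner_form h u).
Proof.
move=> u1; have k0 := apothem_root_gt0 h u1.
have d : is_derive u 1 (fun u => b * halfside u) (b * s / 2).
  by eapply is_derive_eq; [rewrite /halfside; der|move=> /=; field].
have := @der_artanh_div _ (fun u => b * halfside u) (apothem_root h) u _ _ (halfside_lt h u1) d (apothem_root_deru h u1).
move=> H; apply: is_derive_eq H _; rewrite apothem_root_corner// -apothem_root_sqr// /halfside; field.
by rewrite !gt_eqF ?apothem_root_gt0// (lt_le_trans _ (corner_form_ge1 h u1)).
Qed.

Lemma slice_weight_derh h u : u \in `[-1, 1] -> is_derive h 1 (slice_weight^~ u) (slice_weight_dh h u).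
Proof.
move=> u1; have k0 := apothem_root_gt0 h u1; have N0 := axis_form_gt0 h u1; have x0 := time_coord_gt0 h.
have dx : is_derive h 1 time_coord (h / time_coord h).
  eapply is_derive_eq; first by rewrite /time_coord /time_sqr; der; exact: time_sqr_gt0.
  by rewrite -/(time_sqr h) -/(time_coord h) /=; field; rewrite gt_eqF.
have dN : is_derive h 1 (axis_form^~ u) (2 * h * (1 - u ^+ 2)).
  by eapply is_derive_eq; [rewrite /axis_form /time_sqr; der|move=> /=; ring].
have dk := apothem_root_derh h u1.
have n0 : axis_form h u * apothem_root h u != 0 by rewrite mulf_neq0// gt_eqF.
have := der_mul (der_mul (der_mul (der_cst (b * apothem u) h) (der_id h)) dx)
  (@der_inv _ (fun h => axis_form h u * apothem_root h u) h _ n0 (der_mul dN dk)).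
move=> H; apply: is_derive_eq H _; rewrite /slice_weight_dh; field.
by rewrite !gt_eqF.
Qed.

(** Integrating the weight first leaves, after integration by parts, an integrand
    without [half_side_length]. *)
Lemma weight_primitive_deru h u : u \in `[-1, 1] -> is_derive u 1 (weight_primitive h) (slice_weight_dh h u).
Proof.
move=> u1; have k0 := apothem_root_gt0 h u1; have N0 := axis_form_gt0 h u1; have x0 := time_coord_gt0 h.
have W0 := edge_denominator_gt0 h.
have dN : is_derive u 1 (axis_form h) (- 2 * h ^+ 2 * u).
  by eapply is_derive_eq; [rewrite /axis_form; der|move=> /=; ring].
have da : is_derive u 1 apothem (- ((1 - q) / 2)).
  by eapply is_derive_eq; [rewrite /apothem; der|move=> /=; ring].
pose dM := (1 + b ^+ 2) * (apothem u - u * ((1 - q) / 2)) / axis_form h u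
  + 2 * (1 + b ^+ 2) * u ^+ 2 * apothem u * h ^+ 2 / axis_form h u ^+ 2 + linear_coef1 h.
have dMP : is_derive u 1 (weight_numerator h) dM.
  have := der_add (der_mul (der_mul (der_mul (der_cst (1 + b ^+ 2) u) (der_id u)) da)
    (@der_inv _ (axis_form h) u _ (lt0r_neq0 N0) dN))
    (der_add (der_cst (linear_coef0 h) u) (der_mul (der_cst (linear_coef1 h) u) (der_id u))).
  by move=> H; apply: is_derive_eq H _; rewrite /dM; field; rewrite gt_eqF.
have n0 : time_coord h * apothem_root h u != 0 by rewrite mulf_neq0// gt_eqF.
have := der_mul (der_mul (der_cst b u) dMP)
  (@der_inv _ (fun u => time_coord h * apothem_root h u) u _ n0 (der_mul (der_cst (time_coord h) u) (apothem_root_deru h u1))).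
move=> H; apply: is_derive_eq H _.
pose kk' := - h ^+ 2 * u + b ^+ 2 * apothem u * ((1 - q) / 2).
transitivity (b * (dM * apothem_root h u ^+ 2 - weight_numerator h u * kk') / (time_coord h * apothem_root h u ^+ 3)).
  by rewrite /kk'; field; rewrite !gt_eqF.
have k2E : time_sqr h = apothem_root h u ^+ 2 + h ^+ 2 * u ^+ 2 + b ^+ 2 * apothem u ^+ 2.
  by rewrite apothem_root_sqr// /apothem_form /axis_form; ring.
have NE : axis_form h u = apothem_root h u ^+ 2 + b ^+ 2 * apothem u ^+ 2 by rewrite apothem_root_sqr// /apothem_form; ring.
have cE : 1 + b ^+ 2 = time_sqr h - h ^+ 2 by rewrite /time_sqr; ring.
have := @weight_primitive_identity R (apothem_root h u ^+ 2) h u b ((1 + q) / 2) ((1 - q) / 2).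
rewrite -/(apothem u) -k2E -NE -cE => -> //; try by rewrite gt_eqF.
by rewrite -time_coord_sqr /slice_weight_dh; field; rewrite !gt_eqF.
Qed.

(** The square roots cancel in what integration by parts leaves: the result is
    rational in [u]. *)
Lemma boundary_remainder h u : u \in `[-1, 1] ->
  - weight_primitive h u * (b * s * (1 / 2 - (1 + u) / 2 * (- h ^+ 2 * u + b ^+ 2 * apothem u * ((1 - q) / 2)) / apothem_form h u)
   * apothem_root h u / corner_form h u) + slice_weight h u * half_side_length_dh h u
  = b ^+ 2 * s / (2 * time_coord h) * ((linear_coef1 h - linear_coef0 h) - (1 + b ^+ 2) * u / axis_form h u) / corner_form h u.
Proof.
move=> u1; have k0 := apothem_root_gt0 h u1; have N0 := axis_form_gt0 h u1; have x0 := time_coord_gt0 h.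
have W0 := edge_denominator_gt0 h; have Q0 := lt_le_trans ltr01 (corner_form_ge1 h u1).
have k2E : time_sqr h = apothem_root h u ^+ 2 + h ^+ 2 * u ^+ 2 + b ^+ 2 * apothem u ^+ 2.
  by rewrite apothem_root_sqr// /apothem_form /axis_form; ring.
have NE : axis_form h u = apothem_root h u ^+ 2 + b ^+ 2 * apothem u ^+ 2 by rewrite apothem_root_sqr// /apothem_form; ring.
have cE : 1 + b ^+ 2 = time_sqr h - h ^+ 2 by rewrite /time_sqr; ring.
have := @boundary_remainder_identity R (apothem_root h u ^+ 2) h u b ((1 + q) / 2) ((1 - q) / 2).
rewrite -/(apothem u) -k2E -NE -cE -/(edge_denominator h) -/(linear_coef0 h) -/(linear_coef1 h) -/(weight_numerator h u).
move=> /(_ (lt0r_neq0 (exprn_gt0 2 k0)) (lt0r_neq0 N0) (lt0r_neq0 W0) d01) E.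
transitivity (b ^+ 2 * s / (time_coord h * corner_form h u) * (((linear_coef1 h - linear_coef0 h) - (1 + b ^+ 2) * u / axis_form h u) / 2)); last first.
  by field; rewrite !gt_eqF.
rewrite -E -apothem_root_sqr// -time_coord_sqr /weight_primitive /slice_weight /half_side_length_dh /halfside; field.
by rewrite !gt_eqF.
Qed.

Definition sinh_half_edge h := Num.sqrt (sinh2_half_edge h).
Definition cosh_half_edge h := Num.sqrt (1 + sinh2_half_edge h).
(** The artanh term integrates the reciprocal of [corner_form], and the logarithms
    integrate u / ([axis_form] [corner_form]), both forms being affine in u^2. *)
Definition variation_primitive h u := weight_primitive h u * half_side_length h u
  + b ^+ 2 * s / (2 * time_coord h) *
    ((linear_coef1 h - linear_coef0 h) * (artanh (sinh_half_edge h * u / cosh_half_edge h) / (sinh_half_edge h * cosh_half_edge h))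
     - (1 + b ^+ 2) * ((ln (axis_form h u) - ln (corner_form h u)) / (2 * (sinh2_half_edge h * (1 + b ^+ 2) - h ^+ 2)))).
(** The increment of [variation_primitive] over [-1, 1]. *)
Definition slice_volume_deriv h := weight_primitive h 1 * half_side_length h 1
  + b ^+ 2 * s / (2 * time_coord h) * (linear_coef1 h - linear_coef0 h) * (2 * artanh (sinh_half_edge h / cosh_half_edge h) / (sinh_half_edge h * cosh_half_edge h)).

Lemma sinh_half_edge_gt0 h : 0 < sinh_half_edge h. Proof. by rewrite sqrtr_gt0 sinh2_half_edge_gt0. Qed.
Lemma cosh_half_edge_gt0 h : 0 < cosh_half_edge h. Proof. by rewrite sqrtr_gt0 addr_gt0// sinh2_half_edge_gt0. Qed.
Lemma sinh_half_edge_sqr h : sinh_half_edge h ^+ 2 = sinh2_half_edge h. Proof. by rewrite sqr_sqrtr// ltW// sinh2_half_edge_gt0. Qed.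
Lemma cosh_half_edge_sqr h : cosh_half_edge h ^+ 2 = 1 + sinh2_half_edge h.
Proof. by rewrite sqr_sqrtr// ltW// addr_gt0// sinh2_half_edge_gt0. Qed.

Lemma sinh_half_edge_lt h u : u \in `[-1, 1] -> `|sinh_half_edge h * u| < cosh_half_edge h.
Proof.
move=> u1; rewrite -ltr_sqr ?nnegrE ?(ltW (cosh_half_edge_gt0 h))// real_normK ?num_real//.
rewrite cosh_half_edge_sqr exprMn sinh_half_edge_sqr.
have u2 : u ^+ 2 <= 1 by move: u1; rewrite in_itv/= => /andP[]; nra.
by have := sinh2_half_edge_gt0 h; nra.
Qed.

Lemma log_denominator_gt0 h : 0 < sinh2_half_edge h * (1 + b ^+ 2) - h ^+ 2.
Proof.
have b2 := exprn_gt0 2 b0; have h2 := sqr_ge0 h; case/andP: q01 => q0 q1.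
have -> : sinh2_half_edge h * (1 + b ^+ 2) - h ^+ 2 =
  h ^+ 2 * b ^+ 2 + b ^+ 2 * ((1 - q) / 2) * (1 + b ^+ 2) by rewrite /sinh2_half_edge; ring.
apply: ltr_wpDl; first by rewrite mulr_ge0// ltW.
by rewrite !mulr_gt0//; lra.
Qed.

Lemma variation_primitive_deru h u : u \in `[-1, 1] -> is_derive u 1 (variation_primitive h) (slice_density_dh h u).
Proof.
move=> u1; have k0 := apothem_root_gt0 h u1; have N0 := axis_form_gt0 h u1; have x0 := time_coord_gt0 h.
have Q0 := lt_le_trans ltr01 (corner_form_ge1 h u1).
have S0 := sinh_half_edge_gt0 h; have C0 := cosh_half_edge_gt0 h; have D0 := log_denominator_gt0 h.
have dE2 : is_derive u 1 (fun u => artanh (sinh_half_edge h * u / cosh_half_edge h)) (sinh_half_edge h * cosh_half_edge h / corner_form h u).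
  have dSu : is_derive u 1 (fun u => sinh_half_edge h * u) (sinh_half_edge h).
    by eapply is_derive_eq; [der|move=> /=; ring].
  have := @der_artanh_div _ (fun u => sinh_half_edge h * u) (fun=> cosh_half_edge h) u _ _ (sinh_half_edge_lt h u1) dSu (der_cst (cosh_half_edge h) u).
  move=> H; apply: is_derive_eq H _ => /=.
  rewrite corner_formE cosh_half_edge_sqr exprMn sinh_half_edge_sqr mulr0 subr0; congr (_ / _); ring.
have dN : is_derive u 1 (axis_form h) (- 2 * h ^+ 2 * u).
  by eapply is_derive_eq; [rewrite /axis_form; der|move=> /=; ring].
have dQ : is_derive u 1 (corner_form h) (- 2 * sinh2_half_edge h * u).
  have -> : corner_form h = fun u => 1 + sinh2_half_edge h * (1 - u ^+ 2) by apply/funext => z; exact: corner_formE.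
  by eapply is_derive_eq; [der|move=> /=; ring].
have := der_add (der_mul (weight_primitive_deru h u1) (half_side_length_deru h u1))
  (der_mul (der_cst (b ^+ 2 * s / (2 * time_coord h)) u)
   (der_add (der_mul (der_cst (linear_coef1 h - linear_coef0 h) u) (der_mul dE2 (der_cst (sinh_half_edge h * cosh_half_edge h)^-1 u)))
     (der_opp (der_mul (der_cst (1 + b ^+ 2) u)
        (der_mul (der_add (@der_ln _ (axis_form h) u _ N0 dN) (der_opp (@der_ln _ (corner_form h) u _ Q0 dQ)))
           (der_cst (2 * (sinh2_half_edge h * (1 + b ^+ 2) - h ^+ 2))^-1 u)))))).
move=> H; apply: is_derive_eq H _; rewrite /slice_density_dh.
set dA := (X in _ * half_side_length h u + weight_primitive h u * X + _).
have rem := boundary_remainder h u1; rewrite -/dA in rem.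
have -> : slice_weight h u * half_side_length_dh h u = weight_primitive h u * dA + (- weight_primitive h u * dA + slice_weight h u * half_side_length_dh h u) by ring.
rewrite {}rem -!addrA; congr (_ + (_ + _)).
have EN : axis_form h u = 1 + b ^+ 2 + h ^+ 2 * (1 - u ^+ 2) by rewrite /axis_form /time_sqr; ring.
have lnd : (- 2 * h ^+ 2 * u / axis_form h u - - 2 * sinh2_half_edge h * u / corner_form h u) / (2 * (sinh2_half_edge h * (1 + b ^+ 2) - h ^+ 2))
    = u / axis_form h u / corner_form h u.
  rewrite corner_formE EN in Q0 N0 *; field.
  by rewrite !gt_eqF.
transitivity (b ^+ 2 * s / (2 * time_coord h) * ((linear_coef1 h - linear_coef0 h) / corner_form h u - (1 + b ^+ 2) *
  ((- 2 * h ^+ 2 * u / axis_form h u - - 2 * sinh2_half_edge h * u / corner_form h u) / (2 * (sinh2_half_edge h * (1 + b ^+ 2) - h ^+ 2))))).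
  by field; rewrite !gt_eqF.
by rewrite lnd; field; rewrite !gt_eqF.
Qed.

Lemma artanhN (x : R) : artanh (- x) = - artanh x.
Proof. by rewrite /artanh opprK; ring. Qed.

Lemma artanh0 : artanh (0 : R) = 0.
Proof. by rewrite /artanh oppr0 addr0 subrr mul0r. Qed.

(** At u = -1 the slice side degenerates to a vertex, so that [half_side_length]
    vanishes; the logarithms are even in [u] and cancel. *)
Lemma variation_primitive_ends h : variation_primitive h 1 - variation_primitive h (- 1) = slice_volume_deriv h.
Proof.
rewrite /variation_primitive !corner_formE /axis_form sqrrN mulrN1 mulNr artanhN mulr1 /slice_volume_deriv.
have -> : half_side_length h (- 1) = 0 by rewrite /half_side_length /halfside subrr mulr0 mul0r mulr0 mul0r artanh0.
ring.
Qed.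

Section continuity.
Variables (p : R * R).
Hypothesis p1 : p.2 \in `[-1, 1].

Lemma apothem_root_cts : {for p, continuous (fun p => apothem_root p.1 p.2)}.
Proof. by rewrite /apothem_root /apothem_form /axis_form /time_sqr /apothem; cts. Qed.

Lemma time_coord_cts : {for p, continuous (fun p : R * R => time_coord p.1)}.
Proof. by rewrite /time_coord /time_sqr; cts. Qed.

Lemma half_side_length_cts : {for p, continuous (fun p => half_side_length p.1 p.2)}.
Proof.
have k0 := apothem_root_gt0 p.1 p1.
apply: (@cts_artanh _ _ (fun p => b * halfside p.2 / apothem_root p.1 p.2)).
  by rewrite normf_div (gtr0_norm k0) ltr_pdivrMr// mul1r halfside_lt.
rewrite /halfside; cts; [by rewrite gt_eqF|exact: apothem_root_cts].
Qed.

Lemma axis_form_cts : {for p, continuous (fun p => axis_form p.1 p.2)}.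
Proof. by rewrite /axis_form /time_sqr; cts. Qed.

Lemma corner_form_cts : {for p, continuous (fun p => corner_form p.1 p.2)}.
Proof. by rewrite /corner_form /apothem_form /axis_form /time_sqr /apothem /halfside; cts. Qed.

Lemma slice_weight_cts : {for p, continuous (fun p => slice_weight p.1 p.2)}.
Proof.
have k0 := apothem_root_gt0 p.1 p1; have N0 := axis_form_gt0 p.1 p1.
rewrite /slice_weight /apothem; cts; try solve [exact: time_coord_cts|exact: axis_form_cts|exact: apothem_root_cts].
by rewrite mulf_neq0// gt_eqF.
Qed.

Lemma slice_density_cts : {for p, continuous (fun p => slice_density p.1 p.2)}.
Proof. by apply: cts_mul; [exact: slice_weight_cts|exact: half_side_length_cts]. Qed.

Lemma slice_density_dh_cts : {for p, continuous (fun p => slice_density_dh p.1 p.2)}.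
Proof.
have k0 := apothem_root_gt0 p.1 p1; have N0 := axis_form_gt0 p.1 p1; have x0 := time_coord_gt0 p.1.
have Q0 := lt_le_trans ltr01 (corner_form_ge1 p.1 p1).
rewrite /slice_density_dh /slice_weight_dh /half_side_length_dh /apothem /halfside; cts;
  try solve [exact: time_coord_cts|exact: axis_form_cts|exact: apothem_root_cts|exact: corner_form_cts|exact: half_side_length_cts|exact: slice_weight_cts];
  by rewrite ?mulf_neq0 ?expf_neq0 ?mulf_neq0// ?gt_eqF.
Qed.

End continuity.

Notation lam := (@lebesgue_measure R).

Definition slice_volume h := (\int[lam]_(u in `[-1%R, 1%R]) slice_density h u)%R.

Lemma section_cts (f : R * R -> R) h u : {for (h, u), continuous f} ->
  {for u, continuous (fun u => f (h, u))}.
Proof.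
move=> cf; apply: (@continuous_comp _ _ _ (fun u => (h, u)) f) => //.
move=> A [[P Q] [/= Ph Qu] PQA]; apply: filterS Qu => z Qz.
by apply: PQA; split => //=; exact: nbhs_singleton.
Qed.

Lemma slice_density_integrable h : lam.-integrable `[-1%R, 1%R] (EFin \o slice_density h).
Proof.
apply: continuous_compact_integrable; first exact: segment_compact.
apply: continuous_in_subspaceT => u /[!inE] u1.
exact: (section_cts (@slice_density_cts (h, u) u1)).
Qed.

Lemma slice_density_dh_bound (lo hi : R) : exists2 M : R, 0 <= M &
  forall h u, h \in `[lo, hi] -> u \in `[-1, 1] -> `|slice_density_dh h u| <= M.
Proof.
pose f (p : R * R) := slice_density_dh p.1 p.2.
have : compact (f @` (`[lo, hi] `*` `[-1, 1])).
  apply: continuous_compact; last by apply: compact_setX; exact: segment_compact.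
  apply: continuous_in_subspaceT => p /[!inE] -[_ p1].
  exact: slice_density_dh_cts.
move/compact_bounded => [M [_ HM]].
exists (`|M| + 1); first by rewrite addr_ge0.
move=> h u hh uu; apply: (HM (`|M| + 1)); first by rewrite (le_lt_trans (ler_norm _))// ltrDl.
by exists (h, u).
Qed.

(** Differentiation under the integral sign; the derivative is bounded because it
    is continuous on a compact rectangle. *)
Lemma slice_volume_der h : is_derive h 1 slice_volume (slice_volume_deriv h).
Proof.
have [M M0 HM] := slice_density_dh_bound (h - 1) (h + 1).
have hI : `]h - 1, h + 1[%classic h by rewrite /= in_itv/= ltrBlDr ltrDl ltr01.
have p1E x u : u \in `[-1, 1] -> partial1of2 slice_density x u = slice_density_dh x u.
  move=> u1; rewrite partial1of2E.
  have [_ //] := der_mul (slice_weight_derh x u1) (half_side_length_derh x u1).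
have Hd x u : u \in `[-1, 1] -> derivable (slice_density^~ u) x 1.
  by move=> u1; case: (der_mul (slice_weight_derh x u1) (half_side_length_derh x u1)).
have mI : measurable (`[(-1)%R, 1%R] : set R) by [].
have intM : lam.-integrable `[(-1)%R, 1%R] (EFin \o (cst M : R -> R)).
  apply: continuous_compact_integrable; first exact: segment_compact.
  by apply: continuous_subspaceT; exact: cst_continuous.
have Gub x u : `]h - 1, h + 1[%classic x -> `[(-1)%R, 1%R]%classic u -> `|partial1of2 slice_density x u| <= cst M u.
  move=> /= xI u1; rewrite p1E//; apply: HM => //; exact: subset_itv_oo_cc.
have D1 := @derivable_under_integral R _ _ lam slice_density `[(-1)%R, 1%R] mI h (h - 1) (h + 1) hI
  (fun x _ => slice_density_integrable x) (fun x v _ hv => Hd x v hv) (cst M) (fun _ => M0) intM Gub.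
have D2 := @differentiation_under_integral R _ _ lam slice_density `[(-1)%R, 1%R] mI h (h - 1) (h + 1) hI
  (fun x _ => slice_density_integrable x) (fun x v _ hv => Hd x v hv) (cst M) (fun _ => M0) intM Gub.
apply: DeriveDef; first exact: D1.
rewrite -derive1E D2 -variation_primitive_ends.
transitivity (\int[lam]_(u in `[(-1)%R, 1%R]) slice_density_dh h u).
  by apply: eq_Rintegral => u /[!inE] u1; exact: p1E.
have n11 : -1 <= 1 :> R by rewrite lerN10 || lra.
have E := @FTC_segment _ (variation_primitive h) (slice_density_dh h) (-1) 1 n11 (fun v hv => variation_primitive_deru h hv)
  (fun v hv => section_cts (@slice_density_dh_cts (h, v) hv)).
by rewrite /Rintegral E.
Qed.

Lemma slice_volume_deriv_cts h : {for h, continuous slice_volume_deriv}.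
Proof.
have I1 : (1 : R) \in `[-1, 1] by rewrite in_itv/= lexx andbT; lra.
have x0 := time_coord_gt0 h; have W0 := edge_denominator_gt0 h; have C0 := cosh_half_edge_gt0 h.
have S0 := sinh_half_edge_gt0 h; have N0 := axis_form_gt0 h I1; have k0 := apothem_root_gt0 h I1.
have cx : {for h, continuous time_coord} by rewrite /time_coord /time_sqr; cts.
have cW : {for h, continuous edge_denominator} by rewrite /edge_denominator /time_sqr; cts.
have cS : {for h, continuous sinh_half_edge} by rewrite /sinh_half_edge /sinh2_half_edge; cts.
have cC : {for h, continuous cosh_half_edge} by rewrite /cosh_half_edge /sinh2_half_edge; cts.
have cN : {for h, continuous (axis_form^~ 1)} by rewrite /axis_form /time_sqr; cts.
have ck : {for h, continuous (apothem_root^~ 1)} by rewrite /apothem_root /apothem_form /axis_form /time_sqr /apothem; cts.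
have cl1 : {for h, continuous linear_coef1} by rewrite /linear_coef1; cts; rewrite ?gt_eqF.
have cl0 : {for h, continuous linear_coef0} by rewrite /linear_coef0 /time_sqr; cts; rewrite ?gt_eqF.
have cA : {for h, continuous (half_side_length^~ 1)}.
  apply: (@cts_artanh _ _ (fun h => b * halfside 1 / apothem_root h 1)).
    by rewrite normf_div (gtr0_norm k0) ltr_pdivrMr// mul1r halfside_lt.
  by cts; rewrite ?gt_eqF.
rewrite /slice_volume_deriv /weight_primitive /weight_numerator; cts; rewrite ?mulf_neq0// ?gt_eqF//.
by have := sinh_half_edge_lt h I1; rewrite mulr1 normf_div (gtr0_norm C0) ltr_pdivrMr// mul1r.
Qed.

(** For [h = 0] the polyhedron is flat, so the constant of integration is zero. *)
Lemma integral_slice_volume_deriv h1 : 0 <= h1 ->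
  (\int[lam]_(h in `[0%R, h1]) (slice_volume_deriv h)%:E = \int[lam]_(u in `[(-1)%R, 1%R]) (slice_density h1 u)%:E)%E.
Proof.
move=> h10; have -> := FTC_segment h10 (fun h _ => slice_volume_der h) (fun h _ => slice_volume_deriv_cts (h:=h)).
have -> : slice_volume 0 = 0.
  transitivity (\int[lam]_(u in `[(-1)%R, 1%R]) (cst 0 u : R)); last by rewrite Rintegral_cst ?mul0r.
  by apply: eq_Rintegral => u _; rewrite /slice_density /slice_weight mulr0 !mul0r.
rewrite subr0 /slice_volume /Rintegral fineK//.
by apply: integrable_fin_num => //; exact: slice_density_integrable.
Qed.

End wedge_integral.

(** * The lateral edge length as the variable *)
Section arcosh_theory.
Context (R : realType).
Implicit Types x y : R.

Lemma cosh_sqr x : cosh x ^+ 2 = 1 + sinh x ^+ 2.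
Proof.
have : expR x * expR (- x) = 1 by exact: expRxMexpNx_1.
rewrite /cosh /sinh => e.
have -> : ((expR x + expR (- x)) / 2) ^+ 2 = ((expR x - expR (- x)) / 2) ^+ 2 + expR x * expR (- x) by field.
by rewrite e addrC.
Qed.

Lemma arcosh_arg_gt0 x : 1 <= x -> 0 < x + Num.sqrt (x ^+ 2 - 1).
Proof. by move=> x1; rewrite ltr_pwDl ?sqrtr_ge0// (lt_le_trans ltr01). Qed.

Lemma expR_arcosh x : 1 <= x -> expR (arcosh x) = x + Num.sqrt (x ^+ 2 - 1).
Proof. by move=> x1; rewrite lnK// posrE arcosh_arg_gt0. Qed.

Lemma expRN_arcosh x : 1 <= x -> expR (- arcosh x) = x - Num.sqrt (x ^+ 2 - 1).
Proof.
move=> x1; rewrite expRN expR_arcosh//.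
apply: (mulfI (lt0r_neq0 (arcosh_arg_gt0 x1))).
rewrite mulfV ?gt_eqF ?arcosh_arg_gt0// mulrC -subr_sqr sqr_sqrtr; first by ring.
by rewrite subr_ge0; nra.
Qed.

Lemma arcoshK x : 1 <= x -> cosh (arcosh x) = x.
Proof. by move=> x1; rewrite /cosh expR_arcosh// expRN_arcosh//; field. Qed.

Lemma sinh_arcosh x : 1 <= x -> sinh (arcosh x) = Num.sqrt (x ^+ 2 - 1).
Proof. by move=> x1; rewrite /sinh expR_arcosh// expRN_arcosh//; field. Qed.

Lemma coshK x : 0 <= x -> arcosh (cosh x) = x.
Proof.
move=> x0; have s0 : 0 <= sinh x.
  by rewrite /sinh divr_ge0// subr_ge0 ler_expR; lra.
rewrite /arcosh cosh_sqr addrAC subrr add0r sqrtr_sqr ger0_norm//.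
have -> : cosh x + sinh x = expR x by rewrite /cosh /sinh; field.
exact: expRK.
Qed.

Lemma der_arcosh (f : R -> R) x df : 1 < f x -> is_derive x 1 f df ->
  is_derive x 1 (fun y => arcosh (f y)) (df / Num.sqrt (f x ^+ 2 - 1)).
Proof.
move=> f1 hf; have r0 : 0 < f x ^+ 2 - 1 by nra.
have s0 : 0 < Num.sqrt (f x ^+ 2 - 1) by rewrite sqrtr_gt0.
have l0 := arcosh_arg_gt0 (ltW f1).
have hs := @der_sqrt _ (fun y => f y ^+ 2 - 1) x _ r0 (der_add (der_exp 1 hf) (der_cst (-1) x)).
have := @der_ln _ (fun y => f y + Num.sqrt (f y ^+ 2 - 1)) x _ l0 (der_add hf hs).
by move=> H; apply: is_derive_eq H _ => /=; field; rewrite !gt_eqF.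
Qed.

(** Half-argument formulas: [S] and [C] are the hyperbolic sine and cosine of
    half of arcosh (1 + 2 S^2). *)
Lemma arcosh_double (S C : R) : 0 <= S -> 0 < C -> C ^+ 2 = 1 + S ^+ 2 ->
  Num.sqrt ((1 + 2 * S ^+ 2) ^+ 2 - 1) = 2 * S * C /\
  artanh (S / C) = arcosh (1 + 2 * S ^+ 2) / 2.
Proof.
move=> S0 C0 CE.
have e : Num.sqrt ((1 + 2 * S ^+ 2) ^+ 2 - 1) = 2 * S * C.
  have -> : (1 + 2 * S ^+ 2) ^+ 2 - 1 = (2 * S * C) ^+ 2.
    by rewrite [RHS]exprMn CE; ring.
  by rewrite sqrtr_sqr ger0_norm// !mulr_ge0// ltW.
split=> //; rewrite /arcosh e.
have SC : S < C by rewrite -ltr_sqr ?nnegrE ?(ltW C0)// CE; lra.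
rewrite /artanh -ln_div ?posrE; last 2 first.
- by rewrite ltr_pwDl// divr_ge0// ltW.
- by rewrite subr_gt0 ltr_pdivrMr// mul1r.
congr (ln _ / 2).
have d0 : C - S != 0 by rewrite gt_eqF// subr_gt0.
transitivity ((C + S) / (C - S)); first by field; rewrite d0 gt_eqF.
transitivity ((C + S) ^+ 2 / (C ^+ 2 - S ^+ 2)).
  have s0 : C + S != 0 by rewrite gt_eqF// ltr_wpDr.
  by field; rewrite d0 subr_sqr mulf_neq0.
have -> : C ^+ 2 - S ^+ 2 = 1 by rewrite CE; ring.
by rewrite divr1 sqrrD CE; ring.
Qed.

End arcosh_theory.

Section edge_length_substitution.
Context (R : realType) (b q s : R).
Hypothesis q01 : 0 < q < 1.
Hypothesis s0 : 0 < s.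
Hypothesis qs : q ^+ 2 + s ^+ 2 = 1.
Hypothesis b0 : 0 < b.
Implicit Types h : R.
Notation lam := (@lebesgue_measure R).

Let a := arcosh (1 + 2 * (b * s) ^+ 2).
Let t h := arcosh (1 + 2 * sinh2_half_edge b q h).
Let dt h := 4 * h / (2 * sinh_half_edge b q h * cosh_half_edge b q h).
Let f (t : R) := (a * (2 * (cosh t - q) * sinh a * sinh t)
  + t * (- (cosh a - 1) * (1 + cosh a + 2 * cosh t ^+ 2 - 4 * cosh t * q))) /
  ((2 * cosh t ^+ 2 - 1 - cosh a) * Num.sqrt (1 - cosh a * (2 + cosh a) + 2 * cosh t ^+ 2
  + 4 * (cosh a - 1) * cosh t * q - 2 * sinh t ^+ 2 * (2 * q ^+ 2 - 1))).

Let argt_gt1 h : 1 < 1 + 2 * sinh2_half_edge b q h.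
Proof. by rewrite ltrDl mulr_gt0// sinh2_half_edge_gt0. Qed.

Let tE h : Num.sqrt ((1 + 2 * sinh2_half_edge b q h) ^+ 2 - 1) = 2 * sinh_half_edge b q h * cosh_half_edge b q h /\
  artanh (sinh_half_edge b q h / cosh_half_edge b q h) = t h / 2.
Proof.
have S0 := sinh_half_edge_gt0 q01 b0 h; have C0 := cosh_half_edge_gt0 q01 b0 h.
have := @arcosh_double _ (sinh_half_edge b q h) (cosh_half_edge b q h) (ltW S0) C0.
by rewrite cosh_half_edge_sqr// sinh_half_edge_sqr//; apply.
Qed.

Let t_der h : is_derive h 1 t (dt h).
Proof.
have := @der_arcosh _ (fun h => 1 + 2 * sinh2_half_edge b q h) h _ (argt_gt1 h).
rewrite (tE h).1; apply; rewrite /sinh2_half_edge.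
by eapply is_derive_eq; [der|move=> /=; ring].
Qed.

Let dt_cts h : {for h, continuous dt}.
Proof.
have S0 := sinh_half_edge_gt0 q01 b0 h; have C0 := cosh_half_edge_gt0 q01 b0 h.
rewrite /dt; cts; first by rewrite !mulf_neq0// gt_eqF.
- by rewrite /sinh_half_edge /sinh2_half_edge; cts.
- by rewrite /cosh_half_edge /sinh2_half_edge; cts.
Qed.

Let f_measurable : measurable_fun setT f.
Proof.
have mc : measurable_fun setT (@cosh R).
  by apply: continuous_measurable_fun => z; rewrite /cosh; apply: (_ : {for z, continuous _}); cts.
have ms : measurable_fun setT (@sinh R).
  by apply: continuous_measurable_fun => z; rewrite /sinh; apply: (_ : {for z, continuous _}); cts.
by rewrite /f; meas.
Qed.

(** At [u = 1] the slice is the top face, and [half_side_length] is a / 2; the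
    artanh in [slice_volume_deriv] is t / 2. The radicand of the theorem becomes
    the square of 4 s [time_coord] h, and the coefficients of a and t are
    compared separately. *)
Let integrand_pullback h : 0 < h -> f (t h) * dt h = 2 * slice_volume_deriv b q s h.
Proof.
move=> h0.
have I1 : (1 : R) \in `[-1, 1] by rewrite in_itv/= lexx andbT; lra.
have S0 := sinh_half_edge_gt0 q01 b0 h; have C0 := cosh_half_edge_gt0 q01 b0 h.
have k0 := apothem_root_gt0 b q01 h I1; have x0 := time_coord_gt0 b h; have W0 := edge_denominator_gt0 q01 b0 h.
have s2 : s ^+ 2 = 1 - q ^+ 2 by rewrite -qs; ring.
have k1 : apothem_root b q h 1 ^+ 2 = 1 + (b * s) ^+ 2.
  by rewrite apothem_root_sqr// exprMn s2 /apothem_form /axis_form /time_sqr /apothem; field.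
have bs0 : 0 < b * s by rewrite mulr_gt0.
have [ea aE] := @arcosh_double _ (b * s) (apothem_root b q h 1) (ltW bs0) k0 k1.
have a1 : 1 <= 1 + 2 * (b * s) ^+ 2 by rewrite lerDl mulr_ge0// sqr_ge0.
have [et tE'] := tE h.
have t1 := ltW (argt_gt1 h).
rewrite /f /a /t (arcoshK a1) (sinh_arcosh a1) (arcoshK t1) (sinh_arcosh t1).
rewrite -/a -/(t h) ea et /slice_volume_deriv tE'.
have -> : half_side_length b q s h 1 = a / 2.
  by rewrite /half_side_length -aE; congr (artanh (_ / _)); rewrite /halfside; field.
set Rt := (X in Num.sqrt X).
have RE : Rt = (4 * s * time_coord b h * h) ^+ 2.
  rewrite /Rt [RHS]exprMn [(4 * s * _) ^+ 2]exprMn [(4 * s) ^+ 2]exprMn time_coord_sqr exprMn.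
  rewrite [(_ * cosh_half_edge b q h) ^+ 2]exprMn [(2 * sinh_half_edge b q h) ^+ 2]exprMn sinh_half_edge_sqr// cosh_half_edge_sqr// s2.
  by rewrite /sinh2_half_edge /time_sqr; field.
rewrite RE sqrtr_sqr gtr0_norm ?mulr_gt0//.
have DE : 2 * (1 + 2 * sinh2_half_edge b q h) ^+ 2 - 1 - (1 + 2 * (b * s) ^+ 2) = 8 * edge_denominator b q h.
  by rewrite exprMn s2 /sinh2_half_edge /edge_denominator /time_sqr; field.
rewrite DE.
have cancel (x y w : R) : y != 0 -> w != 0 -> x / (y * w) * w = x / y.
  by move=> y0 w0; field; rewrite y0 w0.
have M1 : weight_numerator b q h 1 = (1 + 2 * sinh2_half_edge b q h - q) * apothem_root b q h 1 ^+ 2 / (2 * edge_denominator b q h).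
  rewrite k1 exprMn s2 /weight_numerator /linear_coef0 /linear_coef1.
  have -> : axis_form b h 1 = 1 + b ^+ 2 by rewrite /axis_form /time_sqr; ring.
  have -> : apothem q 1 = q by rewrite /apothem; field.
  have b20 : 1 + b ^+ 2 != 0 by rewrite gt_eqF// ltr_pwDl// sqr_ge0.
  transitivity (q + ((1 - q) / 2 * (time_sqr b h ^+ 2 - b ^+ 2 * ((1 + q) / 2) ^+ 2 * (1 + b ^+ 2)) +
    (1 + q) / 2 * (- h ^+ 4 + b ^+ 2 * ((1 - q) / 2) ^+ 2 * (1 + b ^+ 2))) / edge_denominator b q h).
    by field; rewrite b20 gt_eqF.
  apply: (mulIf (lt0r_neq0 W0)); rewrite mulrDl divfK ?gt_eqF//.
  by rewrite cancel ?gt_eqF// /edge_denominator /sinh2_half_edge /time_sqr; field.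
have L1 : linear_coef1 b q h - linear_coef0 b q h = - (1 + (1 + 2 * (b * s) ^+ 2) + 2 * (1 + 2 * sinh2_half_edge b q h) ^+ 2
   - 4 * (1 + 2 * sinh2_half_edge b q h) * q) / (8 * edge_denominator b q h).
  rewrite exprMn s2 /linear_coef0 /linear_coef1.
  apply: (mulIf (lt0r_neq0 W0)); rewrite mulrBl !divfK ?gt_eqF//.
  by rewrite cancel ?gt_eqF// /sinh2_half_edge /time_sqr; field.
rewrite /weight_primitive M1 L1 /dt; field.
by rewrite !gt_eqF.
Qed.

Lemma edge_length_integral (c0 h1 : R) : 0 < h1 -> 0 < c0 -> cosh c0 = 1 + 2 * sinh2_half_edge b q 0 ->
  (\int[lam]_(t in `[c0, arcosh (1 + 2 * sinh2_half_edge b q h1)]) (f t)%:E =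
   2%:E * \int[lam]_(u in `[(-1)%R, 1%R]) (slice_density b q s h1 u)%:E)%E.
Proof.
move=> h10 c00 c0E.
have -> : c0 = t 0 by rewrite /t -c0E coshK// ltW.
rewrite -/(t h1) integral_itv_bndoo; last by apply/measurable_EFinP; exact: measurable_funTS f_measurable.
have dt0 h : h \in `]0, h1[ -> 0 < dt h.
  move=> /[!in_itv]/= /andP[h0 _].
  by rewrite /dt divr_gt0 ?mulr_gt0// ?sinh_half_edge_gt0// cosh_half_edge_gt0.
have mf : measurable_fun setT (EFin \o f) by exact/measurable_EFinP.
have -> := integral_increasing h10 (fun h _ => t_der h) (fun h _ => dt_cts (h:=h)) dt0 mf.
rewrite -(integral_slice_volume_deriv q01 qs b0 (ltW h10)).
have intV : lam.-integrable `[0%R, h1] (EFin \o slice_volume_deriv b q s).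
  apply: continuous_compact_integrable; first exact: segment_compact.
  by apply: continuous_subspaceT => h; exact: slice_volume_deriv_cts.
have intV' : lam.-integrable `]0%R, h1[ (EFin \o slice_volume_deriv b q s).
  by apply: integrableS intV => //; exact: subset_itv_oo_cc.
transitivity (\int[lam]_(h in `]0%R, h1[) (2%:E * (slice_volume_deriv b q s h)%:E))%E.
  apply: eq_integral => h /[!inE] /= /[!in_itv] /= /andP[h0 _].
  by rewrite -!EFinM integrand_pullback.
have -> : (\int[lam]_(h in `[0%R, h1]) (slice_volume_deriv b q s h)%:E = \int[lam]_(h in `]0%R, h1[) (slice_volume_deriv b q s h)%:E)%E.
  by apply: integral_itv_bndoo; case/integrableP: intV'.
exact: (integralZl _ intV').
Qed.

End edge_length_substitution.

(** * Triple integrals and the volume of a half sector *)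
Section lebesgue3.
Context (R : realType).
Notation lam := (@lebesgue_measure R).
Notation R1 := (measurableTypeR R).
Notation lam3 := ((lam \x lam) \x lam)%E.
Implicit Types f : R1 * R1 * R1 -> \bar R.

Lemma lebesgue2_sigma_finite : sigma_finite [set: R1 * R1] (lam \x lam)%E.
Proof.
have /sigma_finiteP[F [TF ndF Foo]] := @sigma_finiteT _ _ _ lam.
exists (fun n => F n `*` F n).
  rewrite -setXTT TF predeqE => -[x y]; split.
    move=> [/= [n _ Fnx] [k _ Gky]]; exists (maxn n k) => //; split.
    - by move: x Fnx; exact/subsetPset/ndF/leq_maxl.
    - by move: y Gky; exact/subsetPset/ndF/leq_maxr.
  by move=> [n _ []/= ? ?]; split; exists n.
move=> k; have [? ?] := Foo k.
split; first exact: measurableX.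
by rewrite product_measure1E// lte_mul_pinfty// ge0_fin_numE.
Qed.

(** Tonelli's theorem for the triple product needs the product of the first two
    factors as a sigma-finite measure. *)
Definition lebesgue2 : {sigma_finite_measure set (R1 * R1)%type -> \bar R} :=
  HB.pack (lam \x lam)%E
    (Measure_isSigmaFinite.Build _ _ _ (lam \x lam)%E lebesgue2_sigma_finite).

Let f_z f (z : R1) : measurable_fun setT f ->
  measurable_fun setT (fun p : R1 * R1 => f (p, z)).
Proof. by move=> mf; apply: measurableT_comp => //; exact: measurable_fun_pair. Qed.

Let slices f : measurable_fun setT f -> (forall p, 0 <= f p)%E ->
  (\int[lam3]_p f p = \int[lam]_z \int[(lam \x lam)%E]_x f (x, z))%E.
Proof. by move=> mf f0; exact: (@fubini_tonelli2 _ _ _ _ _ lebesgue2 lam f mf f0). Qed.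

Lemma integral3_zxy f : measurable_fun setT f -> (forall p, 0 <= f p)%E ->
  (\int[lam3]_p f p = \int[lam]_z \int[lam]_x \int[lam]_y f (x, y, z))%E.
Proof.
move=> mf f0; rewrite slices//; apply: eq_integral => z _.
exact: (@fubini_tonelli1 _ _ _ _ _ lam lam _ (f_z z mf) (fun p => f0 (p, z))).
Qed.

Lemma integral3_zyx f : measurable_fun setT f -> (forall p, 0 <= f p)%E ->
  (\int[lam3]_p f p = \int[lam]_z \int[lam]_y \int[lam]_x f (x, y, z))%E.
Proof.
move=> mf f0; rewrite slices//; apply: eq_integral => z _.
exact: (@fubini_tonelli2 _ _ _ _ _ lam lam _ (f_z z mf) (fun p => f0 (p, z))).
Qed.

Lemma integral3_xyz f : measurable_fun setT f -> (forall p, 0 <= f p)%E ->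
  (\int[lam3]_p f p = \int[lam]_x \int[lam]_y \int[lam]_z f (x, y, z))%E.
Proof.
move=> mf f0.
have -> : (\int[lam3]_p f p = \int[(lam \x lam)%E]_x \int[lam]_z f (x, z))%E.
  exact: (@fubini_tonelli1 _ _ _ _ _ lebesgue2 lam f mf f0).
have mF : measurable_fun setT (fun x => \int[lam]_z f (x, z))%E.
  exact: (@measurable_fun_fubini_tonelli_F _ _ _ _ _ lam f mf f0).
apply: (@fubini_tonelli1 _ _ _ _ _ lam lam _ mF) => p.
by apply: integral_ge0 => z _.
Qed.

End lebesgue3.

Section measurable_inequalities.
Context d (T : measurableType d) (R : realType).
Implicit Types f g : T -> R.

Lemma measurable_set_le f g : measurable_fun setT f -> measurable_fun setT g ->
  measurable [set x | f x <= g x].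
Proof.
move=> mf mg; have := measurable_fun_ler mf mg => /(_ measurableT [set true]).
by rewrite setTI; apply.
Qed.

Lemma measurable_set_lt f g : measurable_fun setT f -> measurable_fun setT g ->
  measurable [set x | f x < g x].
Proof.
move=> mf mg; have := measurable_fun_ltr mf mg => /(_ measurableT [set true]).
by rewrite setTI; apply.
Qed.

End measurable_inequalities.

Section right_triangle.
Context (R : realType) (m2 : R).
Implicit Types x y d w : R.
Notation lam := (@lebesgue_measure R).

Let K x := Num.sqrt (m2 - x ^+ 2).
(** The value of the integral of (m2 - x^2 - y^2)^-2 over the right triangle
    0 < x <= d, 0 <= y <= w x; for m2 = 1 - z^2 this is the density on a slice. *)
Definition sector_area d w := d / (2 * m2 * Num.sqrt (m2 - d ^+ 2))
  * artanh (w * d / Num.sqrt (m2 - d ^+ 2)).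

Let dy_prim x y : x ^+ 2 + y ^+ 2 < m2 ->
  is_derive y 1 (fun y => y / (2 * K x ^+ 2 * (K x ^+ 2 - y ^+ 2)) + artanh (y / K x) / (2 * K x ^+ 3))
    (((m2 - x ^+ 2 - y ^+ 2) ^+ 2)^-1).
Proof.
move=> xy; have x2 := sqr_ge0 x; have y2 := sqr_ge0 y.
have K2 : K x ^+ 2 = m2 - x ^+ 2 by rewrite sqr_sqrtr//; lra.
have K0 : 0 < K x by rewrite sqrtr_gt0; lra.
have yK : `|y| < K x.
  by rewrite -ltr_sqr ?nnegrE ?(ltW K0)// real_normK ?num_real// K2; lra.
have D0 : K x ^+ 2 - y ^+ 2 != 0 by rewrite K2 gt_eqF//; lra.
have n0 : 2 * K x ^+ 2 * (K x ^+ 2 - y ^+ 2) != 0 by rewrite !mulf_neq0// gt_eqF// exprn_gt0.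
have d1 : is_derive y 1 (fun y => 2 * K x ^+ 2 * (K x ^+ 2 - y ^+ 2)) (- 4 * K x ^+ 2 * y).
  by eapply is_derive_eq; [der|move=> /=; ring].
have d2 := @der_artanh_div _ (fun y => y) (fun=> K x) y _ _ yK (der_id y) (der_cst (K x) y).
have := der_add (der_mul (der_id y) (@der_inv _ (fun y => 2 * K x ^+ 2 * (K x ^+ 2 - y ^+ 2)) y _ n0 d1))
  (der_mul d2 (der_cst (2 * K x ^+ 3)^-1 y)).
move=> H; apply: is_derive_eq H _; rewrite -K2 /=; field.
by rewrite D0 gt_eqF.
Qed.

(** The boolean chooses which end of the interval is included, as in
    [half_sector] below. *)
Lemma integral_column (b : bool) x w : 0 <= x -> 0 <= w -> x ^+ 2 * (1 + w ^+ 2) < m2 ->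
  (\int[lam]_(y in [set` Interval (BSide b 0%R) (BSide b (x * w)%R)]) (((m2 - x ^+ 2 - y ^+ 2) ^+ 2)^-1)%:E
   = (x * w / (2 * K x ^+ 2 * (K x ^+ 2 - (x * w) ^+ 2)) + artanh (x * w / K x) / (2 * K x ^+ 3))%:E)%E.
Proof.
move=> x0 w0 xw.
have xw0 : 0 <= x * w by rewrite mulr_ge0.
have sq y : y \in `[0, x * w] -> x ^+ 2 + y ^+ 2 < m2.
  rewrite in_itv/= => /andP[y0 yxw]; apply: le_lt_trans xw.
  by rewrite mulrDr mulr1 lerD2l -exprMn ler_sqr ?nnegrE.
have cf y : y \in `[0, x * w] -> {for y, continuous (fun y => ((m2 - x ^+ 2 - y ^+ 2) ^+ 2)^-1)}.
  by move=> /sq yx; cts; rewrite expf_neq0// gt_eqF//; lra.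
have mf : measurable_fun setT (fun y => (((m2 - x ^+ 2 - y ^+ 2) ^+ 2)^-1)%:E).
  by apply/measurable_EFinP; meas.
rewrite integral_itv_bndoo; last exact: measurable_funTS mf.
rewrite -(@integral_itv_bndoo _ 0 (x * w) _ true false); last exact: measurable_funTS mf.
have -> := FTC_segment xw0 (fun v hv => dy_prim (sq v hv)) cf.
by rewrite !(mul0r, artanh0) addr0 subr0.
Qed.

Lemma integral_triangle (b : bool) d w : 0 < d -> 0 <= w -> d ^+ 2 * (1 + w ^+ 2) < m2 ->
  (\int[lam]_(x in `]0%R, d]) \int[lam]_(y in [set` Interval (BSide b 0%R) (BSide b (x * w)%R)])
     (((m2 - x ^+ 2 - y ^+ 2) ^+ 2)^-1)%:E = (sector_area d w)%:E)%E.
Proof.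
move=> d0 w0 dw.
have w2 := sqr_ge0 w.
have m20 : 0 < m2 by apply: le_lt_trans dw; rewrite mulr_ge0// ?sqr_ge0// addr_ge0.
have sq x : x \in `[0, d] -> x ^+ 2 * (1 + w ^+ 2) < m2.
  rewrite in_itv/= => /andP[x0 xd]; apply: le_lt_trans dw.
  by rewrite ler_wpM2r ?addr_ge0// ler_sqr ?nnegrE// ltW.
pose g x := x * w / (2 * K x ^+ 2 * (K x ^+ 2 - (x * w) ^+ 2)) + artanh (x * w / K x) / (2 * K x ^+ 3).
have facts x : x \in `[0, d] -> [/\ K x ^+ 2 = m2 - x ^+ 2, 0 < K x, `|x * w| < K x & K x ^+ 2 - (x * w) ^+ 2 != 0].
  move=> /[dup] xd /sq xw; have x2 := sqr_ge0 x.
  have xw2 : 0 <= x ^+ 2 * w ^+ 2 by rewrite mulr_ge0.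
  have K2 : K x ^+ 2 = m2 - x ^+ 2 by rewrite sqr_sqrtr//; lra.
  have K0 : 0 < K x by rewrite sqrtr_gt0; lra.
  split=> //; last by rewrite K2 exprMn gt_eqF//; lra.
  by rewrite -ltr_sqr ?nnegrE ?(ltW K0)// real_normK ?num_real// K2 exprMn; lra.
have cK x : {for x, continuous K} by rewrite /K; cts.
have cg x : x \in `[0, d] -> {for x, continuous g}.
  move=> /facts[K2 K0 xK D0]; have Kn : K x != 0 by rewrite gt_eqF.
  have n1 : 2 * K x ^+ 2 * (K x ^+ 2 - (x * w) ^+ 2) != 0 by rewrite mulf_neq0// mulf_neq0// expf_neq0.
  have n2 : 2 * K x ^+ 3 != 0 by rewrite mulf_neq0// expf_neq0.
  have n3 : `|x * w / K x| < 1 by rewrite normf_div (gtr0_norm K0) ltr_pdivrMr// mul1r.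
  by rewrite /g; cts => //; exact: cK.
have dg x : x \in `[0, d] -> is_derive x 1 (fun x => sector_area x w) (g x).
  move=> /facts[K2 K0 xK D0].
  have dK : is_derive x 1 K (- x / K x).
    eapply is_derive_eq; first by rewrite /K; der; rewrite -sqrtr_gt0.
    by rewrite /= -/(K x); field; rewrite gt_eqF.
  have xK' : `|w * x| < K x by rewrite mulrC.
  have dA := @der_artanh_div _ (fun x => w * x) K x _ _ xK' (der_mul (der_cst w x) (der_id x)) dK.
  have n0 : 2 * m2 * K x != 0 by rewrite !mulf_neq0// gt_eqF.
  have := der_mul (der_mul (der_id x) (@der_inv _ (fun x => 2 * m2 * K x) x _ n0 (der_mul (der_cst (2 * m2) x) dK))) dA.
  move=> H; apply: is_derive_eq H _; rewrite /g /=.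
  have mE : m2 = K x ^+ 2 + x ^+ 2 by rewrite K2; ring.
  have mn0 : K x ^+ 2 + x ^+ 2 != 0 by rewrite -mE gt_eqF.
  rewrite [w * x]mulrC {1 2 3 4}mE; set A := artanh _; field.
  by rewrite D0 mn0 gt_eqF.
transitivity (\int[lam]_(x in `]0%R, d]) (g x)%:E)%E.
  apply: eq_integral => x /[!inE] /= /[!in_itv]/= /andP[x0 xd].
  by apply: integral_column => //; [exact: ltW|apply: sq; rewrite in_itv/= ltW].
have mg : measurable_fun `]0, d] (EFin \o g).
  apply/measurable_EFinP; apply: subspace_continuous_measurable_fun => //.
  apply: continuous_in_subspaceT => x /[!inE] /= /[!in_itv]/= /andP[x0 xd].
  by apply: cg; rewrite in_itv/= ltW.
rewrite integral_itv_obnd_cbnd//.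
have -> := FTC_segment (ltW d0) dg cg.
by rewrite /sector_area !mul0r subr0.
Qed.

End right_triangle.

Section half_sector.
Context (R : realType) (r h0 q s : R).
Hypothesis q01 : 0 < q < 1.
Hypothesis s0 : 0 < s.
Hypothesis qs : q ^+ 2 + s ^+ 2 = 1.
Hypothesis r0 : 0 < r.
Hypothesis h00 : 0 < h0.
Hypothesis rh : r ^+ 2 + h0 ^+ 2 < 1.
Notation lam := (@lebesgue_measure R).
Notation R1 := (measurableTypeR R).
Implicit Types x y z u : R.

Definition slice_apothem z := r * apothem q (z / h0).
Definition slice_slope z := halfside s (z / h0) / apothem q (z / h0).

(** With [true] the plane y = 0 is included and the surface of corners excluded,
    with [false] the converse: the two kinds of halves then tile a sector without
    overlap. *)
Definition half_sector (b : bool) : set (pt3 R) :=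
  [set p | [/\ p.2 \in `[- h0, h0], p.1.1 \in `]0, slice_apothem p.2] &
    p.1.2 \in Interval (BSide b 0) (BSide b (p.1.1 * slice_slope p.2))]].

Lemma half_sector_measurable b : measurable (half_sector b : set (R1 * R1 * R1)).
Proof.
have m1 : measurable_fun setT (fun p : R1 * R1 * R1 => p.1.1) by exact: measurableT_comp.
have m2 : measurable_fun setT (fun p : R1 * R1 * R1 => p.1.2) by exact: measurableT_comp.
have m3 : measurable_fun setT (fun p : R1 * R1 * R1 => p.2) by exact: measurable_snd.
have ma : measurable_fun setT (fun p : R1 * R1 * R1 => slice_apothem p.2).
  by rewrite /slice_apothem /apothem; meas.
have mw : measurable_fun setT (fun p : R1 * R1 * R1 => p.1.1 * slice_slope p.2).
  by rewrite /slice_slope /apothem /halfside; meas.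
have -> : half_sector b =
  [set p : R1 * R1 * R1 | - h0 <= p.2] `&` [set p : R1 * R1 * R1 | p.2 <= h0] `&`
  [set p : R1 * R1 * R1 | 0 < p.1.1] `&` [set p : R1 * R1 * R1 | p.1.1 <= slice_apothem p.2] `&`
  (if b then [set p : R1 * R1 * R1 | 0 <= p.1.2] `&` [set p : R1 * R1 * R1 | p.1.2 < p.1.1 * slice_slope p.2]
   else [set p : R1 * R1 * R1 | 0 < p.1.2] `&` [set p : R1 * R1 * R1 | p.1.2 <= p.1.1 * slice_slope p.2]).
  apply/seteqP; split => p; rewrite /half_sector /= !in_itv/=; case: b => /=;
    [move=> [/andP[-> ->] /andP[-> ->] /andP[-> ->]]|move=> [/andP[-> ->] /andP[-> ->] /andP[-> ->]]
    |move=> [[[[-> ->] ->] ->] [-> ->]]|move=> [[[[-> ->] ->] ->] [-> ->]]]; by [].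
do ![apply: measurableI]; try exact: measurable_set_le; try exact: measurable_set_lt.
by case: b; apply: measurableI; try exact: measurable_set_le; try exact: measurable_set_lt.
Qed.

Definition density (p : pt3 R) : R := ((1 - dot p p) ^+ 2)^-1.

Lemma measurable_density : measurable_fun setT (density : R1 * R1 * R1 -> R).
Proof.
have m1 : measurable_fun setT (fun p : R1 * R1 * R1 => p.1.1) by exact: measurableT_comp.
have m2 : measurable_fun setT (fun p : R1 * R1 * R1 => p.1.2) by exact: measurableT_comp.
have m3 : measurable_fun setT (fun p : R1 * R1 * R1 => p.2) by exact: measurable_snd.
by rewrite /density /dot; meas.
Qed.

Lemma density_ge0 p : 0 <= density p.
Proof. by rewrite invr_ge0 sqr_ge0. Qed.

Lemma hvolumeE (A : set (pt3 R)) : measurable (A : set (R1 * R1 * R1)) ->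
  (hvolume A = \int[(lam \x lam) \x lam]_p ((EFin \o density) \_ A) p)%E.
Proof. by move=> mA; rewrite /hvolume integral_mkcond. Qed.

Lemma measurable_density_restrict (A : set (pt3 R)) : measurable (A : set (R1 * R1 * R1)) ->
  measurable_fun setT ((EFin \o density) \_ A : R1 * R1 * R1 -> \bar R).
Proof.
move=> mA; apply/measurable_restrict => //; rewrite setTI.
by apply/measurable_EFinP; apply: measurable_funTS; exact: measurable_density.
Qed.

Lemma density_restrict_ge0 (A : set (pt3 R)) p : (0 <= ((EFin \o density) \_ A) p)%E.
Proof. by rewrite patchE; case: ifP => // _; rewrite lee_fin density_ge0. Qed.

Let ub z : z \in `[- h0, h0] -> z / h0 \in `[-1, 1].
Proof. by rewrite !in_itv/= ler_pdivlMr// ler_pdivrMr// mulN1r mul1r. Qed.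

Let apo_gt0 z : z \in `[- h0, h0] -> 0 < apothem q (z / h0).
Proof.
move=> /ub /(apothem_bounds q01) /andP[+ _]; apply: lt_le_trans.
by case/andP: q01.
Qed.

(** The corner of a slice lies on an edge, hence in the ball. *)
Let in_ball z : z \in `[- h0, h0] ->
  slice_apothem z ^+ 2 * (1 + slice_slope z ^+ 2) < 1 - z ^+ 2.
Proof.
move=> zh; have a0 := apo_gt0 zh; have u1 := ub zh.
rewrite /slice_apothem /slice_slope.
have -> : z ^+ 2 = h0 ^+ 2 * (z / h0) ^+ 2 by field; rewrite gt_eqF.
have s2 : s ^+ 2 = 1 - q ^+ 2 by rewrite -qs; ring.
move: (z / h0) u1 a0 => u u1 a0.
have -> : (r * apothem q u) ^+ 2 * (1 + (halfside s u / apothem q u) ^+ 2)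
   = r ^+ 2 * (apothem q u ^+ 2 + s ^+ 2 * ((1 + u) / 2) ^+ 2).
  by rewrite /halfside; field; rewrite gt_eqF.
have -> : apothem q u ^+ 2 + s ^+ 2 * ((1 + u) / 2) ^+ 2 = 1 - (1 - u ^+ 2) * ((1 - q) / 2).
  by rewrite s2 /apothem; field.
have u2 : 0 <= 1 - u ^+ 2 by move: u1; rewrite in_itv/= => /andP[]; nra.
have q2 : 0 <= (1 - q) / 2 by case/andP: q01 => *; lra.
have r2 := sqr_ge0 r; have h2 := sqr_ge0 h0.
have e1 : 0 <= r ^+ 2 * ((1 - u ^+ 2) * ((1 - q) / 2)) by rewrite mulr_ge0// mulr_ge0.
have e2 : 0 <= h0 ^+ 2 * (1 - u ^+ 2) by rewrite mulr_ge0.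
have rh' : r ^+ 2 + h0 ^+ 2 < 1 := rh.
by lra.
Qed.

Let slope_ge0 z : z \in `[- h0, h0] -> 0 <= slice_slope z.
Proof.
move=> zh; rewrite /slice_slope divr_ge0 ?(ltW (apo_gt0 zh))// /halfside.
by move: (ub zh); rewrite in_itv/= => /andP[u1 _]; rewrite divr_ge0// mulr_ge0 ?(ltW s0)//; lra.
Qed.

Lemma half_sector_slices b :
  (hvolume (half_sector b) = \int[lam]_(z in `[(- h0)%R, h0])
     (sector_area (1 - z ^+ 2) (slice_apothem z) (slice_slope z))%:E)%E.
Proof.
have mD := half_sector_measurable b.
rewrite hvolumeE// integral3_zxy; last 2 first.
- exact: measurable_density_restrict.
- by move=> p; exact: density_restrict_ge0.
rewrite [RHS]integral_mkcond; apply: eq_integral => z _.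
rewrite [RHS]patchE; case: ifPn => [|nz]; last first.
  rewrite integral0_eq// => x _; rewrite integral0_eq// => y _.
  rewrite patchE memNset//= => -[zz _ _]; move/negP: nz; apply.
  by rewrite inE.
rewrite inE /= => zh.
have d0 : 0 < slice_apothem z by rewrite mulr_gt0// apo_gt0.
rewrite -(integral_triangle b d0 (slope_ge0 zh) (in_ball zh)).
rewrite [RHS]integral_mkcond; apply: eq_integral => x _.
rewrite [RHS]patchE; case: ifPn => [|nx]; last first.
  rewrite integral0_eq// => y _.
  rewrite patchE memNset//= => -[_ xx _]; move/negP: nx; apply.
  by rewrite inE.
rewrite inE /= => xh.
rewrite [RHS]integral_mkcond; apply: eq_integral => y _.
rewrite [LHS]patchE [RHS]patchE.
have -> : ((x, y, z) \in half_sector b) =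
  (y \in [set` Interval (BSide b 0) (BSide b (x * slice_slope z))]).
  by apply/idP/idP; rewrite !inE /half_sector /= => // -[].
case: ifP => // _; congr (_%:E); rewrite /density /dot /=; congr ((_ ^+ 2)^-1); ring.
Qed.

Let X := (1 - r ^+ 2 - h0 ^+ 2)^-1.
Let b := r * Num.sqrt X.
Let h := h0 * Num.sqrt X.

(** The slice at height z = h0 u contributes [sector_area]; multiplying the Klein
    coordinates by the time coordinate sqrt X turns it into [slice_density]. *)
Lemma half_sector_volume e :
  (hvolume (half_sector e) = (2^-1)%:E * \int[lam]_(u in `[(-1)%R, 1%R]) (slice_density b q s h u)%:E)%E.
Proof.
have rh' : r ^+ 2 + h0 ^+ 2 < 1 := rh.
have X0 : 0 < X by rewrite invr_gt0; lra.
have sX0 : 0 < Num.sqrt X by rewrite sqrtr_gt0.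
have sX2 : Num.sqrt X ^+ 2 = X by rewrite sqr_sqrtr// ltW.
have b0 : 0 < b by rewrite mulr_gt0.
rewrite half_sector_slices.
pose Phi z := sector_area (1 - z ^+ 2) (slice_apothem z) (slice_slope z).
have mart : measurable_fun setT (@artanh R).
  rewrite /artanh; apply: measurable_funM => //; apply: measurable_funB.
    by apply: measurableT_comp => //; apply: measurable_funD.
  by apply: measurableT_comp => //; apply: measurable_funB.
have mPhi : measurable_fun setT (EFin \o Phi).
  apply/measurable_EFinP; rewrite /Phi /sector_area /slice_apothem /slice_slope /apothem /halfside.
  apply: measurable_funM; first by meas.
  by apply: (measurableT_comp mart); meas.
rewrite integral_itv_bndoo; last exact: measurable_funTS mPhi.
have dphi (u : R) : u \in `[-1, 1] -> is_derive u 1 (fun u => h0 * u) h0.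
  by move=> _; eapply is_derive_eq; [der|move=> /=; ring].
have cphi (u : R) : u \in `[-1, 1] -> {for u, continuous (fun=> h0)} by move=> _; exact: cts_cst.
have n11 : -1 < 1 :> R by lra.
have := integral_increasing n11 dphi cphi (fun _ _ => h00) mPhi.
rewrite mulrN1 mulr1 => ->.
have intF := slice_density_integrable q01 qs b0 h.
have intF' : lam.-integrable `](-1)%R, 1%R[ (EFin \o slice_density b q s h).
  by apply: integrableS intF => //; exact: subset_itv_oo_cc.
transitivity (\int[lam]_(u in `](-1)%R, 1%R[) ((2^-1)%:E * (slice_density b q s h u)%:E))%E.
  apply: eq_integral => u /[!inE] /= /subset_itv_oo_cc u1.
  rewrite /= -!EFinM; congr (_%:E).
  have a0 : 0 < apothem q u.
    have /andP[+ _] := apothem_bounds q01 u1; apply: lt_le_trans.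
    by case/andP: q01.
  have uE : h0 * u / h0 = u by rewrite mulrAC divff ?mul1r// gt_eqF.
  have hu : h0 * u \in `[- h0, h0].
    move: u1; rewrite !in_itv/= => /andP[u1 u2]; apply/andP; split.
      by rewrite -mulrN1 ler_pM2l.
    by rewrite -{2}[h0]mulr1 ler_pM2l.
  have inb := in_ball hu.
  rewrite /Phi /sector_area.
  set k := Num.sqrt _.
  have k2E : 1 - (h0 * u) ^+ 2 - slice_apothem (h0 * u) ^+ 2 > 0.
    move: inb; rewrite mulrDr mulr1.
    have : 0 <= slice_apothem (h0 * u) ^+ 2 * slice_slope (h0 * u) ^+ 2 by rewrite mulr_ge0 ?sqr_ge0.
    by lra.
  have k0 : 0 < k by rewrite sqrtr_gt0.
  have XE : time_sqr b h = X.
    rewrite /time_sqr /b /h !exprMn sX2 /X; field; rewrite gt_eqF//; lra.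
  have NE : axis_form b h u = X * (1 - (h0 * u) ^+ 2) by rewrite /axis_form XE /h !exprMn sX2; ring.
  have kE : apothem_root b q h u = Num.sqrt X * k.
    rewrite /k -sqrtrM ?(ltW X0)// /apothem_root /apothem_form NE /b !exprMn sX2 /slice_apothem uE; congr (Num.sqrt _); ring.
  have m0 : 0 < 1 - (h0 * u) ^+ 2 by move: k2E; have := sqr_ge0 (slice_apothem (h0 * u)); lra.
  rewrite /slice_density /slice_weight /half_side_length kE NE /time_coord XE.
  have -> : slice_slope (h0 * u) * slice_apothem (h0 * u) / k = b * halfside s u / (Num.sqrt X * k).
    by rewrite /slice_slope /slice_apothem uE /b; field; rewrite !gt_eqF.
  set A := artanh _; rewrite /slice_apothem uE /b /h.
  set S := Num.sqrt X in sX0 sX2 *; rewrite -sX2; field.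
  by rewrite !gt_eqF.
rewrite (integralZl _ intF')//; congr (_ * _)%E; apply/esym.
by apply: integral_itv_bndoo; case/integrableP: intF'.
Qed.

End half_sector.

(** * Maps of space preserving Lebesgue measure *)
Section lebesgue_invariance.
Context (R : realType).
Notation lam := (@lebesgue_measure R).
Notation R1 := (measurableTypeR R).
Notation R3 := (R1 * R1 * R1)%type.
Notation lam3 := ((lam \x lam) \x lam)%E.

Lemma measurable_coord1 : measurable_fun setT (fun p : R3 => p.1.1 : R).
Proof. exact: measurableT_comp. Qed.
Lemma measurable_coord2 : measurable_fun setT (fun p : R3 => p.1.2 : R).
Proof. exact: measurableT_comp. Qed.
Lemma measurable_coord3 : measurable_fun setT (fun p : R3 => p.2 : R).
Proof. exact: measurable_snd. Qed.

Lemma measurable_triple (f g h : R3 -> R) : measurable_fun setT f ->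
  measurable_fun setT g -> measurable_fun setT h ->
  measurable_fun setT (fun p => (f p, g p, h p) : R3).
Proof. by move=> mf mg mh; exact: (measurable_fun_pair (measurable_fun_pair mf mg) mh). Qed.

(** Preservation is stated for integrals of nonnegative functions, which compose
    directly with Tonelli's theorem. *)
Definition lebesgue_preserving (f : R3 -> R3) := measurable_fun setT f /\
  forall F : R3 -> \bar R, measurable_fun setT F -> (forall p, 0 <= F p)%E ->
    (\int[lam3]_p F (f p) = \int[lam3]_p F p)%E.

Lemma lebesgue_preserving_comp f g : lebesgue_preserving f -> lebesgue_preserving g ->
  lebesgue_preserving (g \o f).
Proof.
move=> [mf If] [mg Ig]; split; first exact: measurableT_comp.
move=> F mF F0; rewrite -[RHS](Ig F)//.
exact: (If (F \o g) (measurableT_comp mF mg) (fun p => F0 _)).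
Qed.

(** A shear, possibly composed with a reflection of the sheared coordinate, is a
    translation or reflection on every line parallel to that coordinate. *)
Section coordinate.
Variables (al : R) (g : R1 * R1 -> R).
Hypothesis al1 : `|al| = 1.
Hypothesis mg : measurable_fun setT g.

Let al0 : al != 0. Proof. by rewrite -normr_eq0 al1 oner_eq0. Qed.

Let affine (be : R) (G : R -> \bar R) : measurable_fun setT G -> (forall x, 0 <= G x)%E ->
  (\int[lam]_x G (al * x + be)%R = \int[lam]_x G x)%E.
Proof.
move=> mG G0; rewrite -[RHS](@ge0_integral_affine R al be)//.
by apply: eq_integral => x _; rewrite al1 mule1.
Qed.

Let section F (h : R1 -> R3) : measurable_fun setT (F : R3 -> \bar R) -> measurable_fun setT h ->
  measurable_fun setT (F \o h).
Proof. by move=> mF mh; exact: measurableT_comp. Qed.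

Lemma lebesgue_preserving_x :
  lebesgue_preserving (fun p => (al * p.1.1 + g (p.1.2, p.2), p.1.2, p.2)).
Proof.
have c1 := measurable_coord1; have c2 := measurable_coord2; have c3 := measurable_coord3.
have mf : measurable_fun setT (fun p : R3 => (al * p.1.1 + g (p.1.2, p.2), p.1.2, p.2) : R3).
  apply: measurable_triple => //; apply: measurable_funD; first exact: measurable_funM.
  by apply: measurableT_comp => //; apply: measurable_fun_pair.
split=> // F mF F0.
have -> := integral3_zyx (measurableT_comp mF mf) (fun p => F0 _).
rewrite [RHS](integral3_zyx mF F0); apply: eq_integral => z _; apply: eq_integral => y _ /=.
apply: (affine (g (y, z)) (G := fun x => F (x, y, z))) => //.
by apply: (section (h := fun x => (x, y, z))) => //; do 2 apply: measurable_fun_pair => //.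
Qed.

Lemma lebesgue_preserving_y :
  lebesgue_preserving (fun p => (p.1.1, al * p.1.2 + g (p.1.1, p.2), p.2)).
Proof.
have c1 := measurable_coord1; have c2 := measurable_coord2; have c3 := measurable_coord3.
have mf : measurable_fun setT (fun p : R3 => (p.1.1, al * p.1.2 + g (p.1.1, p.2), p.2) : R3).
  apply: measurable_triple => //; apply: measurable_funD; first exact: measurable_funM.
  by apply: measurableT_comp => //; apply: measurable_fun_pair.
split=> // F mF F0.
have -> := integral3_zxy (measurableT_comp mF mf) (fun p => F0 _).
rewrite [RHS](integral3_zxy mF F0); apply: eq_integral => z _; apply: eq_integral => x _ /=.
apply: (affine (g (x, z)) (G := fun y => F (x, y, z))) => //.
by apply: (section (h := fun y => (x, y, z))) => //; do 2 apply: measurable_fun_pair => //.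
Qed.

Lemma lebesgue_preserving_z :
  lebesgue_preserving (fun p => (p.1.1, p.1.2, al * p.2 + g (p.1.1, p.1.2))).
Proof.
have c1 := measurable_coord1; have c2 := measurable_coord2; have c3 := measurable_coord3.
have mf : measurable_fun setT (fun p : R3 => (p.1.1, p.1.2, al * p.2 + g (p.1.1, p.1.2)) : R3).
  apply: measurable_triple => //; apply: measurable_funD; first exact: measurable_funM.
  by apply: measurableT_comp => //; apply: measurable_fun_pair.
split=> // F mF F0.
have -> := integral3_xyz (measurableT_comp mF mf) (fun p => F0 _).
rewrite [RHS](integral3_xyz mF F0); apply: eq_integral => x _; apply: eq_integral => y _ /=.
apply: (affine (g (x, y)) (G := fun z => F (x, y, z))) => //.
by apply: (section (h := fun z => (x, y, z))) => //; do 2 apply: measurable_fun_pair => //.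
Qed.

End coordinate.

Definition rot12 (c s : R) (p : pt3 R) : pt3 R :=
  (c * p.1.1 - s * p.1.2, s * p.1.1 + c * p.1.2, p.2).
Definition rot13 (c s : R) (p : pt3 R) : pt3 R :=
  (c * p.1.1 - s * p.2, p.1.2, s * p.1.1 + c * p.2).
Definition flip2 (p : pt3 R) : pt3 R := (p.1.1, - p.1.2, p.2).
Definition flip3 (p : pt3 R) : pt3 R := (p.1.1, p.1.2, - p.2).

Let norm1 : `|1 : R| = 1. Proof. exact: normr1. Qed.
Let normN1 : `|-1 : R| = 1. Proof. by rewrite normrN1. Qed.

(** A rotation by an angle other than pi is a product of three shears of parameters
    - tan (theta / 2), sin theta, - tan (theta / 2); rotation by pi is the square
    of rotation by pi / 2. *)
Lemma lebesgue_preserving_rot12 c s : c ^+ 2 + s ^+ 2 = 1 -> lebesgue_preserving (rot12 c s).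
Proof.
have generic c' s' : c' != -1 -> c' ^+ 2 + s' ^+ 2 = 1 -> lebesgue_preserving (rot12 c' s').
  move=> cN1 cs; pose t := s' / (1 + c').
  have c0 : 1 + c' != 0 by rewrite addrC addr_eq0.
  have ts : t * s' = 1 - c'.
    have s2 : s' ^+ 2 = 1 - c' ^+ 2 by have := cs; lra.
    by apply: (mulIf c0); rewrite /t mulrAC divfK// -expr2 s2; ring.
  have tc : t * (1 + c') = s' by rewrite /t divfK.
  have m1 (a : R) : measurable_fun setT (fun q : R1 * R1 => a * q.1) by apply: measurable_funM.
  have Sx := lebesgue_preserving_x norm1 (m1 (- t)).
  have Sy := lebesgue_preserving_y norm1 (m1 s').
  have -> : rot12 c' s' = (fun p => (1 * p.1.1 + - t * p.1.2, p.1.2, p.2)) \o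
     ((fun p => (p.1.1, 1 * p.1.2 + s' * p.1.1, p.2)) \o
      (fun p => (1 * p.1.1 + - t * p.1.2, p.1.2, p.2))).
    apply/funext => -[[x y] z]; rewrite /rot12 /=.
    have E2 : s' * x + c' * y = 1 * y + s' * (1 * x + - t * y).
      transitivity (s' * x + (1 - t * s') * y); first by rewrite ts; ring.
      ring.
    congr (_, _, _) => //; rewrite -E2.
    transitivity ((1 - t * s') * x - t * (1 + c') * y); first by rewrite ts tc; ring.
    ring.
  exact: (lebesgue_preserving_comp (lebesgue_preserving_comp Sx Sy) Sx).
move=> cs; have [cE|cN] := eqVneq c (-1); last exact: generic.
have s0 : s = 0.
  by apply/eqP; rewrite -sqrf_eq0; apply/eqP; move: cs; rewrite cE sqrrN expr1n; lra.
have G : lebesgue_preserving (rot12 0 1).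
  by apply: generic; [rewrite eq_sym oppr_eq0 oner_eq0|ring].
have -> : rot12 c s = rot12 0 1 \o rot12 0 1.
  by apply/funext => -[[x y] z]; rewrite /rot12 /= cE s0; congr (_, _, _); ring.
exact: lebesgue_preserving_comp.
Qed.

Lemma lebesgue_preserving_rot13 c s : c ^+ 2 + s ^+ 2 = 1 -> lebesgue_preserving (rot13 c s).
Proof.
have generic c' s' : c' != -1 -> c' ^+ 2 + s' ^+ 2 = 1 -> lebesgue_preserving (rot13 c' s').
  move=> cN1 cs; pose t := s' / (1 + c').
  have c0 : 1 + c' != 0 by rewrite addrC addr_eq0.
  have ts : t * s' = 1 - c'.
    have s2 : s' ^+ 2 = 1 - c' ^+ 2 by have := cs; lra.
    by apply: (mulIf c0); rewrite /t mulrAC divfK// -expr2 s2; ring.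
  have tc : t * (1 + c') = s' by rewrite /t divfK.
  have m1 (a : R) : measurable_fun setT (fun q : R1 * R1 => a * q.1) by apply: measurable_funM.
  have m2 (a : R) : measurable_fun setT (fun q : R1 * R1 => a * q.2) by apply: measurable_funM.
  have Sx := lebesgue_preserving_x norm1 (m2 (- t)).
  have Sz := lebesgue_preserving_z norm1 (m1 s').
  have -> : rot13 c' s' = (fun p => (1 * p.1.1 + - t * p.2, p.1.2, p.2)) \o
     ((fun p => (p.1.1, p.1.2, 1 * p.2 + s' * p.1.1)) \o
      (fun p => (1 * p.1.1 + - t * p.2, p.1.2, p.2))).
    apply/funext => -[[x y] z]; rewrite /rot13 /=.
    have E2 : s' * x + c' * z = 1 * z + s' * (1 * x + - t * z).
      transitivity (s' * x + (1 - t * s') * z); first by rewrite ts; ring.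
      ring.
    congr (_, _, _) => //; rewrite -E2.
    transitivity ((1 - t * s') * x - t * (1 + c') * z); first by rewrite ts tc; ring.
    ring.
  exact: (lebesgue_preserving_comp (lebesgue_preserving_comp Sx Sz) Sx).
move=> cs; have [cE|cN] := eqVneq c (-1); last exact: generic.
have s0 : s = 0.
  by apply/eqP; rewrite -sqrf_eq0; apply/eqP; move: cs; rewrite cE sqrrN expr1n; lra.
have G : lebesgue_preserving (rot13 0 1).
  by apply: generic; [rewrite eq_sym oppr_eq0 oner_eq0|ring].
have -> : rot13 c s = rot13 0 1 \o rot13 0 1.
  by apply/funext => -[[x y] z]; rewrite /rot13 /= cE s0; congr (_, _, _); ring.
exact: lebesgue_preserving_comp.
Qed.

Lemma lebesgue_preserving_flip2 : lebesgue_preserving flip2.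
Proof.
have -> : flip2 = fun p => (p.1.1, -1 * p.1.2 + cst 0 (p.1.1, p.2), p.2).
  by apply/funext => p; rewrite /flip2 /= addr0 mulN1r.
exact: lebesgue_preserving_y.
Qed.

Lemma lebesgue_preserving_flip3 : lebesgue_preserving flip3.
Proof.
have -> : flip3 = fun p => (p.1.1, p.1.2, -1 * p.2 + cst 0 (p.1.1, p.1.2)).
  by apply/funext => p; rewrite /flip3 /= addr0 mulN1r.
exact: lebesgue_preserving_z.
Qed.

End lebesgue_invariance.

(** * Motions of the Klein ball *)
Section motions.
Context (R : realType).
Notation lam := (@lebesgue_measure R).
Notation R1 := (measurableTypeR R).
Notation R3 := (R1 * R1 * R1)%type.
Notation lam3 := ((lam \x lam) \x lam)%E.
Implicit Types (p q : pt3 R).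

Definition cosh_dist p q : R := (1 - dot p q) / Num.sqrt ((1 - dot p p) * (1 - dot q q)).

(** The properties of an isometry of the ball that the reduction to the standard
    position needs. They are closed under composition, so they need checking on generators
    only. *)
Record motion (f : pt3 R -> pt3 R) : Prop := Motion {
  motion_H3 : forall p, H3 p -> H3 (f p);
  motion_dist : forall p q, H3 p -> H3 q -> cosh_dist (f p) (f q) = cosh_dist p q;
  motion_volume : forall A : set (pt3 R), measurable (A : set R3) -> A `<=` @H3 R ->
    measurable (@H3 R `&` f @^-1` A : set R3) /\ hvolume (@H3 R `&` f @^-1` A) = hvolume A;
  motion_hull : forall m (V : 'I_m -> pt3 R), (forall i, H3 (V i)) ->
    forall p, H3 p -> hull V p <-> hull (f \o V) (f p);
  motion_coplanar : forall m (V : 'I_m -> pt3 R), (forall i, H3 (V i)) ->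
    coplanar (f \o V) -> coplanar V
}.

Lemma motion_comp f g : motion f -> motion g -> motion (g \o f).
Proof.
move=> mf mg; split.
- by move=> p /(motion_H3 mf)/(motion_H3 mg).
- by move=> p q Hp Hq /=; rewrite (motion_dist mg) ?(motion_dist mf)//; exact: motion_H3 mf _ _.
- move=> A mA AH; have [mB eB] := motion_volume mg mA AH.
  have [mC eC] := motion_volume mf mB (@subIsetl _ _ _).
  have E : @H3 R `&` (g \o f) @^-1` A = @H3 R `&` f @^-1` (@H3 R `&` g @^-1` A).
    by apply/seteqP; split => p /= [Hp]; [move=> Ap; split => //; split => //; exact: motion_H3 mf _ _|case].
  by rewrite E eC.
- move=> m V HV p Hp; rewrite (motion_hull mf HV Hp).
  have HfV i : H3 ((f \o V) i) by exact: motion_H3 mf _ _.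
  by rewrite (motion_hull mg HfV (motion_H3 mf Hp)).
- move=> m V HV c; apply: (motion_coplanar mf HV); apply: (motion_coplanar mg) => //.
  by move=> i; exact: motion_H3 mf _ _.
Qed.

Definition lincomb m (w : 'I_m -> R) (V : 'I_m -> pt3 R) : pt3 R :=
  (\sum_i w i * (V i).1.1, \sum_i w i * (V i).1.2, \sum_i w i * (V i).2).

Lemma measurable_H3 : measurable (@H3 R : set R3).
Proof.
apply: (measurable_set_lt (f := fun p : R3 => dot p p)) => //.
have c1 := @measurable_coord1 R; have c2 := @measurable_coord2 R; have c3 := @measurable_coord3 R.
by rewrite /dot; meas.
Qed.

(** For an orthogonal linear map with a linear inverse everything but the volume
    is formal. *)
Section linear.
Variables f g : pt3 R -> pt3 R.
Hypothesis f_lin : forall m w (V : 'I_m -> pt3 R), f (lincomb w V) = lincomb w (f \o V).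
Hypothesis f_dot : forall p q, dot (f p) (f q) = dot p q.
Hypothesis gf : forall p, g (f p) = p.
Hypothesis g_dot : forall p q, dot (g p) (g q) = dot p q.
Hypothesis f_leb : lebesgue_preserving f.

Lemma motion_linear : motion f.
Proof.
split.
- by move=> p; rewrite /H3 /= f_dot.
- by move=> p q _ _; rewrite /cosh_dist !f_dot.
- move=> A mA AH.
  have E : @H3 R `&` f @^-1` A = f @^-1` A.
    by apply/seteqP; split => p /= => [[]//|Ap]; split => //; have := AH _ Ap; rewrite /H3 /= f_dot.
  rewrite E; case: f_leb => mf If.
  have mB : measurable (f @^-1` A : set R3) by rewrite -[X in measurable X]setTI; exact: mf.
  split => //; rewrite !hvolumeE//.
  rewrite -[RHS](If _ (measurable_density_restrict mA) (density_restrict_ge0 A)).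
  apply: eq_integral => p _; rewrite !patchE.
  have -> : (p \in f @^-1` A) = (f p \in A) by apply/idP/idP; rewrite !inE.
  by rewrite /= /density f_dot.
- move=> m V HV p Hp; split => [[w [w0 w1 ->]]|[w [w0 w1 e]]].
    by exists w; split => //; rewrite -[LHS]/(f (lincomb w V)) f_lin.
  exists w; split => //.
  by rewrite -[RHS]/(lincomb w V) -[RHS]gf f_lin -[RHS]/(g (lincomb w (f \o V))) -[lincomb _ _]e gf.
- move=> m V HV [u [b [u0 ub]]]; exists (g u), b; split; last first.
    by move=> i; rewrite -(ub i) -{1}(gf (V i)) g_dot.
  move=> gu0; apply: u0; have : dot u u = 0 by rewrite -g_dot gu0 /dot /= !mul0r !addr0.
  case: u {ub gu0} => -[x y] z; rewrite /dot /= -!expr2 => /eqP.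
  rewrite paddr_eq0 ?addr_ge0 ?sqr_ge0// paddr_eq0 ?sqr_ge0// !sqrf_eq0.
  by move=> /andP[/andP[/eqP-> /eqP->] /eqP->].
Qed.

End linear.

Lemma dot_rot12 c s p q : c ^+ 2 + s ^+ 2 = 1 ->
  dot (rot12 c s p) (rot12 c s q) = dot p q.
Proof.
move=> cs; transitivity ((c ^+ 2 + s ^+ 2) * (p.1.1 * q.1.1 + p.1.2 * q.1.2) + p.2 * q.2).
  by rewrite /dot /rot12 /=; ring.
by rewrite cs mul1r.
Qed.

Lemma dot_rot13 c s p q : c ^+ 2 + s ^+ 2 = 1 ->
  dot (rot13 c s p) (rot13 c s q) = dot p q.
Proof.
move=> cs; transitivity ((c ^+ 2 + s ^+ 2) * (p.1.1 * q.1.1 + p.2 * q.2) + p.1.2 * q.1.2).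
  by rewrite /dot /rot13 /=; ring.
by rewrite cs mul1r /dot; ring.
Qed.

Lemma dot_flip2 p q : dot (flip2 p) (flip2 q) = dot p q.
Proof. by rewrite /dot /flip2 /=; ring. Qed.

Lemma dot_flip3 p q : dot (flip3 p) (flip3 q) = dot p q.
Proof. by rewrite /dot /flip3 /=; ring. Qed.

Lemma motion_rot12 c s : c ^+ 2 + s ^+ 2 = 1 -> motion (rot12 c s).
Proof.
move=> cs.
have cs' : c ^+ 2 + (- s) ^+ 2 = 1 by rewrite sqrrN.
apply: (@motion_linear (rot12 c s) (rot12 c (- s))).
- move=> m w V; rewrite /rot12 /lincomb /=; congr (_, _, _).
    by rewrite !mulr_sumr -sumrB; apply: eq_bigr => i _; ring.
  by rewrite !mulr_sumr -big_split; apply: eq_bigr => i _ /=; ring.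
- by move=> p q; exact: dot_rot12.
- move=> [[x y] z]; rewrite /rot12 /=; congr (_, _, _).
    by transitivity ((c ^+ 2 + s ^+ 2) * x); [ring|rewrite cs mul1r].
  by transitivity ((c ^+ 2 + s ^+ 2) * y); [ring|rewrite cs mul1r].
- by move=> p q; exact: dot_rot12.
- exact: lebesgue_preserving_rot12.
Qed.

Lemma motion_rot13 c s : c ^+ 2 + s ^+ 2 = 1 -> motion (rot13 c s).
Proof.
move=> cs.
have cs' : c ^+ 2 + (- s) ^+ 2 = 1 by rewrite sqrrN.
apply: (@motion_linear (rot13 c s) (rot13 c (- s))).
- move=> m w V; rewrite /rot13 /lincomb /=; congr (_, _, _).
    by rewrite !mulr_sumr -sumrB; apply: eq_bigr => i _; ring.
  by rewrite !mulr_sumr -big_split; apply: eq_bigr => i _ /=; ring.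
- by move=> p q; exact: dot_rot13.
- move=> [[x y] z]; rewrite /rot13 /=; congr (_, _, _).
    by transitivity ((c ^+ 2 + s ^+ 2) * x); [ring|rewrite cs mul1r].
  by transitivity ((c ^+ 2 + s ^+ 2) * z); [ring|rewrite cs mul1r].
- by move=> p q; exact: dot_rot13.
- exact: lebesgue_preserving_rot13.
Qed.

Lemma motion_flip2 : motion (@flip2 R).
Proof.
have fd := dot_flip2.
apply: (@motion_linear _ (@flip2 R)) => //.
- move=> m w V; rewrite /flip2 /lincomb /=; congr (_, _, _).
  by rewrite -sumrN; apply: eq_bigr => i _; rewrite mulrN.
- by move=> [[x y] z]; rewrite /flip2 /= opprK.
- exact: lebesgue_preserving_flip2.
Qed.

Lemma motion_flip3 : motion (@flip3 R).
Proof.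
have fd := dot_flip3.
apply: (@motion_linear _ (@flip3 R)) => //.
- move=> m w V; rewrite /flip3 /lincomb /=; congr (_, _, _).
  by rewrite -sumrN; apply: eq_bigr => i _; rewrite mulrN.
- by move=> [[x y] z]; rewrite /flip3 /= opprK.
- exact: lebesgue_preserving_flip3.
Qed.

Section boost.
Variable v : R.
Hypothesis v1 : v ^+ 2 < 1.

Let e := Num.sqrt (1 - v ^+ 2).
Let e0 : 0 < e. Proof. by rewrite sqrtr_gt0 subr_gt0. Qed.
Let e2 : e ^+ 2 = 1 - v ^+ 2. Proof. by rewrite sqr_sqrtr// subr_ge0 ltW. Qed.

(** The Lorentz boost of velocity [v] along the third axis in the Klein model. *)
Definition boost p : pt3 R :=
  (e * p.1.1 / (1 + v * p.2), e * p.1.2 / (1 + v * p.2), (p.2 + v) / (1 + v * p.2)).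

Lemma boost_denom_gt0 (z : R) : z ^+ 2 <= 1 -> 0 < 1 + v * z.
Proof. by move=> z1; have := v1; nra. Qed.

Lemma H3_coord3 p : H3 p -> p.2 ^+ 2 < 1.
Proof. by rewrite /H3 /= /dot; have := sqr_ge0 p.1.1; have := sqr_ge0 p.1.2; nra. Qed.

Let den p : H3 p -> 0 < 1 + v * p.2.
Proof. by move=> /H3_coord3/ltW/boost_denom_gt0. Qed.

Lemma boost_dot p q : 0 < 1 + v * p.2 -> 0 < 1 + v * q.2 ->
  1 - dot (boost p) (boost q) = (1 - v ^+ 2) * (1 - dot p q) / ((1 + v * p.2) * (1 + v * q.2)).
Proof.
move=> p0 q0.
transitivity (((1 + v * p.2) * (1 + v * q.2) - e ^+ 2 * (p.1.1 * q.1.1 + p.1.2 * q.1.2)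
   - (p.2 + v) * (q.2 + v)) / ((1 + v * p.2) * (1 + v * q.2))).
  by rewrite /dot /boost /=; field; rewrite !gt_eqF.
by rewrite e2 /dot; congr (_ / _); ring.
Qed.

Lemma boost_H3 p : H3 p -> H3 (boost p).
Proof.
move=> Hp; have d0 := den Hp; rewrite /H3 /= -subr_gt0 boost_dot// divr_gt0 ?mulr_gt0// ?subr_gt0//.
Qed.

Lemma boost_H3_inv p : 0 < 1 + v * p.2 -> H3 (boost p) -> H3 p.
Proof.
move=> d0; rewrite /H3 /= -subr_gt0 boost_dot// -mulrA pmulr_rgt0 ?subr_gt0//.
by rewrite pmulr_lgt0 ?subr_gt0// invr_gt0 mulr_gt0.
Qed.

Lemma boost_dist p q : H3 p -> H3 q -> cosh_dist (boost p) (boost q) = cosh_dist p q.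
Proof.
move=> Hp Hq; have dp := den Hp; have dq := den Hq.
rewrite /cosh_dist !boost_dot//.
pose k := (1 - v ^+ 2) / ((1 + v * p.2) * (1 + v * q.2)).
have k0 : 0 < k by rewrite divr_gt0 ?mulr_gt0// subr_gt0.
have -> : (1 - v ^+ 2) * (1 - dot p p) / ((1 + v * p.2) * (1 + v * p.2)) *
    ((1 - v ^+ 2) * (1 - dot q q) / ((1 + v * q.2) * (1 + v * q.2))) =
    k ^+ 2 * ((1 - dot p p) * (1 - dot q q)).
  by rewrite /k; field; rewrite !gt_eqF.
have s0 : 0 < Num.sqrt ((1 - dot p p) * (1 - dot q q)).
  by rewrite sqrtr_gt0 mulr_gt0// subr_gt0.
rewrite sqrtrM ?sqr_ge0// sqrtr_sqr (gtr0_norm k0) /k; field.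
by rewrite !gt_eqF// subr_gt0.
Qed.

(** A projective map sends a convex combination to the one with weights multiplied
    by the denominators and renormalized. *)
Lemma boost_hull m (V : 'I_m -> pt3 R) p : (forall i, H3 (V i)) -> H3 p ->
  hull V p -> hull (boost \o V) (boost p).
Proof.
move=> HV Hp [w [w0 w1 pE]].
have d0 := den Hp; have dV i := den (HV i).
have nV i : 1 + v * (V i).2 != 0 by rewrite gt_eqF.
have n0 : 1 + v * p.2 != 0 by rewrite gt_eqF.
have dE : \sum_i w i * (1 + v * (V i).2) = 1 + v * p.2.
  rewrite pE /= mulr_sumr -[in RHS]w1 -big_split; apply: eq_bigr => i _ /=; ring.
exists (fun i => w i * (1 + v * (V i).2) / (1 + v * p.2)); split.
- by move=> i; rewrite divr_ge0 ?mulr_ge0 ?(ltW (dV i)) ?(ltW d0).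
- by rewrite -mulr_suml dE divff.
- have E1 : p.1.1 = \sum_i w i * (V i).1.1 by rewrite {1}pE.
  have E2 : p.1.2 = \sum_i w i * (V i).1.2 by rewrite {1}pE.
  have E3 : p.2 = \sum_i w i * (V i).2 by rewrite {1}pE.
  rewrite {1}/boost; congr (_, _, _); rewrite -/(boost _) /=.
  + rewrite {1}E1 mulr_sumr mulr_suml; apply: eq_bigr => i _; field.
    by rewrite n0 nV.
  + rewrite {1}E2 mulr_sumr mulr_suml; apply: eq_bigr => i _; field.
    by rewrite n0 nV.
  + have -> : p.2 + v = \sum_i w i * ((V i).2 + v).
      by rewrite {1}E3 -[v in LHS]mul1r -w1 mulr_suml -big_split; apply: eq_bigr => i _ /=; ring.
    rewrite mulr_suml; apply: eq_bigr => i _; field.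
    by rewrite n0 nV.
Qed.

(** The equation of a plane pulls back to a linear equation after clearing the
    denominator. Without vertices any plane will do; with one, the pulled-back
    normal vector cannot vanish. *)
Lemma boost_coplanar m (V : 'I_m -> pt3 R) : (forall i, H3 (V i)) ->
  coplanar (boost \o V) -> coplanar V.
Proof.
move=> HV [u [b [u0 ub]]].
have e00 := e0; have v1' := v1.
have E i : dot (u.1.1 * e, u.1.2 * e, u.2 - b * v) (V i) = b - u.2 * v.
  have di := den (HV i); have := ub i; rewrite /dot /boost /= => H.
  have : (1 + v * (V i).2) * b = u.1.1 * (e * (V i).1.1) + u.1.2 * (e * (V i).1.2) + u.2 * ((V i).2 + v).
    by rewrite -H; field; rewrite gt_eqF.
  by move=> H2; lra.
case: m V HV ub E => [|m] V HV ub E.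
  by exists (1, 0, 0), 0; split => [[/eqP]|[]//]; rewrite oner_eq0.
exists (u.1.1 * e, u.1.2 * e, u.2 - b * v), (b - u.2 * v); split => // -[/eqP + /eqP + u3].
have n0 : e == 0 = false by rewrite gt_eqF.
rewrite !mulf_eq0 !n0 !orbF => /eqP u1 /eqP u2.
have := E ord0; rewrite /dot /= u1 u2 u3 !mul0r !addr0 => E0.
have ub' : u.2 = b * v by lra.
have /eqP : b * (1 - v ^+ 2) = 0 by rewrite [RHS]E0 ub'; ring.
have n1 : (1 - v ^+ 2 == 0) = false by rewrite gt_eqF// subr_gt0.
rewrite mulf_eq0 n1 orbF => /eqP b0.
by apply: u0; case: u u1 u2 ub' {ub E u3 E0} => -[x y] z /= -> -> ->; rewrite b0 mul0r.
Qed.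

Lemma measurable_boost : measurable_fun setT (boost : R3 -> R3).
Proof.
have c1 := @measurable_coord1 R; have c2 := @measurable_coord2 R; have c3 := @measurable_coord3 R.
by apply: measurable_triple; meas.
Qed.

Let phi z := (z + v) / (1 + v * z).
Let dphi z := (1 - v ^+ 2) / (1 + v * z) ^+ 2.

Let phi_der (z : R) : z \in `[-1, 1] -> is_derive z 1 phi (dphi z).
Proof.
move=> z1; have z2 : z ^+ 2 <= 1 by move: z1; rewrite in_itv/= => /andP[]; nra.
have d0 := boost_denom_gt0 z2; have n0 : 1 + v * z != 0 by rewrite gt_eqF.
eapply is_derive_eq; first by rewrite /phi; der.
by rewrite /dphi /=; field.
Qed.

Let dphi_cts z : z \in `[-1, 1] -> {for z, continuous dphi}.
Proof.
move=> z1; have z2 : z ^+ 2 <= 1 by move: z1; rewrite in_itv/= => /andP[]; nra.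
have d0 := boost_denom_gt0 z2; have n0 : 1 + v * z != 0 by rewrite gt_eqF.
have n1 : (1 + v * z) ^+ 2 != 0 by rewrite expf_neq0.
by rewrite /dphi; cts.
Qed.

Let dphi_gt0 z : z \in `]-1, 1[ -> 0 < dphi z.
Proof.
rewrite in_itv/= => /andP[z1 z2]; have z3 : z ^+ 2 <= 1 by nra.
by rewrite divr_gt0 ?subr_gt0// exprn_gt0// boost_denom_gt0.
Qed.

Let integral_supported (g : R -> \bar R) : (forall z : R, (1 <= z ^+ 2)%R -> g z = 0%E) ->
  (\int[lam]_z g z = \int[lam]_(z in `](-1)%R, 1%R[) g z)%E.
Proof.
move=> g0; rewrite [RHS]integral_mkcond; apply: eq_integral => z _; rewrite patchE.
case: ifPn => // /negP zn; apply: g0; rewrite leNgt; apply/negP => z1; apply: zn.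
by rewrite inE /= in_itv/=; apply/andP; split; nra.
Qed.

(** On the plane at height [z] a boost is a homothety of ratio [al]. *)
Let scale3 (F : R3 -> \bar R) (al be z : R) : measurable_fun setT F -> (forall p, 0 <= F p)%E ->
  0 < al -> 0 <= be ->
  (\int[lam]_y \int[lam]_x (F ((al * x)%R, (al * y)%R, z) * (al * (al * be))%:E)
   = (\int[lam]_y \int[lam]_x F (x, y, z)) * be%:E)%E.
Proof.
move=> mF F0 al0 be0.
have al1 : al != 0 by rewrite gt_eqF.
have msec (g : R1 -> R3) : measurable_fun setT g -> measurable_fun setT (F \o g).
  by move=> mg; exact: measurableT_comp.
have mx y : measurable_fun setT (fun x : R1 => F (x, y, z)).
  by apply: (msec (fun x => (x, y, z))); do 2 apply: measurable_fun_pair => //.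
have mxy : measurable_fun setT (fun p : R1 * R1 => F (p.1, p.2, z)).
  by apply: (measurableT_comp mF); do 2 apply: measurable_fun_pair => //.
have mI : measurable_fun setT (fun y : R1 => \int[lam]_x F (x, y, z))%E.
  refine (@measurable_fun_fubini_tonelli_G _ _ _ _ _ lam (fun w : R1 * R1 => F (w.1, w.2, z)) mxy (fun w => F0 _)).
have I0 y : (0 <= \int[lam]_x F (x, y, z))%E by apply: integral_ge0.
have st (g : R1 -> \bar R) k : measurable_fun setT g -> (forall x, 0 <= g x)%E -> 0 <= k ->
    (\int[lam]_x (g (al * x)%R * (al * k)%:E) = (\int[lam]_x g x) * k%:E)%E.
  move=> mg g0 k0; rewrite -[X in (X * _)%E](@ge0_integral_affine R al 0)// -ge0_integralZr//.
  - by apply: eq_integral => x _; rewrite addr0 (gtr0_norm al0) -muleA -EFinM.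
  - apply: emeasurable_funM => //; apply: (measurableT_comp mg).
    by apply: measurable_funD => //; exact: measurable_funM.
  - by move=> x _; rewrite mule_ge0.
transitivity (\int[lam]_y ((\int[lam]_x F (x, al * y, z)%R) * (al * be)%:E))%E.
  by apply: eq_integral => y _; apply: st => //; rewrite mulr_ge0// ltW.
exact: (st (fun y => \int[lam]_x F (x, y, z))%E).
Qed.

(** Slicing by [z]: homothety in each slice, and the Moebius substitution [phi] in
    [z]; the Jacobian al^2 [dphi] compensates the density. *)
Lemma boost_volume (A : set (pt3 R)) : measurable (A : set R3) -> A `<=` @H3 R ->
  measurable (@H3 R `&` boost @^-1` A : set R3) /\ hvolume (@H3 R `&` boost @^-1` A) = hvolume A.
Proof.
move=> mA AH.
have mB : measurable (@H3 R `&` boost @^-1` A : set R3).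
  apply: measurableI; first exact: measurable_H3.
  by rewrite -[X in measurable X]setTI; exact: measurable_boost.
split=> //; rewrite !hvolumeE//.
pose F := ((EFin \o (@density R)) \_ A : R3 -> \bar R).
have mF : measurable_fun setT F := measurable_density_restrict mA.
have F0 : forall p, (0 <= F p)%E := density_restrict_ge0 A.
rewrite (integral3_zyx (measurable_density_restrict mB) (density_restrict_ge0 _)).
rewrite [RHS](integral3_zyx mF F0).
pose G z := (\int[lam]_y \int[lam]_x F (x, y, z))%E.
have mG : measurable_fun setT G.
  have -> : G = (fun z => \int[(lam \x lam)%E]_q F (q, z))%E.
    apply/funext => z; apply/esym.
    have mz : measurable_fun setT (fun q : R1 * R1 => F (q, z)).
      by apply: (measurableT_comp mF); exact: measurable_fun_pair.
    refine (@fubini_tonelli2 _ _ _ _ _ lam lam _ mz (fun w => F0 (w, z))).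
  exact: (@measurable_fun_fubini_tonelli_G _ _ _ _ _ (@lebesgue2 R) F mF F0).
have G0 z : (0 <= G z)%E by apply: integral_ge0 => y _; apply: integral_ge0.
have outA (B : set (pt3 R)) (x y z : R) : B `<=` @H3 R -> 1 <= z ^+ 2 ->
    ((EFin \o (@density R)) \_ B) (x, y, z) = 0%E.
  move=> BH z1; rewrite patchE; case: ifPn => // /[!inE] /BH /H3_coord3 /=.
  by rewrite ltNge z1.
rewrite integral_supported; last first.
  move=> z z1; rewrite integral0_eq// => y _; rewrite integral0_eq// => x _.
  by apply: outA => // p [].
rewrite [RHS]integral_supported; last first.
  move=> z z1; rewrite integral0_eq// => y _; rewrite integral0_eq// => x _.
  exact: outA.
have n11 : -1 < 1 :> R by lra.
have := ge0_integral_increasing n11 phi_der dphi_cts dphi_gt0 mG G0.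
have -> : phi (-1) = -1.
  rewrite /phi; have := @boost_denom_gt0 (-1); rewrite sqrrN expr1n => /(_ (lexx _)) d0.
  by apply: (mulIf (lt0r_neq0 d0)); rewrite divfK ?gt_eqF//; ring.
have -> : phi 1 = 1.
  rewrite /phi; have := @boost_denom_gt0 1; rewrite expr1n => /(_ (lexx _)) d0.
  by apply: (mulIf (lt0r_neq0 d0)); rewrite divfK ?gt_eqF//; ring.
move=> GE; rewrite [RHS]GE; apply: eq_integral => z /[!inE] /= z1.
have z2 : z ^+ 2 < 1 by move: z1; rewrite in_itv/= => /andP[]; nra.
have d0 := boost_denom_gt0 (ltW z2); have e00 := e0.
pose al := e / (1 + v * z).
have al0 : 0 < al by rewrite divr_gt0.
transitivity (\int[lam]_y \int[lam]_x (F ((al * x)%R, (al * y)%R, phi z) * (al * (al * dphi z))%:E))%E; last first.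
  by rewrite scale3// ltW// dphi_gt0.
apply: eq_integral => y _; apply: eq_integral => x _.
have bE : boost (x, y, z) = (al * x, al * y, phi z).
  by rewrite /boost /al /phi /=; congr (_, _, _); ring.
rewrite -bE /F !patchE.
have bd := @boost_dot (x, y, z) (x, y, z) d0 d0.
have -> : ((x, y, z) \in @H3 R `&` boost @^-1` A) = (boost (x, y, z) \in A).
  apply/idP/idP; rewrite !inE /=; first by case.
  by move=> Ab; split => //; apply: (boost_H3_inv (p := (x, y, z)) d0); exact: AH.
case: ifPn => [|_]; last by rewrite mul0e.
rewrite inE => /AH /(boost_H3_inv (p := (x, y, z)) d0); rewrite /H3 /= -subr_gt0 => H1.
rewrite -EFinM /density bd; congr (_%:E).
have -> : al * (al * dphi z) = e ^+ 2 * (1 - v ^+ 2) / (1 + v * z) ^+ 4.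
  by rewrite /al /dphi; field; rewrite gt_eqF.
rewrite e2 /=; field; rewrite !gt_eqF// subr_gt0//.
Qed.

End boost.

Lemma boostK v p : v ^+ 2 < 1 -> H3 p -> boost (- v) (boost v p) = p.
Proof.
move=> v1 Hp; have d0 := boost_denom_gt0 v1 (ltW (H3_coord3 Hp)).
case: p Hp d0 => -[x y] z Hp /= d0.
have e2 : Num.sqrt (1 - v ^+ 2) ^+ 2 = 1 - v ^+ 2 by rewrite sqr_sqrtr// subr_ge0 ltW.
have e0 : 0 < 1 - v ^+ 2 by rewrite subr_gt0.
rewrite /boost /= sqrrN; set e := Num.sqrt _ in e2 *.
have dE : 1 + - v * ((z + v) / (1 + v * z)) = (1 - v ^+ 2) / (1 + v * z).
  by field; rewrite gt_eqF.
rewrite dE; congr (_, _, _).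
- transitivity (e ^+ 2 * x / (1 - v ^+ 2)); first by field; rewrite !gt_eqF.
  by rewrite e2 mulrAC divff ?mul1r ?gt_eqF.
- transitivity (e ^+ 2 * y / (1 - v ^+ 2)); first by field; rewrite !gt_eqF.
  by rewrite e2 mulrAC divff ?mul1r ?gt_eqF.
- by field; rewrite !gt_eqF.
Qed.

Lemma motion_boost v : v ^+ 2 < 1 -> motion (boost v).
Proof.
move=> v1; split.
- by move=> p; exact: boost_H3.
- by move=> p q; exact: boost_dist.
- by move=> A; exact: boost_volume.
- move=> m V HV p Hp; split; first exact: boost_hull.
  have v1' : (- v) ^+ 2 < 1 by rewrite sqrrN.
  have HbV i : H3 ((boost v \o V) i) by exact: boost_H3.
  move=> /(boost_hull v1' HbV (boost_H3 v1 Hp)); rewrite boostK//.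
  by congr (hull _ p); apply/funext => i /=; rewrite boostK.
- by move=> m V; exact: boost_coplanar.
Qed.

End motions.

(** * Every isometry is undone by a motion *)
Section isometries.
Context (R : realType).
Implicit Types (p q : pt3 R) (f : pt3 R -> pt3 R).

Lemma arcosh_inj (x y : R) : 1 <= x -> 1 <= y -> arcosh x = arcosh y -> x = y.
Proof. by move=> x1 y1 e; rewrite -(arcoshK x1) -(arcoshK y1) e. Qed.

Lemma dot_lt1 p q : H3 p -> H3 q -> dot p q < 1.
Proof.
rewrite /H3 /= => Hp Hq.
have : 0 <= (p.1.1 - q.1.1) ^+ 2 + (p.1.2 - q.1.2) ^+ 2 + (p.2 - q.2) ^+ 2.
  by rewrite !addr_ge0 ?sqr_ge0.
by move: Hp Hq; rewrite /dot; lra.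
Qed.

(** Together with the injectivity of arcosh beyond 1, this makes preserving
    distance the same as preserving [cosh_dist]. It is the reversed
    Cauchy-Schwarz inequality, written as a sum of squares. *)
Lemma cosh_dist_ge1 p q : H3 p -> H3 q -> 1 <= cosh_dist p q.
Proof.
move=> Hp Hq; have pq := dot_lt1 Hp Hq; move: (Hp) (Hq); rewrite /H3 /= => Hp' Hq'.
have P0 : 0 < (1 - dot p p) * (1 - dot q q) by rewrite mulr_gt0 ?subr_gt0.
rewrite /cosh_dist ler_pdivlMr ?sqrtr_gt0// mul1r.
rewrite -ler_sqr ?nnegrE ?sqrtr_ge0 ?subr_ge0 ?(ltW pq)// sqr_sqrtr ?(ltW P0)//.
pose d : pt3 R := (q.1.1 - p.1.1, q.1.2 - p.1.2, q.2 - p.2).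
rewrite -subr_ge0.
have -> : (1 - dot p q) ^+ 2 - (1 - dot p p) * (1 - dot q q)
  = (1 - dot p p) * (d.1.1 ^+ 2 + d.1.2 ^+ 2 + d.2 ^+ 2) + dot p d ^+ 2.
  by rewrite /d /dot /=; ring.
by rewrite addr_ge0 ?sqr_ge0// mulr_ge0 ?subr_ge0 ?(ltW Hp')// !addr_ge0 ?sqr_ge0.
Qed.

Lemma hisometry_H3 f p : hisometry f -> H3 p -> H3 (f p).
Proof. by move=> [[fH _ _] _] Hp; exact: fH. Qed.

Lemma hisometry_cosh_dist f p q : hisometry f -> H3 p -> H3 q ->
  cosh_dist (f p) (f q) = cosh_dist p q.
Proof.
move=> fi Hp Hq; have := fi.2 _ _ Hp Hq.
by apply: arcosh_inj; apply: cosh_dist_ge1 => //; exact: hisometry_H3.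
Qed.

Lemma polar_rotation (x y : R) : exists c s, [/\ c ^+ 2 + s ^+ 2 = 1,
  c * x - s * y = Num.sqrt (x ^+ 2 + y ^+ 2) & s * x + c * y = 0].
Proof.
have xy0 : 0 <= x ^+ 2 + y ^+ 2 by rewrite addr_ge0 ?sqr_ge0.
have [xy|xy] := eqVneq (x ^+ 2 + y ^+ 2) 0.
  exists 1, 0; rewrite expr1n expr0n addr0 xy sqrtr0; split => //.
    by move/eqP: xy; rewrite paddr_eq0 ?sqr_ge0// !sqrf_eq0 => /andP[/eqP-> /eqP->]; ring.
  by move/eqP: xy; rewrite paddr_eq0 ?sqr_ge0// !sqrf_eq0 => /andP[/eqP-> /eqP->]; ring.
set r := Num.sqrt _.
have r0 : 0 < r by rewrite sqrtr_gt0 lt0r xy.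
have r2 : r ^+ 2 = x ^+ 2 + y ^+ 2 by rewrite sqr_sqrtr.
exists (x / r), (- y / r); split.
- transitivity ((x ^+ 2 + y ^+ 2) / r ^+ 2); first by field; rewrite gt_eqF.
  by rewrite -r2 divff// expf_neq0// gt_eqF.
- transitivity ((x ^+ 2 + y ^+ 2) / r); first by field; rewrite gt_eqF.
  by rewrite -r2 expr2 -mulrA divff ?mulr1// gt_eqF.
- by field; rewrite gt_eqF.
Qed.

Lemma rotate_to_axis p : exists psi, [/\ motion psi, forall a b, dot (psi a) (psi b) = dot a b &
  psi p = (0, 0, Num.sqrt (dot p p))].
Proof.
have [c [s [cs e1 e2]]] := polar_rotation p.1.1 p.1.2.
set r1 := Num.sqrt _ in e1.
have r12 : r1 ^+ 2 = p.1.1 ^+ 2 + p.1.2 ^+ 2 by rewrite sqr_sqrtr// addr_ge0 ?sqr_ge0.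
have [c' [s' [cs' e1' e2']]] := polar_rotation p.2 r1.
have cs'' : c' ^+ 2 + (- s') ^+ 2 = 1 by rewrite sqrrN.
exists (rot13 c' (- s') \o rot12 c s); split.
- exact: (motion_comp (motion_rot12 cs) (motion_rot13 cs'')).
- by move=> a b /=; rewrite dot_rot13// dot_rot12.
- rewrite /rot13 /rot12 /= e1 e2; congr (_, _, _).
    by rewrite -[RHS]e2'; ring.
  transitivity (c' * p.2 - s' * r1); first ring.
  by rewrite e1' r12 /dot -!expr2; congr (Num.sqrt _); ring.
Qed.

Lemma move_to_origin p : H3 p -> exists2 psi, motion psi & psi p = (0, 0, 0).
Proof.
move=> Hp; have [psi [mpsi dpsi ep]] := rotate_to_axis p.
have p0 : 0 <= dot p p by rewrite /dot -!expr2 !addr_ge0 ?sqr_ge0.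
have v1 : (- Num.sqrt (dot p p)) ^+ 2 < 1 by rewrite sqrrN sqr_sqrtr.
exists (boost (- Num.sqrt (dot p p)) \o psi); first exact: (motion_comp mpsi (motion_boost v1)).
by rewrite /= ep /boost /= !mulr0 !mul0r subrr mul0r.
Qed.

Let O : pt3 R := (0, 0, 0).

(** Distances to the origin determine norms, and then distances determine inner
    products. *)
Lemma isometry_fixing_origin f : (forall p, H3 p -> H3 (f p)) ->
  (forall p q, H3 p -> H3 q -> cosh_dist (f p) (f q) = cosh_dist p q) -> f O = O ->
  forall p q, H3 p -> H3 q -> dot (f p) (f q) = dot p q.
Proof.
move=> fH fd f0.
have HO : H3 O by rewrite /H3 /dot /= !mul0r !addr0 ltr01.
have dO q : dot O q = 0 by rewrite /dot /= !mul0r !addr0.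
have n p : H3 p -> dot (f p) (f p) = dot p p.
  move=> Hp; have := fd _ _ HO Hp; rewrite f0 /cosh_dist !dO subr0 !mul1r => /invr_inj.
  have h1 : 0 <= 1 - dot (f p) (f p) by rewrite subr_ge0 ltW//; exact: fH.
  have h2 : 0 <= 1 - dot p p by rewrite subr_ge0 ltW.
  by move=> /(congr1 (fun x => x ^+ 2)); rewrite !sqr_sqrtr//; lra.
move=> p q Hp Hq; have := fd _ _ Hp Hq; rewrite /cosh_dist !n//.
have s0 : Num.sqrt ((1 - dot p p) * (1 - dot q q)) != 0.
  by rewrite gt_eqF// sqrtr_gt0 mulr_gt0// subr_gt0.
by move=> /(mulIf (invr_neq0 s0)); lra.
Qed.

(** A map preserving inner products is determined by the images of a basis; the
    images of the half unit vectors, which lie in the ball, are rotated back one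
    after the other, a last reflection correcting the orientation. *)
Lemma straighten_basis f : (forall p q, H3 p -> H3 q -> dot (f p) (f q) = dot p q) ->
  exists2 psi, motion psi & forall p, H3 p -> psi (f p) = p.
Proof.
move=> fd; pose e1 : pt3 R := (2^-1, 0, 0); pose e2 : pt3 R := (0, 2^-1, 0).
pose e3 : pt3 R := (0, 0, 2^-1).
have e1E q : dot q e1 = q.1.1 / 2 by rewrite /dot /e1 /=; ring.
have e2E q : dot q e2 = q.1.2 / 2 by rewrite /dot /e2 /=; ring.
have e3E q : dot q e3 = q.2 / 2 by rewrite /dot /e3 /=; ring.
have He1 : H3 e1 by rewrite /H3 /= e1E /=; lra.
have He2 : H3 e2 by rewrite /H3 /= e2E /=; lra.
have He3 : H3 e3 by rewrite /H3 /= e3E /=; lra.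
have half4 : Num.sqrt (2^-1 ^+ 2) = 2^-1 :> R by rewrite sqrtr_sqr ger0_norm// invr_ge0 ler0n.
have [psi1 [m1 d1 E1]] := rotate_to_axis (f e3).
have fe3 : psi1 (f e3) = e3.
  by rewrite E1 fd// e3E /= -expr2 half4.
have d1f p q : H3 p -> H3 q -> dot (psi1 (f p)) (psi1 (f q)) = dot p q.
  by move=> Hp Hq; rewrite d1 fd.
pose w := psi1 (f e1).
have w3 : w.2 = 0.
  by have := d1f _ _ He1 He3; rewrite fe3 -/w !e3E /= mul0r; lra.
have ww : w.1.1 ^+ 2 + w.1.2 ^+ 2 = 2^-1 ^+ 2.
  by have := d1f _ _ He1 He1; rewrite -/w e1E /dot w3 /=; lra.
have [c [s [cs c1 c2]]] := polar_rotation w.1.1 w.1.2.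
have m2 := motion_comp m1 (motion_rot12 cs).
pose f2 p := rot12 c s (psi1 (f p)).
have d2f p q : H3 p -> H3 q -> dot (f2 p) (f2 q) = dot p q.
  by move=> Hp Hq; rewrite /f2 dot_rot12// d1f.
have f2e3 : f2 e3 = e3 by rewrite /f2 fe3 /rot12 /e3 /= !mulr0 subrr addr0.
have f2e1 : f2 e1 = e1 by rewrite /f2 -/w /rot12 c1 c2 w3 ww half4.
have f21 p : H3 p -> (f2 p).1.1 = p.1.1.
  by move=> Hp; have := d2f _ _ Hp He1; rewrite f2e1 !e1E; lra.
have f23 p : H3 p -> (f2 p).2 = p.2.
  by move=> Hp; have := d2f _ _ Hp He3; rewrite f2e3 !e3E; lra.
pose y := (f2 e2).1.2.
have y2 : y ^+ 2 = 2^-1 ^+ 2.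
  by have := d2f _ _ He2 He2; rewrite e2E /dot f21// f23// -/y /=; lra.
have yp p : H3 p -> (f2 p).1.2 * y = p.1.2 / 2.
  by move=> Hp; have := d2f _ _ Hp He2; rewrite e2E /dot (f21 e2)// (f23 e2)// -/y /=; lra.
have /orP[/eqP yE|/eqP yE] : (y == 2^-1) || (y == - 2^-1) by rewrite -eqf_sqr y2.
- exists (rot12 c s \o psi1) => // p Hp; rewrite -[LHS]/(f2 p).
  have := f21 _ Hp; have := f23 _ Hp; have := yp _ Hp; rewrite yE.
  case: (f2 p) => -[a b] d; case: (p) => -[a' b'] d' /= hb -> ->; congr (_, _, _); lra.
- exists (@flip2 R \o (rot12 c s \o psi1)); first exact: (motion_comp m2 (motion_flip2 R)).
  move=> p Hp; rewrite -[LHS]/(flip2 (f2 p)).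
  have := f21 _ Hp; have := f23 _ Hp; have := yp _ Hp; rewrite yE /flip2.
  case: (f2 p) => -[a b] d; case: (p) => -[a' b'] d' /= hb -> ->; congr (_, _, _); lra.
Qed.

Lemma hisometry_motion f : hisometry f ->
  exists2 psi, motion psi & forall p, H3 p -> psi (f p) = p.
Proof.
move=> fi; have HO : H3 O by rewrite /H3 /dot /= !mul0r !addr0 ltr01.
have [psi1 m1 E1] := move_to_origin (hisometry_H3 fi HO).
have [psi2 m2 E2] : exists2 psi, motion psi & forall p, H3 p -> psi ((psi1 \o f) p) = p.
  apply: straighten_basis; apply: isometry_fixing_origin => //=.
  - by move=> p Hp; apply: (motion_H3 m1); exact: hisometry_H3.
  - move=> p q Hp Hq; rewrite (motion_dist m1) ?hisometry_cosh_dist//; exact: hisometry_H3.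
by exists (psi2 \o psi1) => //; exact: (motion_comp m1 m2).
Qed.

End isometries.

(** * The standard position of an antiprism *)
Section normal_form.
Context (R : realType) (n : nat).
Hypothesis n3 : (3 <= n)%N.
Implicit Types r h : R.

Definition angle (i : nat) : R := i%:R * (pi / n%:R).

Definition antiprism_vertex r h (i : nat) : pt3 R :=
  (r * cos (angle i), r * sin (angle i), - ((-1) ^+ i * h)).

Let th : R := pi / n%:R.
Let S := std_mirror_rotation th.

Lemma antiprism_vertexS r h i :
  antiprism_vertex r h i.+1 = S (antiprism_vertex r h i).
Proof.
have E : angle i.+1 = th + angle i by rewrite /angle -/th; ring.
rewrite /antiprism_vertex /S /std_mirror_rotation /= E cosD sinD exprS; congr (_, _, _); ring.
Qed.

Lemma dot_antiprism_vertex r h (i : nat) :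
  dot (antiprism_vertex r h i) (antiprism_vertex r h i) = r ^+ 2 + h ^+ 2.
Proof.
transitivity (r ^+ 2 * (cos (angle i) ^+ 2 + sin (angle i) ^+ 2) + ((-1) ^+ i) ^+ 2 * h ^+ 2).
  by rewrite /dot /antiprism_vertex /=; ring.
by rewrite cos2Dsin2 -exprM mulnC exprM sqrrN expr1n expr1n mulr1 mul1r.
Qed.

Let S_H3 p : H3 p -> H3 (S p).
Proof.
rewrite /H3 /=; have -> // : dot (S p) (S p) = dot p p.
transitivity ((cos th ^+ 2 + sin th ^+ 2) * (p.1.1 ^+ 2 + p.1.2 ^+ 2) + p.2 ^+ 2).
  by rewrite /dot /S /std_mirror_rotation /=; ring.
by rewrite cos2Dsin2 /dot; ring.
Qed.

Lemma orbit_std (W : 'I_(2 * n) -> pt3 R) r h :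
  (forall i, W (ordS i) = S (W i)) ->
  (forall i, val i = 0%N -> W i = antiprism_vertex r h 0) ->
  forall i, W i = antiprism_vertex r h i.
Proof.
move=> WS W0 [i]; elim: i => [|i IH] Hi; first exact: W0.
have Hi' := ltnW Hi; rewrite antiprism_vertexS -(IH Hi') -WS; congr W.
by apply: val_inj; rewrite /= modn_small.
Qed.

(** Conjugated to the standard mirror rotation, the symmetry carries the first
    vertex through the whole orbit, and a rotation about the axis puts that vertex
    over the first coordinate axis. If r = 0, vertices 0 and 4 coincide, although
    a lateral face contains 0 and not 4; if h = 0, the vertices are coplanar. *)
Theorem antiprism_normal_form (V : 'I_(2 * n) -> pt3 R) : antiprism V ->
  exists r h psi, [/\ 0 < r, 0 < h, motion psi & forall i, psi (V i) = antiprism_vertex r h i].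
Proof.
move=> [VH Vnc [g [phi phiI gphi] gV] _ _ Vlat].
have [psi0 m0 E0] := hisometry_motion phiI.
have [p pH pV] : exists2 p : 'I_(2 * n) -> pt3 R, forall i, H3 (p i) & forall i, phi (p i) = V i.
  have /choice[p pP] : forall i, exists q, H3 q /\ phi q = V i.
    by move=> i; have [_ _ /(_ _ (VH i))] := phiI.1; move=> [q Hq <-]; exists q.
  by exists p => i; case: (pP i).
have psi0V i : psi0 (V i) = p i by rewrite -pV E0.
have pS i : p (ordS i) = S (p i).
  by rewrite -psi0V -gV -pV gphi// E0//; exact: S_H3.
have n20 : (0 < 2 * n)%N by lia.
pose i0 := Ordinal n20.
have [c [s [cs c1 c2]]] := polar_rotation (p i0).1.1 (p i0).1.2.
set r := Num.sqrt _ in c1.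
have rotS q : rot12 c s (S q) = S (rot12 c s q).
  by rewrite /rot12 /S /std_mirror_rotation /=; congr (_, _, _); ring.
pose W i := rot12 c s (p i).
have WS i : W (ordS i) = S (W i) by rewrite /W pS rotS.
have W0 i : val i = 0%N -> W i = (r, 0, (p i0).2).
  move=> iE; have -> : i = i0 by exact: val_inj.
  by rewrite /W /rot12 c1 c2.
have vE h : antiprism_vertex r h 0 = (r, 0, - h).
  by rewrite /antiprism_vertex /angle mul0r cos0 sin0 mulr1 mulr0 expr0 mul1r.
have WE : forall i, W i = antiprism_vertex r (- (p i0).2) i.
  by apply: orbit_std => // i /W0 ->; rewrite vE opprK.
have mW := motion_comp m0 (motion_rot12 cs).
have psiW i : (rot12 c s \o psi0) (V i) = W i by rewrite /= psi0V.
have r0 : 0 < r.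
  rewrite lt0r sqrtr_ge0 andbT; apply/eqP => rE.
  have xy0 : (p i0).1.1 ^+ 2 + (p i0).1.2 ^+ 2 = 0.
    apply/eqP; rewrite eq_le addr_ge0 ?sqr_ge0// andbT -sqrtr_eq0; exact/eqP.
  move/eqP: xy0; rewrite paddr_eq0 ?sqr_ge0// !sqrf_eq0 => /andP[/eqP x0 /eqP y0].
  have S2 : S (S (p i0)) = p i0.
    case: (p i0) x0 y0 => -[a b] d /= -> ->.
    by rewrite /S /std_mirror_rotation /=; congr (_, _, _); ring.
  have p4 : p (ordS (ordS (ordS (ordS i0)))) = p i0 by rewrite !pS !S2.
  have [u [b ub]] := Vlat i0.
  have ifPT (x : bool) (P Q : Prop) : x -> (if x then P else Q) -> P by case: x.
  have ifPF (x : bool) (P Q : Prop) : ~~ x -> (if x then P else Q) -> Q by case: x.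
  have i0in : i0 \in [:: i0; ordS i0; ordS (ordS i0)] by rewrite inE eqxx.
  have u0 := ifPT _ (dot u (V i0) = b) (dot u (V i0) < b) i0in (ub i0).
  have : ordS (ordS (ordS (ordS i0))) \notin [:: i0; ordS i0; ordS (ordS i0)].
    have vS (k : nat) (i : 'I_(2 * n)) : val i = k -> (k < 5)%N -> val (ordS i) = k.+1.
      by move=> iE k5; rewrite /= -[nat_of_ord i]/(val i) iE modn_small//; lia.
    have v0 : val i0 = 0%N by [].
    have v1 := vS _ _ v0 isT; have v2 := vS _ _ v1 isT; have v3 := vS _ _ v2 isT.
    by have v4 := vS _ _ v3 isT; rewrite !inE -!val_eqE v4 v2 v1.
  move=> i4 ; have := ifPF _ (dot u (V _) = b) (dot u (V _) < b) i4 (ub _).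
  have -> : V (ordS (ordS (ordS (ordS i0)))) = V i0 by rewrite -pV p4 pV.
  by rewrite u0 ltxx.
have h0 : (p i0).2 != 0.
  apply/eqP => z0; apply: Vnc; have VHp := VH.
  apply: (motion_coplanar mW VH); exists (0, 0, 1), 0; split.
    by move=> [] /eqP; rewrite oner_eq0.
  by move=> i; rewrite /= psi0V -/(W i) WE z0 /dot /antiprism_vertex /=; ring.
have [hN|hP] := ltP 0 (- (p i0).2).
  by exists r, (- (p i0).2), (rot12 c s \o psi0); split => // i; rewrite psiW WE.
exists r, (p i0).2, (@flip3 R \o (rot12 c s \o psi0)); split => //.
- by rewrite lt0r h0 -oppr_le0.
- exact: (motion_comp mW (motion_flip3 R)).
- move=> i; rewrite -[LHS]/(flip3 (rot12 c s (psi0 (V i)))) psi0V -/(W i) WE.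
  by rewrite /flip3 /antiprism_vertex /=; congr (_, _, _); ring.
Qed.

End normal_form.

(** * Faces, axis and symmetries of the standard antiprism *)
Section hulls.
Context (R : realType).
Implicit Types (p q : pt3 R) (f : pt3 R -> pt3 R).

Lemma hull_vertex m (V : 'I_m -> pt3 R) i : hull V (V i).
Proof.
have E (g : 'I_m -> R) : \sum_j (j == i)%:R * g j = g i.
  rewrite (bigD1 i)//= eqxx mul1r big1 ?addr0// => j /negPf ->; exact: mul0r.
exists (fun j => (j == i)%:R); split => //.
- by rewrite -[RHS](E (fun=> 1)); apply: eq_bigr => j _; rewrite mulr1.
- by rewrite !E; case: (V i) => -[].
Qed.

Lemma hull_convex m (V : 'I_m -> pt3 R) p q (t : R) : 0 <= t <= 1 -> hull V p -> hull V q ->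
  hull V ((1 - t) * p.1.1 + t * q.1.1, (1 - t) * p.1.2 + t * q.1.2, (1 - t) * p.2 + t * q.2).
Proof.
move=> /andP[t0 t1] [w [w0 w1 ->]] [w' [w'0 w'1 ->]].
exists (fun i => (1 - t) * w i + t * w' i); split.
- by move=> i; rewrite addr_ge0// mulr_ge0// subr_ge0.
- by rewrite big_split /= -!mulr_sumr w1 w'1 !mulr1 subrK.
- by congr (_, _, _); rewrite /= !mulr_sumr -big_split; apply: eq_bigr => i _ /=; ring.
Qed.

Lemma hull_halfspace m (V : 'I_m -> pt3 R) (a1 a2 a3 b : R) :
  (forall i, a1 * (V i).1.1 + a2 * (V i).1.2 + a3 * (V i).2 <= b) ->
  forall p, hull V p -> a1 * p.1.1 + a2 * p.1.2 + a3 * p.2 <= b.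
Proof.
move=> Vb p [w [w0 w1 ->]] /=.
rewrite -[b]mul1r -w1 mulr_suml !mulr_sumr -!big_split; apply: ler_sum => i _ /=.
have -> : a1 * (w i * (V i).1.1) + a2 * (w i * (V i).1.2) + a3 * (w i * (V i).2)
  = w i * (a1 * (V i).1.1 + a2 * (V i).1.2 + a3 * (V i).2) by ring.
exact: ler_wpM2l.
Qed.

Lemma hull_H3 m (V : 'I_m -> pt3 R) : (forall i, H3 (V i)) -> hull V `<=` @H3 R.
Proof.
move=> VH p Vp; rewrite /H3 /=.
have [w [w0 w1 pE]] := Vp.
have dE q : dot p q = p.1.1 * q.1.1 + p.1.2 * q.1.2 + p.2 * q.2 by [].
have dp : \sum_i w i * dot p (V i) = dot p p.
  have e1 : \sum_i w i * (V i).1.1 = p.1.1 by rewrite pE.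
  have e2 : \sum_i w i * (V i).1.2 = p.1.2 by rewrite pE.
  have e3 : \sum_i w i * (V i).2 = p.2 by rewrite pE.
  rewrite [RHS]dE -{2}e1 -{2}e2 -{2}e3 !mulr_sumr -!big_split; apply: eq_bigr => i _ /=.
  by rewrite dE; ring.
have half i : dot p (V i) <= (dot p p + dot (V i) (V i)) / 2.
  have : 0 <= (p.1.1 - (V i).1.1) ^+ 2 + (p.1.2 - (V i).1.2) ^+ 2 + (p.2 - (V i).2) ^+ 2.
    by rewrite !addr_ge0 ?sqr_ge0.
  by rewrite /dot; lra.
have le1 : dot p p <= (dot p p + \sum_i w i * dot (V i) (V i)) / 2.
  rewrite -{1}dp.
  have -> : (dot p p + \sum_i w i * dot (V i) (V i)) / 2 = \sum_i w i * ((dot p p + dot (V i) (V i)) / 2).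
    rewrite -{1}[dot p p]mul1r -w1 mulr_suml -big_split mulr_suml; apply: eq_bigr => i _ /=; ring.
  by apply: ler_sum => i _; apply: ler_wpM2l.
suff : \sum_i w i * dot (V i) (V i) < 1 by lra.
have : exists i, 0 < w i.
  apply/not_existsP => w_le; have : \sum_i w i <= 0.
    by apply: sumr_le0 => i _; rewrite leNgt; apply/negP/w_le.
  by rewrite w1 ler10.
move=> [i wi]; rewrite -w1 [X in X < _](bigD1 i)//= [X in _ < X](bigD1 i)//=.
apply: ltr_leD; first by rewrite gtr_pMr//; exact: VH.
by apply: ler_sum => j _; rewrite ler_piMr//; apply/ltW/VH.
Qed.

Lemma hull_image m (V V' : 'I_m -> pt3 R) f :
  (forall w, f (lincomb w V) = lincomb w (f \o V)) ->
  (forall i, hull V' (f (V i))) -> forall p, hull V p -> hull V' (f p).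
Proof.
move=> f_lin fV p [w [w0 w1 ->]]; rewrite -[X in f X]/(lincomb w V) f_lin.
have /choice[c cP] := fV.
(* Weights of a combination of combinations. *)
exists (fun j => \sum_i w i * c i j); split.
- by move=> j; apply: sumr_ge0 => i _; rewrite mulr_ge0//; case: (cP i).
- rewrite exchange_big -w1; apply: eq_bigr => i _ /=.
  by rewrite -mulr_sumr; case: (cP i) => _ -> _; rewrite mulr1.
- have E (g : 'I_m -> R) (k : pt3 R -> R) :
      (forall i, k (f (V i)) = \sum_j c i j * g j) ->
      \sum_i w i * k (f (V i)) = \sum_j (\sum_i w i * c i j) * g j.
    move=> kE; under [RHS]eq_bigr do rewrite mulr_suml.
    rewrite exchange_big; apply: eq_bigr => i _ /=; rewrite kE mulr_sumr.
    by apply: eq_bigr => j _; rewrite mulrA.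
  rewrite /lincomb; congr (_, _, _).
  + by apply: (E (fun j => (V' j).1.1) (fun p => p.1.1)) => i; case: (cP i) => _ _ ->.
  + by apply: (E (fun j => (V' j).1.2) (fun p => p.1.2)) => i; case: (cP i) => _ _ ->.
  + by apply: (E (fun j => (V' j).2) (fun p => p.2)) => i; case: (cP i) => _ _ ->.
Qed.

End hulls.

Section angles.
Context (R : realType) (n : nat).
Hypothesis n3 : (3 <= n)%N.
Let th : R := pi / n%:R.
Let q := cos th.
Let s := sin th.

Lemma angle_bounds : 0 < th < pi / 2.
Proof.
have p0 := pi_gt0 R; have n00 : 0 < n%:R :> R by rewrite ltr0n; lia.
rewrite divr_gt0//= ltr_pdivrMr// mulrAC ltr_pdivlMr// ltr_pM2l// ltr_nat; lia.
Qed.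

Lemma cos_angle_bounds : 0 < q < 1.
Proof.
have /andP[t0 t1] := angle_bounds; have p0 := pi_gt0 R.
apply/andP; split; first by apply: cos_gt0_pihalf; rewrite t1 andbT; lra.
have tI : th \in `[0, pi] by rewrite in_itv/=; apply/andP; split; lra.
have zI : 0 \in `[0, @pi R] by rewrite in_itv/= lexx ltW.
by rewrite -(cos0 R) /q ltr_cos.
Qed.

Lemma sin_angle_gt0 : 0 < s.
Proof.
have /andP[t0 t1] := angle_bounds; have p0 := pi_gt0 R.
by apply: sin_gt0_pi; rewrite t0; lra.
Qed.

Lemma cos_sin_angle : q ^+ 2 + s ^+ 2 = 1.
Proof. exact: cos2Dsin2. Qed.

End angles.

Section std_antiprism.
Context (R : realType) (n : nat) (r h : R).
Hypothesis n3 : (3 <= n)%N.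
Hypothesis r0 : 0 < r.
Hypothesis h0 : 0 < h.
Hypothesis rh : r ^+ 2 + h ^+ 2 < 1.

Let th : R := pi / n%:R.
Let q := cos th.
Let s := sin th.
Let P := antiprism_vertex n r h.

Let q01 : 0 < q < 1 := @cos_angle_bounds R n n3.
Let s0 : 0 < s := @sin_angle_gt0 R n n3.
Let qs : q ^+ 2 + s ^+ 2 = 1 := @cos_sin_angle R n.
Let thb : 0 < th < pi / 2 := @angle_bounds R n n3.

Let n0 : n%:R != 0 :> R. Proof. by rewrite pnatr_eq0; (clear r0 h0 rh; lia). Qed.
Let nth : n%:R * th = pi. Proof. by rewrite /th mulrC divfK. Qed.

Let pE i : P i = (r * cos (i%:R * th), r * sin (i%:R * th), - ((-1) ^+ i * h)).
Proof. by []. Qed.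

Lemma vertex_periodic i : P (i + 2 * n) = P i.
Proof.
have E : (i + 2 * n)%:R * th = i%:R * th + pi *+ 2 by rewrite natrD natrM -nth; ring.
rewrite !pE E cosD2pi sinD2pi.
by rewrite exprD exprM -signr_odd/= sqrrN expr1n expr1n mulr1 signr_odd.
Qed.

Lemma vertex_S i : P i.+1 = std_mirror_rotation th (P i).
Proof. exact: antiprism_vertexS. Qed.

Definition std_antiprism : set (pt3 R) := hull (fun i : 'I_(2 * n) => P i).
Notation K := std_antiprism.

Lemma std_antiprism_vertex i : K (P i).
Proof.
have n20 : (0 < 2 * n)%N by (clear r0 h0 rh; lia).
have -> : P i = P (i %% (2 * n)).
  rewrite {1}(divn_eq i (2 * n)) addnC; elim: (i %/ _)%N => [|k IH]; first by rewrite addn0.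
  by rewrite [(k.+1 * _)%N]mulSnr addnA vertex_periodic.
exact: (hull_vertex (fun i : 'I_(2 * n) => P i) (Ordinal (ltn_pmod i n20))).
Qed.

Lemma vertex_H3 i : H3 (P i).
Proof. by rewrite /H3 /= dot_antiprism_vertex. Qed.

Lemma std_antiprism_H3 : K `<=` @H3 R.
Proof. by apply: hull_H3 => i; exact: vertex_H3. Qed.

Lemma std_antiprism_height p : K p -> - h <= p.2 <= h.
Proof.
move=> Kp; have B i : - h <= - ((-1) ^+ i * h) <= h.
  have h00 := h0; rewrite -signr_odd; case: (odd i); rewrite ?expr1 ?expr0; lra.
have := @hull_halfspace _ _ _ 0 0 1 h _ _ Kp.
have := @hull_halfspace _ _ _ 0 0 (-1) h _ _ Kp.
move=> H1 H2; apply/andP; split.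
  have : 0 * p.1.1 + 0 * p.1.2 + -1 * p.2 <= h; last by lra.
  by apply: H1 => i; have /andP[] := B i; rewrite pE /=; lra.
have : 0 * p.1.1 + 0 * p.1.2 + 1 * p.2 <= h; last by lra.
by apply: H2 => i; have /andP[] := B i; rewrite pE /=; lra.
Qed.

Let cos_le_q i : (0 < i < 2 * n)%N -> cos (i%:R * th) <= q.
Proof.
move=> /andP[i0 i2]; have /andP[t0 t1] := thb; have p0 := pi_gt0 R.
rewrite -subr_ge0.
have -> : q - cos (i%:R * th) = 2 * (sin ((i%:R + 1) * (th / 2)) * sin ((i%:R - 1) * (th / 2))).
  have -> : i%:R * th = (i%:R + 1) * (th / 2) + (i%:R - 1) * (th / 2) by field.
  have -> : q = cos ((i%:R + 1) * (th / 2) - (i%:R - 1) * (th / 2)) by congr (cos _); field.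
  by rewrite cosB cosD; ring.
have i1 : 1 <= i%:R :> R by rewrite ler1n.
have in2 : i%:R + 1 <= 2 * n%:R :> R by rewrite natr1 -natrM ler_nat; (clear r0 h0 rh; lia).
have npi : (2 * n%:R) * (th / 2) = pi by rewrite -[RHS]nth; field.
have t20 : 0 < th / 2 by lra.
have b : (i%:R + 1) * (th / 2) <= pi by rewrite -npi ler_pM2r.
have b' : (i%:R - 1) * (th / 2) <= pi by apply: le_trans b; rewrite ler_pM2r//; lra.
by rewrite mulr_ge0// mulr_ge0// sin_ge0_pi// ?b ?b' andbT mulr_ge0 ?(ltW t20)//; lra.
Qed.

(** The supporting plane of the lateral face spanned by the vertices -1, 0, 1, cut
    at height p.2. *)
Lemma std_antiprism_face p : K p -> p.1.1 <= slice_apothem r h q p.2.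
Proof.
move=> Kp; have /andP[q0 q1] := q01.
have hn : h != 0 by rewrite gt_eqF.
have := @hull_halfspace _ _ _ 1 0 (r * (1 - q) / (2 * h)) (r * (1 + q) / 2) _ _ Kp.
move=> H; have {H} : 1 * p.1.1 + 0 * p.1.2 + r * (1 - q) / (2 * h) * p.2 <= r * (1 + q) / 2.
  apply: H => i; rewrite pE /= mul0r addr0 mul1r mulrN.
  have -> : r * (1 - q) / (2 * h) * ((-1) ^+ i * h) = r * ((1 - q) / 2 * (-1) ^+ i) by field.
  rewrite -[X in _ <= X]mulrA -mulrBr ler_pM2l// -signr_odd.
  case oi: (odd i); last by rewrite expr0; have := cos_le1 (i%:R * th); lra.
  have : cos (i%:R * th) <= q.
    by apply: cos_le_q; rewrite ltn_ord andbT; case: (nat_of_ord i) oi.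
  by rewrite expr1; lra.
have -> : r * (1 - q) / (2 * h) * p.2 = r * (p.2 / h * ((1 - q) / 2)) by field.
by rewrite /slice_apothem /apothem; lra.
Qed.

(** The inverse of the mirror rotation. *)
Definition unrotate (p : pt3 R) : pt3 R := rot12 q (- s) (flip3 p).
(** The half-turn that exchanges the vertices [i] and [1 - i]. *)
Definition mirror (p : pt3 R) : pt3 R := flip3 (rot12 q s (flip2 p)).

Lemma motion_unrotate : motion unrotate.
Proof.
have qs' : q ^+ 2 + (- s) ^+ 2 = 1 by rewrite sqrrN qs.
exact: (motion_comp (motion_flip3 R) (motion_rot12 qs')).
Qed.

Lemma motion_mirror : motion mirror.
Proof.
exact: (motion_comp (motion_comp (motion_flip2 R) (motion_rot12 qs)) (motion_flip3 R)).
Qed.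

Let unrotateE p : unrotate p = (q * p.1.1 + s * p.1.2, q * p.1.2 - s * p.1.1, - p.2).
Proof. by rewrite /unrotate /rot12 /flip3 /=; congr (_, _, _); ring. Qed.

Let mirrorE p : mirror p = (p.1.1 * q + p.1.2 * s, p.1.1 * s - p.1.2 * q, - p.2).
Proof. by rewrite /mirror /rot12 /flip3 /flip2 /=; congr (_, _, _); ring. Qed.

Lemma unrotateK : cancel (std_mirror_rotation th) unrotate.
Proof.
move=> -[[x y] z]; rewrite unrotateE /std_mirror_rotation -/q -/s /= opprK; congr (_, _, _).
  by transitivity ((q ^+ 2 + s ^+ 2) * x); [ring|rewrite qs mul1r].
by transitivity ((q ^+ 2 + s ^+ 2) * y); [ring|rewrite qs mul1r].
Qed.

Lemma rotateK : cancel unrotate (std_mirror_rotation th).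
Proof.
move=> -[[x y] z]; rewrite unrotateE /std_mirror_rotation -/q -/s /= opprK; congr (_, _, _).
  by transitivity ((q ^+ 2 + s ^+ 2) * x); [ring|rewrite qs mul1r].
by transitivity ((q ^+ 2 + s ^+ 2) * y); [ring|rewrite qs mul1r].
Qed.

Lemma mirrorK : involutive mirror.
Proof.
move=> -[[x y] z]; rewrite !mirrorE /= opprK; congr (_, _, _).
  by transitivity ((q ^+ 2 + s ^+ 2) * x); [ring|rewrite qs mul1r].
by transitivity ((q ^+ 2 + s ^+ 2) * y); [ring|rewrite qs mul1r].
Qed.

Lemma std_antiprism_rotate p : K p -> K (std_mirror_rotation th p).
Proof.
apply: hull_image.
- move=> w; rewrite /std_mirror_rotation /lincomb /=; congr (_, _, _).
  + by rewrite !mulr_sumr -sumrB; apply: eq_bigr => i _; ring.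
  + by rewrite !mulr_sumr -big_split; apply: eq_bigr => i _ /=; ring.
  + by rewrite -sumrN; apply: eq_bigr => i _ /=; ring.
- by move=> i; rewrite -vertex_S; exact: std_antiprism_vertex.
Qed.

Lemma std_antiprism_unrotate p : K (unrotate p) <-> K p.
Proof.
split=> [/std_antiprism_rotate|]; first by rewrite rotateK.
apply: hull_image.
- move=> w; rewrite unrotateE /lincomb /=; congr (_, _, _).
  + by rewrite !mulr_sumr -big_split; apply: eq_bigr => i _; rewrite /=; ring.
  + by rewrite !mulr_sumr -sumrB; apply: eq_bigr => i _; rewrite /=; ring.
  + by rewrite -sumrN; apply: eq_bigr => i _; rewrite /=; ring.
- move=> i; rewrite -[P i]vertex_periodic.
  have -> : (i + 2 * n = (i + 2 * n).-1.+1)%N by (clear r0 h0 rh; lia).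
  by rewrite vertex_S unrotateK; exact: std_antiprism_vertex.
Qed.

Lemma std_antiprism_mirror p : K p -> K (mirror p).
Proof.
apply: hull_image.
- move=> w; rewrite mirrorE /lincomb /=; congr (_, _, _).
  + by rewrite !mulr_suml -big_split; apply: eq_bigr => i _; rewrite /=; ring.
  + by rewrite !mulr_suml -sumrB; apply: eq_bigr => i _; rewrite /=; ring.
  + by rewrite -sumrN; apply: eq_bigr => i _; rewrite /=; ring.
- move=> i; have -> : mirror (P i) = P (2 * n + 1 - i).
    have il := ltn_ord i.
    have E : (2 * n + 1 - i)%:R * th = (th - i%:R * th) + pi *+ 2.
      by rewrite natrB; [rewrite natrD natrM -nth; ring|(clear r0 h0 rh; lia)].
    rewrite mirrorE !pE /= E.
    rewrite cosD2pi sinD2pi cosB sinB -/q -/s; congr (_, _, _); [ring|ring|].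
    have -> : (-1) ^+ (2 * n + 1 - i) = - ((-1) ^+ i) :> R.
      rewrite -signr_odd oddB; last by (clear r0 h0 rh; lia).
      by rewrite oddD oddM /= -[in RHS]signr_odd; case: (odd i); rewrite ?expr0 ?expr1 ?opprK.
    by rewrite mulNr !opprK.
  exact: std_antiprism_vertex.
Qed.

(** The sums telescope: 2 sin (th / 2) cos x = sin (x + th / 2) - sin (x - th / 2). *)
Let sum_cos_shift (de : R) : \sum_(k < 2 * n) cos (k%:R * th + de) = 0.
Proof.
have /andP[t0 t1] := thb; have p0 := pi_gt0 R.
have s20 : sin (th / 2) != 0 by rewrite gt_eqF// sin_gt0_pi//; lra.
pose f (k : nat) := sin (k%:R * th + de - th / 2) / (2 * sin (th / 2)).
rewrite -(big_mkord xpredT (fun k => cos (k%:R * th + de))).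
rewrite (@telescope_sumr_eq _ _ _ f)//; last first.
  move=> k _; rewrite /f -mulrBl.
  have -> : k.+1%:R * th + de - th / 2 = (k%:R * th + de) + th / 2 by rewrite -natr1; field.
  by set x := k%:R * th + de; rewrite sinB sinD; field.
apply/eqP; rewrite subr_eq0; apply/eqP; rewrite /f; congr (_ / _).
have -> : (2 * n)%:R * th + de - th / 2 = (0%:R * th + de - th / 2) + pi *+ 2.
  by rewrite natrM -nth; ring.
by rewrite sinD2pi.
Qed.

Let alt_sum_cos_shift (de : R) : \sum_(k < 2 * n) (-1) ^+ k * cos (k%:R * th + de) = 0.
Proof.
have /andP[t0 t1] := thb; have p0 := pi_gt0 R.
have c20 : cos (th / 2) != 0 by rewrite gt_eqF// cos_gt0_pihalf//; lra.
pose f (k : nat) := - ((-1) ^+ k * (cos (k%:R * th + de - th / 2) / (2 * cos (th / 2)))).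
rewrite -(big_mkord xpredT (fun k => (-1) ^+ k * cos (k%:R * th + de))).
rewrite (@telescope_sumr_eq _ _ _ f)//; last first.
  move=> k _; rewrite /f exprS.
  have -> : k.+1%:R * th + de - th / 2 = (k%:R * th + de) + th / 2 by rewrite -natr1; field.
  by set x := k%:R * th + de; rewrite (cosB x) (cosD x); move: x => x; move: ((-1) ^+ k) => e; field.
apply/eqP; rewrite subr_eq0; apply/eqP; rewrite /f; congr (- _).
have -> : (2 * n)%:R * th + de - th / 2 = (0%:R * th + de - th / 2) + pi *+ 2.
  by rewrite natrM -nth; ring.
by rewrite cosD2pi exprM sqrrN !expr1n expr0.
Qed.

(** Equal weights on each face give the centres of the two faces, and weights
    depending only on the parity of the vertex the points between them. *)
Lemma std_antiprism_axis z : z \in `[- h, h] -> K (0, 0, z).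
Proof.
rewrite in_itv/= => /andP[z1 z2].
have u1 : -1 <= z / h <= 1 by rewrite ler_pdivlMr// ler_pdivrMr// mulN1r mul1r z1.
set u := z / h in u1.
have zE : z = u * h by rewrite /u divfK// gt_eqF.
have n20 : (2 * n)%:R != 0 :> R by rewrite pnatr_eq0; (clear r0 h0 rh; lia).
have vanish (g : nat -> R) : \sum_(i < 2 * n) g i = 0 -> \sum_(i < 2 * n) (-1) ^+ i * g i = 0 ->
    \sum_(i < 2 * n) (1 - u * (-1) ^+ i) / (2 * n)%:R * (r * g i) = 0.
  move=> g1 g2.
  transitivity (r / (2 * n)%:R * (\sum_(i < 2 * n) g i - u * \sum_(i < 2 * n) (-1) ^+ i * g i)).
    by rewrite mulr_sumr -sumrB mulr_sumr; apply: eq_bigr => i _; ring.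
  by rewrite g1 g2 mulr0 subr0 mulr0.
have ones : \sum_(i < 2 * n) 1 = (2 * n)%:R :> R by rewrite sumr_const card_ord.
have alts : \sum_(i < 2 * n) (-1) ^+ i = 0 :> R.
  elim: (n) => [|k IH]; first by rewrite big_ord0.
  by rewrite mulnS big_ord_recl big_ord_recl /= -[RHS]IH expr0 expr1 addrA subrr add0r; apply: eq_bigr => i _;
     rewrite /bump /= !add1n !exprS !mulN1r opprK.
exists (fun i : 'I_(2 * n) => (1 - u * (-1) ^+ i) / (2 * n)%:R); split.
- move=> i; rewrite divr_ge0// subr_ge0 -signr_odd.
  by case: (odd i); rewrite ?expr0 ?expr1; lra.
- by rewrite -mulr_suml sumrB ones -mulr_sumr alts mulr0 subr0 divff.
- congr (_, _, _) => /=; apply/esym.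
  + apply: (vanish (fun i => cos (angle R n i))).
      by rewrite -[RHS](sum_cos_shift 0); apply: eq_bigr => i _; rewrite addr0.
    by rewrite -[RHS](alt_sum_cos_shift 0); apply: eq_bigr => i _; rewrite addr0.
  + apply: (vanish (fun i => sin (angle R n i))).
      by rewrite -[RHS](sum_cos_shift (- (pi / 2))); apply: eq_bigr => i _; rewrite cosBpihalf.
    by rewrite -[RHS](alt_sum_cos_shift (- (pi / 2))); apply: eq_bigr => i _; rewrite cosBpihalf.
  + transitivity (h / (2 * n)%:R * (u * (\sum_(i < 2 * n) 1) - \sum_(i < 2 * n) (-1) ^+ i)).
      rewrite mulr_sumr -sumrB mulr_sumr; apply: eq_bigr => i _.
      have -> : (1 - u * (-1) ^+ i) / (2 * n)%:R * - ((-1) ^+ i * h) =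
        h / (2 * n)%:R * (u * (-1) ^+ i ^+ 2 - (-1) ^+ i) by ring.
      have -> : (-1) ^+ i ^+ 2 = 1 :> R by rewrite -exprM mulnC exprM sqrrN !expr1n.
      by [].
    by rewrite ones alts subr0 zE; field.
Qed.

(** The point lies in the triangle spanned by the axis and the side of the slice,
    whose end points are on the lateral edges through vertex 0. *)
Lemma std_antiprism_slice x y z : z \in `[- h, h] -> 0 < x <= slice_apothem r h q z ->
  0 <= y <= x * slice_slope h q s z -> K (x, y, z).
Proof.
move=> zh /andP[x0 xd] /andP[y0 yx].
have KA := std_antiprism_axis zh.
have /andP[q0 q1] := q01; have s0' := s0.
move: zh; rewrite in_itv/= => /andP[z1 z2].
have u1 : -1 <= z / h <= 1 by rewrite ler_pdivlMr// ler_pdivrMr// mulN1r mul1r z1.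
have zE : z = z / h * h by rewrite divfK// gt_eqF.
set u := z / h in u1 zE.
have a0 : 0 < apothem q u.
  by have := @apothem_bounds _ _ q01; rewrite -/q => /(_ u); rewrite in_itv/= u1 => /(_ isT); lra.
have d0 : 0 < slice_apothem r h q z by rewrite mulr_gt0.
have P0 : P 0 = (r, 0, - h) by rewrite pE !mul0r cos0 sin0 mulr1 mulr0 expr0 mul1r.
have P1 : P 1 = (r * q, r * s, h) by rewrite pE !mul1r expr1 mulN1r opprK.
have Pm : K (r * q, - (r * s), h).
  have := (std_antiprism_unrotate (P 0)).2 (std_antiprism_vertex 0).
  by rewrite unrotateE P0 /=; congr (hull _ (_, _, _)); ring.
pose t := (1 + u) / 2.
have ut : 0 <= t <= 1 by rewrite /t; lra.
have aE : slice_apothem r h q z = (1 - t) * r + t * (r * q).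
  by rewrite /slice_apothem /apothem -/u /t; field.
have sE : r * halfside s u = t * (r * s) by rewrite /halfside /t; field.
have zE' : z = (1 - t) * - h + t * h by rewrite {1}zE /t; field.
have KC : K (slice_apothem r h q z, r * halfside s u, z).
  have := hull_convex ut (std_antiprism_vertex 0) (std_antiprism_vertex 1).
  by rewrite P0 P1 /= -aE -zE' mulr0 add0r -sE.
have KC' : K (slice_apothem r h q z, - (r * halfside s u), z).
  have := hull_convex ut (std_antiprism_vertex 0) Pm.
  by rewrite P0 /= -aE -zE' mulr0 add0r mulrN -sE.
have si0 : 0 <= halfside s u by rewrite /halfside; nra.
set d := slice_apothem r h q z in xd d0 KC KC' *.
(* The point of the slice side on the ray from the axis through the given point. *)
pose w := y * d / x.
have wE : y = x / d * w by rewrite /w; field; rewrite !gt_eqF.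
have wb : 0 <= w <= r * halfside s u.
  apply/andP; split; first by rewrite divr_ge0 ?mulr_ge0// ltW.
  rewrite /w ler_pdivrMr//.
  have -> : r * halfside s u * x = x * slice_slope h q s z * d.
    by rewrite /slice_slope -/u /d /slice_apothem -/u; field; rewrite gt_eqF.
  by rewrite ler_pM2r.
have KB : K (d, w, z).
  have [sE0|sn] := eqVneq (r * halfside s u) 0.
    by move: KC; rewrite sE0; have -> // : w = 0 by move: wb; rewrite sE0; lra.
  have sp : 0 < r * halfside s u by rewrite lt0r sn mulr_ge0// ltW.
  pose t' := (1 + w / (r * halfside s u)) / 2.
  have tb : 0 <= t' <= 1.
    have : 0 <= w / (r * halfside s u) <= 1 by rewrite ler_pdivrMr// mul1r divr_ge0 ?(ltW sp)//; lra.
    by rewrite /t'; lra.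
  have := hull_convex tb KC' KC; rewrite /=.
  have -> : (1 - t') * d + t' * d = d by ring.
  have -> : (1 - t') * z + t' * z = z by ring.
  suff -> : (1 - t') * - (r * halfside s u) + t' * (r * halfside s u) = w by [].
  by rewrite /t'; move: (r * halfside s u) sn => a an; field.
have lb : 0 <= x / d <= 1 by rewrite ler_pdivrMr// mul1r xd divr_ge0// ltW.
have := hull_convex lb KA KB; rewrite /= !mulr0 !add0r -wE divfK ?gt_eqF//.
by have -> : (1 - x / d) * z + x / d * z = z by ring.
Qed.

End std_antiprism.

(** * Decomposition of the standard antiprism into sectors *)
Section polar.
Context (R : realType).
Implicit Types x y : R.

Lemma polar_coordinates x y : exists rho phi, [/\ 0 <= rho, 0 <= phi < pi *+ 2,
  x = rho * cos phi & y = rho * sin phi].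
Proof.
have p0 := pi_gt0 R.
have xy0 : 0 <= x ^+ 2 + y ^+ 2 by rewrite addr_ge0 ?sqr_ge0.
have [xy|xy] := eqVneq (x ^+ 2 + y ^+ 2) 0.
  exists 0, 0; rewrite !mul0r lexx mulrn_wgt0//.
  by move/eqP: xy; rewrite paddr_eq0 ?sqr_ge0// !sqrf_eq0 => /andP[/eqP-> /eqP->].
set r := Num.sqrt (x ^+ 2 + y ^+ 2).
have r0 : 0 < r by rewrite sqrtr_gt0 lt0r xy.
have rn : r != 0 by rewrite gt_eqF.
have r2 : r ^+ 2 = x ^+ 2 + y ^+ 2 by rewrite sqr_sqrtr.
have cE : 1 - (x / r) ^+ 2 = (y / r) ^+ 2.
  transitivity ((r ^+ 2 - x ^+ 2) / r ^+ 2); first by field.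
  by rewrite {1}r2; field.
have cb : -1 <= x / r <= 1.
  have : (x / r) ^+ 2 <= 1 by rewrite -subr_ge0 cE sqr_ge0.
  by rewrite -[X in _ <= X](expr1n _ 2) -ler_norml -(@ler_sqr _ `|_|) ?nnegrE// real_normK ?num_real.
have cK : cos (acos (x / r)) = x / r by rewrite acosK// in_itv.
have sE : sin (acos (x / r)) = `|y / r| by rewrite sin_acos// cE sqrtr_sqr.
have a0 := acos_ge0 cb; have a1 := acos_lepi cb.
have [y0|y0] := leP 0 y.
  exists r, (acos (x / r)); split; rewrite ?(ltW r0) ?a0 ?cK ?sE//.
  - by rewrite (le_lt_trans a1)//= mulr2n ltrDl.
  - by rewrite mulrC divfK.
  - by rewrite ger0_norm ?divr_ge0 ?(ltW r0)// mulrC divfK.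
exists r, (- acos (x / r) + pi *+ 2); rewrite cosD2pi sinD2pi cosN sinN cK sE; split.
- exact: ltW.
- have : acos (x / r) != 0.
    apply/eqP => E; move: sE; rewrite E sin0 => /esym/eqP.
    by rewrite normr_eq0 mulf_eq0 invr_eq0 (negPf rn) lt_eqF.
  move=> an; have : 0 < acos (x / r) by rewrite lt0r an.
  by rewrite mulr2n => a00; apply/andP; split; lra.
- by rewrite mulrC divfK.
- rewrite ltr0_norm; first by rewrite opprK mulrC divfK.
  by rewrite pmulr_llt0// invr_gt0.
Qed.

Lemma in_sector_angle (th be : R) : 0 < th < pi -> 0 <= be < pi *+ 2 ->
  0 <= sin be -> 0 < sin (th - be) -> be < th.
Proof.
move=> /andP[t0 t1] /andP[b0 b1] sb stb; rewrite ltNge; apply/negP => tb.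
have bp : be <= pi.
  rewrite leNgt; apply/negP => pb; have : 0 < sin (be - pi).
    by apply: sin_gt0_pi; rewrite subr_gt0 pb ltrBlDr -mulr2n.
  by rewrite sinB cospi sinpi mulr0 subr0 mulrN1; lra.
have : 0 <= sin (be - th) by apply: sin_ge0_pi; apply/andP; split; lra.
by rewrite -opprB sinN; lra.
Qed.

End polar.

Section volume.
Context (R : realType) (n : nat) (r h : R).
Hypothesis n3 : (3 <= n)%N.
Hypothesis r0 : 0 < r.
Hypothesis h0 : 0 < h.
Hypothesis rh : r ^+ 2 + h ^+ 2 < 1.
Notation R1 := (measurableTypeR R).
Notation R3 := (R1 * R1 * R1)%type.
Notation lam := (@lebesgue_measure R).

Let th : R := pi / n%:R.
Let q := cos th.
Let s := sin th.
Let K := std_antiprism n r h.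
Let un := @unrotate R n.
Let mi := @mirror R n.
Let HS := half_sector r h q s.

Let q01 : 0 < q < 1 := @cos_angle_bounds R n n3.
Let s0 : 0 < s := @sin_angle_gt0 R n n3.
Let qs : q ^+ 2 + s ^+ 2 = 1 := @cos_sin_angle R n.
Let thb : 0 < th < pi / 2 := @angle_bounds R n n3.
Let nth : n%:R * th = pi. Proof. by rewrite /th mulrC divfK// pnatr_eq0; clear r0 h0 rh; lia. Qed.

(** The half-open sector of angles from 0 to pi / n. *)
Definition sector : set (pt3 R) := [set p | 0 <= p.1.2 /\ p.1.2 * q < p.1.1 * s].

Let ub z : z \in `[- h, h] -> z / h \in `[-1, 1].
Proof. by rewrite !in_itv/= ler_pdivlMr// ler_pdivrMr// mulN1r mul1r. Qed.

Let apo_gt0 u : u \in `[-1, 1] -> 0 < apothem q u.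
Proof. by move=> /(apothem_bounds q01) /andP[+ _]; apply: lt_le_trans; case/andP: q01. Qed.

Let slope_le z : z \in `[- h, h] -> slice_slope h q s z <= s / q.
Proof.
move=> zh; have u1 := ub zh; have a0 := apo_gt0 u1; case/andP: q01 => qq0 qq1.
rewrite /slice_slope ler_pdivrMr// mulrAC ler_pdivlMr//.
move: (z / h) u1 {a0} => u; rewrite in_itv/= /halfside /apothem => /andP[u1 u2].
have -> : s * (1 + u) / 2 * q = s * ((1 + u) / 2 * q) by ring.
by rewrite ler_pM2l//; nra.
Qed.

Let half_sectorP b p : HS b p -> [/\ p.2 \in `[- h, h], 0 < p.1.1 <= slice_apothem r h q p.2,
  0 <= p.1.2 & p.1.2 <= p.1.1 * slice_slope h q s p.2].
Proof.
rewrite /HS /half_sector /= !in_itv/= => -[-> ->]; case: b => /= /andP[H1 H2]; split=> //; exact: ltW.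
Qed.

Let open_half_sector p : HS false p -> 0 < p.1.2.
Proof. by move=> [_ _]; rewrite in_itv/= => /andP[]. Qed.

Let half_sector_std b p : HS b p -> K p.
Proof.
case: p => -[x y] z /half_sectorP[/= zh xd y0 yx].
by apply: std_antiprism_slice => //; rewrite y0.
Qed.

Let miE p : mi p = (p.1.1 * q + p.1.2 * s, p.1.1 * s - p.1.2 * q, - p.2).
Proof. by rewrite /mi /mirror /rot12 /flip3 /flip2 -/th -/q -/s /=; congr (_, _, _); ring. Qed.

(** [mirror] maps the ray through the corner of a slice to the ray through the
    corner of the opposite slice, and so exchanges the two sides of it. *)
Let mirror_slope z x y : z \in `[- h, h] ->
  0 <= x * q + y * s ->
  (x * s - y * q <= (x * q + y * s) * slice_slope h q s (- z)) =
  (x * slice_slope h q s z <= y).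
Proof.
move=> zh _; have u1 := ub zh; have a0 := apo_gt0 u1.
have zh' : - z \in `[- h, h] by move: zh; rewrite !in_itv/= lerNr opprK lerNl andbC.
have a0' := apo_gt0 (ub zh').
rewrite /slice_slope mulNr in a0' *.
set u := z / h in u1 a0 a0' *.
rewrite !mulrA ler_pdivlMr// ler_pdivrMr//.
rewrite -subr_ge0 -[RHS]subr_ge0; congr (0 <= _).
rewrite /halfside /apothem; have s2 : s ^+ 2 = 1 - q ^+ 2 by have := qs; lra.
transitivity (y * (s ^+ 2 * (1 - u) / 2 + q * ((1 + q) / 2 + u * ((1 - q) / 2)))
  - x * s * (1 + u) / 2); first ring.
by rewrite s2; ring.
Qed.

Let sector_split : K `&` sector = HS true `|` mi @^-1` (HS false).
Proof.
case/andP: q01 => qq0 qq1.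
apply/seteqP; split => [p [Kp [/= y0 yx]]|p].
  have zh : p.2 \in `[- h, h] by rewrite in_itv/=; exact: std_antiprism_height Kp.
  have x0 : 0 < p.1.1.
    have : 0 < p.1.1 * s by apply: le_lt_trans yx; rewrite mulr_ge0// ltW.
    by rewrite pmulr_lgt0.
  have [lt|ge] := ltP p.1.2 (p.1.1 * slice_slope h q s p.2).
    left; rewrite /HS /half_sector /=; split => //.
      by rewrite in_itv/= x0; exact: std_antiprism_face Kp.
    by rewrite in_itv/= y0.
  right; change (HS false (mi p)); rewrite miE; split => /=.
  - by move: zh; rewrite !in_itv/= lerNr opprK lerNl andbC.
  - rewrite in_itv/= ltr_pwDl ?mulr_gt0//; last by rewrite mulr_ge0// ltW.
    by have := std_antiprism_face n3 r0 h0 (std_antiprism_mirror n3 Kp); rewrite -/mi miE.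
  - rewrite in_itv/= subr_gt0 yx /= mirror_slope//.
    by rewrite addr_ge0// mulr_ge0// ltW.
move=> [Hp|].
  split; first exact: half_sector_std Hp.
  have [zh /andP[x0 _] y0 _] := half_sectorP Hp; split => //.
  move: Hp => [_ _]; rewrite in_itv/= => /andP[_ yx].
  rewrite -ltr_pdivlMr// -mulrA; apply: lt_le_trans yx _.
  by rewrite ler_pM2l//; exact: slope_le.
move=> /= Hp; have Kp := half_sector_std Hp.
have pE : p = mi (mi p) by rewrite /mi mirrorK.
split; first by rewrite pE; exact: std_antiprism_mirror.
have [zh /andP[x0 _] y0 yx] := half_sectorP Hp.
have yx' : (mi p).1.2 * q <= (mi p).1.1 * s.
  rewrite -ler_pdivlMr// -mulrA; apply: le_trans yx _.
  by rewrite ler_pM2l//; exact: slope_le.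
split; first by rewrite pE miE /= subr_ge0.
by have := open_half_sector Hp; rewrite miE /= subr_gt0.
Qed.

Let H3K p : K p -> H3 p. Proof. exact: std_antiprism_H3. Qed.

Let mirror_half : mi @^-1` (HS false) = @H3 R `&` mi @^-1` (HS false).
Proof.
apply/seteqP; split => p /= => [Hp|[]//]; split => //; apply: H3K.
by have := std_antiprism_mirror n3 (half_sector_std Hp); rewrite mirrorK.
Qed.

Let mHS b : measurable (HS b : set R3).
Proof. exact: half_sector_measurable. Qed.

Let HS_H3 b : HS b `<=` @H3 R.
Proof. by move=> p /half_sector_std/H3K. Qed.

Let mdens (D : set R3) : measurable_fun D (fun p : R3 => (((1 - dot p p) ^+ 2)^-1)%:E).
Proof. by apply/measurable_EFinP; apply: measurable_funTS; exact: measurable_density. Qed.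

Let dens_ge0 (p : R3) : (0 <= (((1 - dot p p) ^+ 2)^-1)%:E :> \bar R)%E.
Proof. by rewrite lee_fin invr_ge0 sqr_ge0. Qed.

Let I := (\int[lam]_(u in `[(-1)%R, 1%R])
  (slice_density (r * Num.sqrt (1 - r ^+ 2 - h ^+ 2)^-1) q s (h * Num.sqrt (1 - r ^+ 2 - h ^+ 2)^-1) u)%:E)%E.

Let sector_volume : measurable (K `&` sector : set R3) /\ hvolume (K `&` sector) = I.
Proof.
have [mM vM] := motion_volume (motion_mirror R n) (@mHS false) (@HS_H3 false).
rewrite sector_split mirror_half; split; first exact: measurableU.
transitivity (hvolume (HS true) + hvolume (@H3 R `&` mi @^-1` (HS false)))%E.
  rewrite /hvolume ge0_integral_setU//.
  apply/disj_setPS => p [Hp]; rewrite -mirror_half /= => Hmp.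
  have [zh /andP[x0 _] y0 _] := half_sectorP Hp.
  have [_ /andP[mx0 _] _] := half_sectorP Hmp; rewrite miE /= mirror_slope//; last first.
    by move: mx0; rewrite miE /= => /ltW.
  by move: Hp => [_ _]; rewrite in_itv/= => /andP[_]; rewrite ltNge => /negP.
have vM' : hvolume (@H3 R `&` mi @^-1` (HS false)) = hvolume (HS false) := vM.
rewrite vM' !(@half_sector_volume R r h q s q01 s0 qs r0 h0 rh)// -/I -ge0_muleDl ?lee_fin ?invr_ge0 ?ler0n//.
by rewrite -EFinD (_ : 2^-1 + 2^-1 = 1) ?mul1e//; field.
Qed.

(** Preimages are intersected with the ball, as in [motion_volume]. *)
Let piece j := @H3 R `&` (iter j un) @^-1` (K `&` sector).

Let motion_iter j : motion (iter j un).
Proof.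
elim: j => [|j IH]; last exact: (motion_comp IH (motion_unrotate R n)).
split => //=.
- by move=> A mA AH; have -> : @H3 R `&` id @^-1` A = A by apply/seteqP; split => p => [[]|Ap] //; split => //; exact: AH.
Qed.

Let iter_K j p : K (iter j un p) <-> K p.
Proof. by elim: j => [//|j IH] /=; rewrite -IH; exact: std_antiprism_unrotate. Qed.

Let iter_polar j rho phi (z : R) : exists z', iter j un (rho * cos phi, rho * sin phi, z) =
  (rho * cos (phi - j%:R * th), rho * sin (phi - j%:R * th), z').
Proof.
elim: j => [|j [z' IH]]; first by exists z; rewrite mul0r subr0.
exists (- z'); rewrite iterS IH.
have -> : phi - j.+1%:R * th = (phi - j%:R * th) - th by rewrite -natr1; ring.
rewrite /un /unrotate /rot12 /flip3 -/th -/q -/s /=; move: (phi - j%:R * th) => a.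
by rewrite cosB sinB -/q -/s; congr (_, _, _); ring.
Qed.

Let in_sector rho be (z : R) : sector (rho * cos be, rho * sin be, z) <->
  0 <= rho * sin be /\ 0 < rho * sin (th - be).
Proof.
rewrite /sector /= sinB -/q -/s -subr_gt0.
by have -> : rho * cos be * s - rho * sin be * q = rho * (s * cos be - q * sin be) by ring.
Qed.

(** In polar coordinates the pieces are the half-open angular intervals of length
    pi / n, which makes both the covering and the disjointness evident. *)
Let in_piece j p rho phi : K p -> 0 <= rho -> 0 <= phi < pi *+ 2 -> (j < 2 * n)%N ->
  p.1.1 = rho * cos phi -> p.1.2 = rho * sin phi ->
  piece j p <-> 0 < rho /\ j%:R * th <= phi < (j%:R + 1) * th.
Proof.
case: p => -[x y] z /= Kp rho0 /andP[phi0 phi1] jn xE yE.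
have [z' E] := iter_polar j rho phi z.
have /andP[t0 t1] := thb; have p0 := pi_gt0 R.
have jth : (j%:R + 1) * th <= pi *+ 2.
  have jn1 : j%:R + 1 <= 2 * n%:R :> R by rewrite natr1 -natrM ler_nat.
  have -> : pi *+ 2 = 2 * n%:R * th :> R by rewrite -nth; ring.
  by rewrite ler_pM2r.
split => [[_ [_]]|[rho00 /andP[jp pj]]].
  rewrite xE yE E => /in_sector[s1 s2].
  have rho00 : 0 < rho.
    by rewrite lt0r rho0 andbT; apply/eqP => r00; move: s2; rewrite r00 mul0r ltxx.
  split => //; move: s1 s2; rewrite pmulr_rge0// pmulr_rgt0// => s1 s2.
  have tpi : 0 < th < pi by rewrite t0; lra.
  have [a0|a0] := leP 0 (phi - j%:R * th).
    have := @in_sector_angle _ th (phi - j%:R * th) tpi; rewrite a0 /= => H.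
    have {H} : phi - j%:R * th < th.
      apply: H => //; apply: le_lt_trans phi1; rewrite gerBl mulr_ge0//; exact: ltW.
    by move=> H; apply/andP; split; lra.
  have := @in_sector_angle _ th (phi - j%:R * th + pi *+ 2) tpi.
  have sE : sin (th - (phi - j%:R * th)) = sin (th - (phi - j%:R * th + pi *+ 2)).
    have -> : th - (phi - j%:R * th) = (th - (phi - j%:R * th + pi *+ 2)) + pi *+ 2 by ring.
    by rewrite sinD2pi.
  rewrite sinD2pi -sE.
  move=> H; have {H} : phi - j%:R * th + pi *+ 2 < th.
    by apply: H => //; apply/andP; split; lra.
  by move=> H; exfalso; lra.
split; first exact: H3K.
split; first by apply/iter_K.
rewrite xE yE E; apply/in_sector; rewrite pmulr_rge0// pmulr_rgt0//; split.
  by apply: sin_ge0_pi; apply/andP; split; lra.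
by apply: sin_gt0_pi; apply/andP; split; lra.
Qed.

Let piece_K j p : piece j p -> K p.
Proof. by move=> [_ [/iter_K]]. Qed.

Let axis : set (pt3 R) := [set p | [/\ p.1.1 = 0, p.1.2 = 0 & p.2 \in `[- h, h]]].

Let std_decomposition : K = axis `|` \big[setU/set0]_(j <- iota 0 (2 * n)) piece j.
Proof.
rewrite -bigcup_seq; apply/seteqP; split => [p Kp|p [[x0 y0 zh]|[j _ /piece_K//]]]; last first.
  by case: p x0 y0 zh => -[x y] z /= -> -> zh; exact: std_antiprism_axis.
have [rho [phi [rho0 phib xE yE]]] := polar_coordinates p.1.1 p.1.2.
have [r00|rn] := eqVneq rho 0.
  left; rewrite /axis /= xE yE r00 !mul0r; split => //.
  by rewrite in_itv/=; exact: std_antiprism_height Kp.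
have /andP[t0 t1] := thb; case/andP: (phib) => phi0 phi1.
right; pose j := Num.truncn (phi / th).
have /andP[j1 j2] := @truncn_itv _ (phi / th) (divr_ge0 phi0 (ltW t0)).
have jn : (j < 2 * n)%N.
  rewrite -(ltr_nat R); apply: le_lt_trans j1 _; rewrite ltr_pdivrMr//.
  by rewrite natrM -mulrA nth mulr_natl.
exists j; first by rewrite /= mem_iota.
apply/(in_piece Kp rho0 phib jn xE yE); split; first by rewrite lt0r rn.
by move: j1 j2; rewrite ler_pdivlMr// ltr_pdivrMr// -natr1 => -> ->.
Qed.

Let pieces_disjoint : trivIset [set` iota 0 (2 * n)] piece.
Proof.
move=> i j /=; rewrite !mem_iota /= !add0n => ib jb [p [pi_ pj]].
have Kp := piece_K pi_.
have [rho [phi [rho0 phib xE yE]]] := polar_coordinates p.1.1 p.1.2.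
have [_ /andP[i1 i2]] := (in_piece Kp rho0 phib ib xE yE).1 pi_.
have [_ /andP[j1 j2]] := (in_piece Kp rho0 phib jb xE yE).1 pj.
have /andP[t0 t1] := thb.
have le a b : a%:R * th <= phi -> phi < (b%:R + 1) * th -> (a <= b)%N.
  move=> H1 H2; have := le_lt_trans H1 H2.
  by rewrite ltr_pM2r// natr1 ltr_nat ltnS.
by apply/eqP; rewrite eqn_leq !le.
Qed.

Let piece_volume j : measurable (piece j : set R3) /\ hvolume (piece j) = I.
Proof.
have [mS vS] := sector_volume.
have SH : K `&` sector `<=` @H3 R by move=> p [/H3K].
by have [mP vP] := motion_volume (motion_iter j) mS SH; rewrite /piece vP.
Qed.

Let axis_null : measurable (axis : set R3) /\ hvolume axis = 0%E.
Proof.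
have c1 := @measurable_coord1 R; have c2 := @measurable_coord2 R; have c3 := @measurable_coord3 R.
have mA : measurable (axis : set R3).
  have -> : axis = [set p : R3 | p.1.1 <= 0] `&` [set p : R3 | 0 <= p.1.1] `&`
    [set p : R3 | p.1.2 <= 0] `&` [set p : R3 | 0 <= p.1.2] `&`
    [set p : R3 | - h <= p.2] `&` [set p : R3 | p.2 <= h].
    apply/seteqP; split => p; rewrite /axis /= in_itv/=.
      by move=> [-> -> /andP[-> ->]]; rewrite lexx.
    by move=> [[[[[a b] c] d] e] f]; split; [apply/eqP; rewrite eq_le a|apply/eqP; rewrite eq_le c|rewrite e].
  by do ![apply: measurableI]; apply: measurable_set_le.
split => //; rewrite hvolumeE//.
rewrite (integral3_zxy (measurable_density_restrict mA) (density_restrict_ge0 _)).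
rewrite integral0_eq// => z _; rewrite integral0_eq// => x _.
rewrite -[RHS](@integral_set1 R (fun y => ((EFin \o (@density R)) \_ axis) (x, y, z)) 0).
rewrite [RHS]integral_mkcond; apply: eq_integral => y _; rewrite [RHS]patchE.
case: ifPn => // /negP yn; rewrite patchE; case: ifPn => // ya; case: yn.
by move: ya; rewrite !inE /axis /= => -[_ ->].
Qed.

Let sum_const (l : seq nat) (c : \bar R) : (0 <= c)%E -> (\sum_(j <- l) c = (size l)%:R%:E * c)%E.
Proof.
move=> c0; elim: l => [|j l IH]; first by rewrite big_nil mul0e.
rewrite big_cons IH /= -natr1 EFinD ge0_muleDl ?lee_fin ?ler0n//.
by rewrite mul1e addeC.
Qed.

Lemma std_antiprism_measurable : measurable (K : set R3).
Proof.
rewrite std_decomposition; apply: measurableU; first exact: axis_null.1.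
by apply: bigsetU_measurable => j _; exact: (piece_volume j).1.
Qed.

Theorem std_antiprism_volume : (hvolume K = (2 * n)%:R%:E * I)%E.
Proof.
have [mA vA] := axis_null.
have mP j := (piece_volume j).1; have vP j := (piece_volume j).2.
have mU : measurable (\big[setU/set0]_(j <- iota 0 (2 * n)) piece j : set R3).
  by apply: bigsetU_measurable => j _; exact: mP.
have I0 : (0 <= I)%E by rewrite -(vP 0%N); apply: integral_ge0 => p _.
rewrite std_decomposition /hvolume ge0_integral_setU//; last first.
  apply/disj_setPS => p [[x0 y0 _]]; rewrite -bigcup_seq => -[j /=].
  rewrite mem_iota /= add0n => jb pj; have Kp := piece_K pj.
  have p0 := pi_gt0 R.
  have phib : (0 : R) <= (0 : R) < @pi R *+ 2 by rewrite lexx mulrn_wgt0.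
  have xE : p.1.1 = 0 * cos 0 by rewrite mul0r.
  have yE : p.1.2 = 0 * sin 0 by rewrite mul0r.
  by have [] := (in_piece Kp (lexx 0) phib jb xE yE).1 pj; rewrite ltxx.
rewrite -[X in (X + _)%E]/(hvolume axis) vA add0e ge0_integral_bigsetU//; last exact: iota_uniq.
transitivity (\sum_(j <- iota 0 (2 * n)) I)%E.
  by apply: eq_bigr => j _; exact: vP.
by rewrite sum_const// size_iota.
Qed.

End volume.

(** * The volume formula *)
Section normalized.
Context (R : realType) (n : nat) (r h : R).
Hypothesis rh : r ^+ 2 + h ^+ 2 < 1.
Let th : R := pi / n%:R.
Let X := (1 - r ^+ 2 - h ^+ 2)^-1.
Let b := r * Num.sqrt X.
Let h1 := h * Num.sqrt X.

Let X0 : 0 < 1 - r ^+ 2 - h ^+ 2. Proof. by have := rh; lra. Qed.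
Let b2 : b ^+ 2 = r ^+ 2 * X.
Proof. by rewrite /b exprMn sqr_sqrtr// invr_ge0 ltW. Qed.
Let h2 : h1 ^+ 2 = h ^+ 2 * X.
Proof. by rewrite /h1 exprMn sqr_sqrtr// invr_ge0 ltW. Qed.

Let dist_from0 p : dot p p = r ^+ 2 + h ^+ 2 ->
  cosh_dist (antiprism_vertex n r h 0) p = (1 - (r * p.1.1 - h * p.2)) * X.
Proof.
move=> pp; have P0 : antiprism_vertex n r h 0 = (r, 0, - h).
  by rewrite /antiprism_vertex /angle mul0r cos0 sin0 mulr1 mulr0 expr0 mul1r.
rewrite /cosh_dist P0 pp.
have -> : dot (r, 0, - h) (r, 0, - h) = r ^+ 2 + h ^+ 2 by rewrite /dot /=; ring.
have -> : 1 - (r ^+ 2 + h ^+ 2) = 1 - r ^+ 2 - h ^+ 2 by ring.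
rewrite -expr2 sqrtr_sqr gtr0_norm// -/X.
by rewrite /dot /=; congr (_ * X); ring.
Qed.

Lemma cosh_edge_base : cosh_dist (antiprism_vertex n r h 0) (antiprism_vertex n r h 2) =
  1 + 2 * (b * sin th) ^+ 2.
Proof.
have E : angle R n 2 = th *+ 2 by rewrite /angle -/th mulr_natl.
rewrite dist_from0 ?dot_antiprism_vertex// /antiprism_vertex E /=.
rewrite cos_mulr2n cos2sin2 sqrrN expr1n [(b * _) ^+ 2]exprMn b2 /X; field.
by rewrite gt_eqF.
Qed.

Lemma cosh_edge_lateral : cosh_dist (antiprism_vertex n r h 0) (antiprism_vertex n r h 1) =
  1 + 2 * sinh2_half_edge b (cos th) h1.
Proof.
have E : angle R n 1 = th by rewrite /angle -/th mul1r.
rewrite dist_from0 ?dot_antiprism_vertex// /antiprism_vertex E /=.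
by rewrite expr1 /sinh2_half_edge h2 b2 /X; field; rewrite gt_eqF.
Qed.

End normalized.

Theorem theorem3p5 (R : realType) (n : nat) (V : 'I_(2 * n) -> pt3 R)
    (a c c0 : R) (hn : (3 <= n)%N) (hV : antiprism V)
    (ha : forall i, hdist (V i) (V (ordS (ordS i))) = a)
    (hc : forall i, hdist (V i) (V (ordS i)) = c)
    (hc0 : 0 < c0)
    (hroot : 2 * cosh c0 * (1 + cos (pi / n%:R))
             = 1 + cosh a + 2 * cos (pi / n%:R)) :
  hvolume (hull V) =
  (n%:R%:E * \int[@lebesgue_measure R]_(t in `[c0, c])
    ((a * antiprism_G n a t + t * antiprism_H n a t) /
     ((2 * cosh t ^+ 2 - 1 - cosh a) * Num.sqrt (antiprism_R n a t)))%:E)%E.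
Proof.
have VH := ap_compact hV.
have [r [h [psi [r0 h0 mpsi psiV]]]] := antiprism_normal_form hn hV.
have n20 : (0 < 2 * n)%N by lia.
pose i0 := Ordinal n20.
have rh : r ^+ 2 + h ^+ 2 < 1.
  by rewrite -(dot_antiprism_vertex n r h i0) -psiV; exact: motion_H3 mpsi _ (VH i0).
set q := cos (pi / n%:R) in hroot; pose s : R := sin (pi / n%:R).
have q01 : 0 < q < 1 := cos_angle_bounds R hn.
have s0 : 0 < s := sin_angle_gt0 R hn.
have qs : q ^+ 2 + s ^+ 2 = 1 := cos_sin_angle R n.
have X0 : 0 < Num.sqrt (1 - r ^+ 2 - h ^+ 2)^-1 by rewrite sqrtr_gt0 invr_gt0; lra.
set b := r * Num.sqrt (1 - r ^+ 2 - h ^+ 2)^-1.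
set h1 := h * Num.sqrt (1 - r ^+ 2 - h ^+ 2)^-1.
have b0 : 0 < b by rewrite mulr_gt0.
have h10 : 0 < h1 by rewrite mulr_gt0.
have dV i j : hdist (V i) (V j) =
    arcosh (cosh_dist (antiprism_vertex n r h i) (antiprism_vertex n r h j)).
  by rewrite -!psiV (motion_dist mpsi).
have aE : a = arcosh (1 + 2 * (b * s) ^+ 2).
  rewrite -(ha i0) dV -cosh_edge_base//=.
  by rewrite (@modn_small 1) ?modn_small//; lia.
have cE : c = arcosh (1 + 2 * sinh2_half_edge b q h1).
  by rewrite -(hc i0) dV -cosh_edge_lateral//= modn_small//; lia.
have c0E : cosh c0 = 1 + 2 * sinh2_half_edge b q 0.
  have cha : cosh a = 1 + 2 * (b * s) ^+ 2.
    by rewrite aE arcoshK// lerDl mulr_ge0// sqr_ge0.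
  have q10 : 2 * (1 + q) != 0 by rewrite mulf_neq0// gt_eqF//; case/andP: q01; lra.
  (* Both sides are divided by 1 + q after s^2 = (1 - q) (1 + q) is inserted. *)
  apply: (mulIf q10).
  transitivity (1 + cosh a + 2 * q); first by rewrite -hroot; ring.
  have s2 : s ^+ 2 = 1 - q ^+ 2 by lra.
  by rewrite cha [(b * s) ^+ 2]exprMn s2 /sinh2_half_edge; field.
have volE : hvolume (hull V) = hvolume (std_antiprism n r h).
  have [_ <-] := motion_volume mpsi (std_antiprism_measurable hn r0 h0 rh) (std_antiprism_H3 rh).
  congr hvolume; apply/seteqP; split => p.
    move=> Vp; have Hp := hull_H3 VH Vp; split => //.
    move: Vp => /(motion_hull mpsi VH Hp).
    by congr (hull _ _); apply/funext => i; exact: psiV.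
  move=> [Hp Kp]; apply/(motion_hull mpsi VH Hp); move: Kp => /=.
  by congr (hull _ _); apply/funext => i; rewrite /= psiV.
rewrite volE std_antiprism_volume// -/q -/s -/b -/h1 natrM mulrC EFinM -muleA; congr (_ * _)%E.
have <- := @edge_length_integral R b q s q01 s0 qs b0 c0 h1 h10 hc0 c0E.
rewrite -cE -aE; apply: eq_integral => t _.
have cos2E : cos (2 * pi / n%:R) = 2 * q ^+ 2 - 1.
  by rewrite -mulrA mulr_natl cos_mulr2n -/q mulr_natl.
by rewrite /antiprism_G /antiprism_H /antiprism_R cos2E -/q.
Qed.
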